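(* Let $0<p<1$ and $\omega\in\widehat{\mathcal{D}}$. Then the following statements are equivalent: (i) $T(D^p_\omega,H^\infty)$ consists of constant functions only; (ii) $\displaystyle\sup_{0\le r<1}\frac{(1-r)^{2-\frac1p}}{\widehat{\omega}(r)^{\frac1p}}=\infty$; (iii) $\displaystyle\sup_{0\le r<1}\left((1-r)\sum_{k=1}^{\infty}\frac{r^{2(k-1)}}{\widehat{\omega}(1-\frac1k)^{\frac1p}k^{2-\frac1p}}\right)=\infty$; (iv) the identity map $I:D^p_\omega\to D^1_0$ is not bounded (i.e. $D^p_\omega$ is not continuously embedded in $D^1_0$).
   Context: $\mathbb{D}$ is the open unit disc, $\mathcal{H}(\mathbb{D})$ the analytic functions on it, $dA(z)=\frac{dx\,dy}{\pi}$. A radial weight is a non-negative $\omega\in L^1([0,1))$ extended by $\omega(z)=\omega(|z|)$; always assume $\widehat\omega(r)=\int_r^1\omega(s)\,ds>0$ for all $0\le r<1$ (and $\widehat\omega(z)=\widehat\omega(|z|)$). $\omega\in\widehat{\mathcal{D}}$ means there is $C\ge1$ with $\widehat\omega(r)\le C\widehat\omega(\frac{1+r}{2})$ for all $0\le r<1$. For $0<p<\infty$, $A^p_\omega$ is the space of $f\in\mathcal H(\mathbb D)$ with $\|f\|_{A^p_\omega}^p=\int_{\mathbb D}|f|^p\omega\,dA<\infty$, and the weighted Dirichlet space $D^p_\omega$ consists of $f\in\mathcal H(\mathbb D)$ with $\|f\|_{D^p_\omega}^p=\|f'\|^p_{A^p_\omega}+|f(0)|^p<\infty$. For $-1<\alpha<\infty$,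 $D^p_\alpha$ denotes $D^p_\omega$ with $\omega(z)=(\alpha+1)(1-|z|^2)^\alpha$; in particular $\|f\|_{D^1_0}=\int_{\mathbb D}|f'|\,dA+|f(0)|$. For $g\in\mathcal H(\mathbb D)$, $T_g(f)(z)=\int_0^z f(\zeta)g'(\zeta)\,d\zeta$. For a (quasi-)Banach space $X\subset\mathcal H(\mathbb D)$, $T(X,H^\infty)$ (resp. $T_c(X,H^\infty)$) is the set of $g\in\mathcal H(\mathbb D)$ such that $T_g:X\to H^\infty$ is bounded (resp. compact). *)

(* Defs.v *)
From HB Require Import structures.
From mathcomp Require Import all_boot all_order all_algebra.
From mathcomp Require Import all_classical all_reals all_analysis.
From mathcomp Require Import Rstruct Rstruct_topology.
From mathcomp Require Import complex.
Import Order.TTheory GRing.Theory Num.Theory.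
Import numFieldNormedType.Exports.

Set Implicit Arguments.
Unset Strict Implicit.
Unset Printing Implicit Defensive.

Local Open Scope ring_scope.
Local Open Scope classical_set_scope.

Notation RR := Rdefinitions.R.
Notation CC := (RR[i])^o.

Definition cabs (z : CC) : RR := Num.sqrt (complex.Re z ^+ 2 + complex.Im z ^+ 2).

Definition analytic_disc (f : CC -> CC) : Prop :=
  forall z : CC, cabs z < 1 -> derivable f z 1.

Definition cderiv (f : CC -> CC) (z : CC) : CC := 'D_1 f z.

Definition leb := (@lebesgue_measure RR).
Definition leb2 := (leb \x leb)%E.

Definition disc2 : set (RR * RR) := [set xy | xy.1 ^+ 2 + xy.2 ^+ 2 < 1].

Definition omega_hat (omega : RR -> RR) (r : RR) : RR :=
  Rintegral leb `[r, 1[ omega.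

Definition radial_weight (omega : RR -> RR) : Prop :=
  [/\ (forall r, 0 <= r < 1 -> 0 <= omega r),
      leb.-integrable `[0, 1[ (EFin \o omega) &
      (forall r, 0 <= r < 1 -> 0 < omega_hat omega r)].

Definition Dhat (omega : RR -> RR) : Prop :=
  exists C : RR, 1 <= C /\
    forall r, 0 <= r < 1 -> omega_hat omega r <= C * omega_hat omega ((1 + r) / 2).

(* \int_D |f'(z)|^p \omega(|z|) dA(z), dA = dx dy / pi  (value in \bar R) *)
Definition dirichlet_integral (p : RR) (omega : RR -> RR) (f : CC -> CC) : \bar RR :=
  (\int[leb2]_(xy in disc2)
     ((cabs (cderiv f (xy.1 +i* xy.2)%C)) `^ p
        * omega (Num.sqrt (xy.1 ^+ 2 + xy.2 ^+ 2)) / pi)%:E)%E.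

Definition in_Dp (p : RR) (omega : RR -> RR) (f : CC -> CC) : Prop :=
  analytic_disc f /\ (dirichlet_integral p omega f < +oo)%E.

Definition norm_Dp (p : RR) (omega : RR -> RR) (f : CC -> CC) : RR :=
  (fine (dirichlet_integral p omega f) + cabs (f 0) `^ p) `^ (p^-1).

(* D^1_0 : the weight (0+1)(1-|z|^2)^0 = 1, p = 1 *)
Definition omega_one : RR -> RR := fun _ => 1.

(* T_g f (z) = \int_0^z f(\zeta) g'(\zeta) d\zeta, along the segment [0,z]:
   = \int_0^1 f(tz) g'(tz) z dt  (real and imaginary parts) *)
Definition Tg (g f : CC -> CC) (z : CC) : CC :=
  let F := fun t : RR => f (t%:C%C * z) * cderiv g (t%:C%C * z) * z in
  (Rintegral leb `[0, 1] (fun t => complex.Re (F t)) +i*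
   Rintegral leb `[0, 1] (fun t => complex.Im (F t)))%C.

Definition T_Dp_Hinf (p : RR) (omega : RR -> RR) (g : CC -> CC) : Prop :=
  analytic_disc g /\
  exists K : RR, forall f, in_Dp p omega f ->
    forall z : CC, cabs z < 1 -> cabs (Tg g f z) <= K * norm_Dp p omega f.

Definition identity_bounded_Dp_D10 (p : RR) (omega : RR -> RR) : Prop :=
  exists K : RR, forall f, in_Dp p omega f ->
    in_Dp 1 omega_one f /\ norm_Dp 1 omega_one f <= K * norm_Dp p omega f.

(* Main.v *)
Require Import Defs.
From HB Require Import structures.
From mathcomp Require Import all_boot all_order all_algebra.
From mathcomp Require Import all_classical all_reals all_analysis.
From mathcomp Require Import Rstruct Rstruct_topology.
From mathcomp Require Import complex.
From mathcomp Require Import exp trigo measurable_realfun.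
From mathcomp Require Import ring lra.
Import Order.TTheory GRing.Theory Num.Theory.
Import numFieldNormedType.Exports.
Set Implicit Arguments.
Unset Strict Implicit.
Unset Printing Implicit Defensive.
Local Open Scope ring_scope.
Local Open Scope classical_set_scope.

(* Write W for [omega_hat omega] and phi(r) = (1-r)^(2-1/p) / W(r)^(1/p), so that (ii) says that phi is
   unbounded. The sum in (iii) averages phi(1-1/k) with weights (1-r) r^(2(k-1)) of total mass at most 1,
   and for r = 1-1/(8K) the indices K < k <= 2K carry a fixed part of that mass: hence (ii) <-> (iii).

   Suppose phi is bounded. Then p > 1/2 and W(r) >= c (1-r)^(2p-1). The circular means m(r) of |f'|^p
   increase with r, and an area estimate gives |f'(z)|^p <= 8 m(|z|+d)/d. Abel summation along
   r_k = 1-2^-k bounds the sum of m(r_k) 2^(-(2p-1)k) by the integral of m omega, and this controls both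
   the integral of |f'| over the disc and T_g f for g(z) = z, contradicting (iv) and (i).

   Conversely, for large n the functions F_b(z) = (1 - conj(b) z)^(-n-1) have norm at most
   C W(|b|)^(1/p) (1-|b|)^(1/p-n-2). If the embedding into D^1_0 is bounded, testing it on F_b bounds phi.
   If T_g is bounded with g' = z^N k and k(0) <> 0, averaging e^(-i(N+1)s) (T_g F_b)(b), b = a e^(is),
   over s replaces k by k(0), and again phi is bounded. *)

(** * Complex differentiability *)

(** Each of the four statements is compared with [phi_bounded]. The doubling condition serves only
    the norms of the test functions, where n must be large in terms of its constant C, so that
    (2/3)^s with s = (n+2)p - 1 beats C. The direction from a bounded phi rests on the growth of the
    circular means of |f'|^p. A general exponent would call for local logarithms of f'; since p >
    1/2 is forced, a square root is enough, and the zeros of f' are avoided by working with (|f'| +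
    eta)^p and letting eta tend to 0. Monotonicity in r then becomes a maximum principle in one real
    variable. Area integrals matter only up to constants, so polar coordinates may carry an
    unspecified factor kappa, provided that one kappa serves all functions. The dyadic sums close up
    because 1/p >= 1: a sum of powers y^(1/p) is at most the power of the sum, so a bound that is
    linear in the means of |f'|^p controls the sum of their powers 1/p. *)

Notation "x %:C" := (real_complex RR x : CC) : ring_scope.
Notation cRe := (@complex.Re RR).
Notation cIm := (@complex.Im RR).

Lemma cabsE (z : CC) : `|z| = (cabs z)%:C.
Proof. by rewrite normc_def. Qed.

Lemma cabs_ge0 (z : CC) : 0 <= cabs z.
Proof. exact: sqrtr_ge0. Qed.

Lemma cabsM (z w : CC) : cabs (z * w) = cabs z * cabs w.
Proof. by have := normrM z w; rewrite !cabsE -rmorphM /= => -[]. Qed.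

Lemma cabsD (z w : CC) : cabs (z + w) <= cabs z + cabs w.
Proof. by have := ler_normD z w; rewrite !cabsE -rmorphD /= lecR. Qed.

Lemma cabsN (z : CC) : cabs (- z) = cabs z.
Proof. by have := normrN z; rewrite !cabsE => -[]. Qed.

Lemma cabsB (z w : CC) : cabs (z - w) <= cabs z + cabs w.
Proof. by rewrite -(cabsN w) cabsD. Qed.

Lemma cabsC (z w : CC) : cabs (z - w) = cabs (w - z).
Proof. by rewrite -cabsN opprB. Qed.

Lemma cabs_leB (z w : CC) : cabs z - cabs w <= cabs (z - w).
Proof. by rewrite lerBlDr; rewrite -{1}[z](subrK w) cabsD. Qed.

Lemma cabs_distn (z w : CC) : `|cabs z - cabs w| <= cabs (z - w).
Proof. by rewrite ler_norml lerNl opprB {1}cabsC !cabs_leB. Qed.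

Lemma cabs0 : cabs 0 = 0.
Proof. by have := normr0 CC; rewrite cabsE => -[]. Qed.

Lemma cabs1 : cabs 1 = 1.
Proof. by have := normr1 CC; rewrite cabsE => -[]. Qed.

Lemma cabs_eq0 (z : CC) : (cabs z == 0) = (z == 0).
Proof. by rewrite -[RHS]normr_eq0 cabsE -(inj_eq (@complexI _)). Qed.

Lemma cabs_gt0 (z : CC) : (0 < cabs z) = (z != 0).
Proof. by rewrite lt0r cabs_ge0 andbT cabs_eq0. Qed.

Lemma cabsV (z : CC) : cabs z^-1 = (cabs z)^-1.
Proof. by have := normfV z; rewrite !cabsE -fmorphV => -[]. Qed.

Lemma cabsX (z : CC) n : cabs (z ^+ n) = cabs z ^+ n.
Proof. by elim: n => [|n IH]; rewrite ?expr0 ?cabs1// !exprS cabsM IH. Qed.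

Lemma cabsR (x : RR) : cabs x%:C = `|x|.
Proof. by rewrite /cabs /= expr0n addr0 sqrtr_sqr. Qed.

Lemma cabsR_ge0 (x : RR) : 0 <= x -> cabs x%:C = x.
Proof. by move=> x0; rewrite cabsR ger0_norm. Qed.

Lemma Re_le_cabs (z : CC) : `|cRe z| <= cabs z.
Proof. by rewrite -sqrtr_sqr ler_wsqrtr// lerDl sqr_ge0. Qed.

Lemma Im_le_cabs (z : CC) : `|cIm z| <= cabs z.
Proof. by rewrite -sqrtr_sqr ler_wsqrtr// lerDr sqr_ge0. Qed.

Lemma sqr_cabs (z : CC) : cabs z ^+ 2 = cRe z ^+ 2 + cIm z ^+ 2.
Proof. by rewrite sqr_sqrtr// addr_ge0// sqr_ge0. Qed.

Lemma cabs_le_ReIm (z : CC) : cabs z <= `|cRe z| + `|cIm z|.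
Proof.
rewrite -(ler_pXn2r (n := 2))// ?nnegrE ?cabs_ge0 ?addr_ge0//.
rewrite sqr_cabs -(real_normK (num_real (cRe z))) -(real_normK (num_real (cIm z))).
have := normr_ge0 (cRe z); have := normr_ge0 (cIm z); nra.
Qed.

Definition cconj (z : CC) : CC := (cRe z -i* cIm z)%C.

Lemma cabs_conj z : cabs (cconj z) = cabs z.
Proof. by rewrite /cabs /= sqrrN. Qed.

Lemma mulc_conj (z : CC) : z * cconj z = (cabs z ^+ 2)%:C.
Proof.
rewrite sqr_cabs; case: z => a b; rewrite /cconj /=; congr (_ +i* _)%C; ring.
Qed.

Lemma cReD (z w : CC) : cRe (z + w) = cRe z + cRe w.
Proof. by case: z w => [a b] [c d]. Qed.
Lemma cImD (z w : CC) : cIm (z + w) = cIm z + cIm w.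
Proof. by case: z w => [a b] [c d]. Qed.
Lemma cReN (z : CC) : cRe (- z) = - cRe z.
Proof. by case: z. Qed.
Lemma cImN (z : CC) : cIm (- z) = - cIm z.
Proof. by case: z. Qed.
Lemma cReB (z w : CC) : cRe (z - w) = cRe z - cRe w.
Proof. by rewrite cReD cReN. Qed.
Lemma cImB (z w : CC) : cIm (z - w) = cIm z - cIm w.
Proof. by rewrite cImD cImN. Qed.
Lemma cReM (z w : CC) : cRe (z * w) = cRe z * cRe w - cIm z * cIm w.
Proof. by case: z w => [a b] [c d]. Qed.
Lemma cImM (z w : CC) : cIm (z * w) = cRe z * cIm w + cIm z * cRe w.
Proof. by case: z w => [a b] [c d]. Qed.

Lemma RCeq (x y : RR) : (x +i* y)%C = x%:C + 'i%C * y%:C :> CC.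
Proof.
by rewrite [LHS]complexE.
Qed.

Lemma cReImE (z : CC) : z = (cRe z +i* cIm z)%C.
Proof. by case: z. Qed.

(** Differentiability with real radii and the quotient cleared: w = 0 needs no exclusion and every
    estimate is an inequality between real numbers. *)
Definition has_cderiv (f : CC -> CC) (z l : CC) : Prop :=
  forall e : RR, 0 < e -> exists2 d : RR, 0 < d &
    forall w, cabs w < d -> cabs (f (z + w) - f z - l * w) <= e * cabs w.

Lemma diff_quotE (w L A B : CC) : w != 0 -> w^-1 * (A - B) - L = (A - B - L * w) / w.
Proof. by move=> w0; field. Qed.

Lemma derivableP_cderiv (f : CC -> CC) z :
  derivable f z 1 -> has_cderiv f z (cderiv f z).
Proof.
rewrite /cderiv /derive => /cvgrPdist_le /= df e e0.
have e0' : (0 : CC) < e%:C by rewrite ltcR.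
have [d /= d0 H] := df _ e0'.
(* In the order of the complex numbers a positive element is real, so the radius [d] comes from a
   real number. *)
have [dr dE] : exists d' : RR, d = d'%:C.
  exists (cRe d); apply/esym/RRe_real; exact: gtr0_real.
exists dr; first by move: d0; rewrite dE ltcR.
move=> w wd; have [->|w0] := eqVneq w 0; first by rewrite mulr0 addr0 !subrr cabs0 mulr0.
have := H w; rewrite /= sub0r normrN dE cabsE ltcR => /(_ wd w0).
rewrite cabsE lecR => K.
rewrite -ler_pdivrMr ?cabs_gt0// -cabsV -cabsM.
move: K; rewrite cabsC; congr (cabs _ <= _).
rewrite [LHS](diff_quotE _ _ _ w0) (_ : w *: (1 : CC) = w) ?[w + z]addrC//; exact: mulr1.
Qed.

Lemma has_cderiv_derivable (f : CC -> CC) z l :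
  has_cderiv f z l -> derivable f z 1 /\ cderiv f z = l.
Proof.
move=> df.
have H : h^-1 *: ((f \o shift z) (h *: (1 : CC)) - f z) @[h --> (0:CC)^'] --> l.
  apply/cvgrPdist_le => /= e e0.
  have [er eE] : exists d' : RR, e = d'%:C.
    exists (cRe e); apply/esym/RRe_real; exact: gtr0_real.
  move: e0; rewrite eE ltcR => /df [d d0 H].
  exists d%:C => /=; first by rewrite ltcR.
  move=> w /=; rewrite sub0r normrN cabsE ltcR => /H {}H w0.
  rewrite cabsE lecR cabsC.
  move: H; rewrite -ler_pdivrMr ?cabs_gt0// -cabsV -cabsM.
  congr (cabs _ <= _).
  rewrite [RHS](diff_quotE _ _ _ w0) (_ : w *: (1 : CC) = w) ?[w + z]addrC//; exact: mulr1.
split; first by apply/cvg_ex; exists l.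
by apply: cvg_lim.
Qed.

Lemma has_cderivE f z l : has_cderiv f z l -> cderiv f z = l.
Proof. by move=> /has_cderiv_derivable []. Qed.

Lemma has_cderiv_ext (f g : CC -> CC) z l (r : RR) : 0 < r ->
  (forall w, cabs w < r -> f (z + w) = g (z + w)) -> has_cderiv f z l -> has_cderiv g z l.
Proof.
move=> r0 fg df e /df [d d0 H]; exists (Num.min d r); first by rewrite lt_min d0.
move=> w; rewrite lt_min => /andP[wd wr]; rewrite -fg// -[g z](_ : f z = _) ?H//.
by have := fg 0; rewrite addr0 cabs0 => ->.
Qed.

Lemma has_cderiv_cont (f : CC -> CC) z l : has_cderiv f z l ->
  forall e : RR, 0 < e -> exists2 d : RR, 0 < d &
    forall w, cabs w < d -> cabs (f (z + w) - f z) < e.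
Proof.
move=> /(_ 1 ltr01) [d d0 H] e e0.
exists (Num.min d (e / (1 + cabs l + 1))).
  rewrite lt_min d0 divr_gt0//; have := cabs_ge0 l; lra.
move=> w; rewrite lt_min ltr_pdivlMr; last by have := cabs_ge0 l; lra.
move=> /andP[/H {}H we].
have := cabsD (f (z + w) - f z - l * w) (l * w); rewrite subrK cabsM mul1r in H * => K.
have := cabs_ge0 w; nra.
Qed.

Lemma has_cderiv_cst (c : CC) z : has_cderiv (fun=> c) z 0.
Proof.
move=> e e0; exists 1 => // w _; rewrite subrr mul0r subr0 cabs0.
by rewrite mulr_ge0// ?cabs_ge0// ltW.
Qed.

Lemma has_cderiv_id z : has_cderiv id z 1.
Proof.
move=> e e0; exists 1 => // w _; rewrite mul1r [z + w]addrC addrK subrr cabs0.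
by rewrite mulr_ge0// ?cabs_ge0// ltW.
Qed.

Lemma has_cderivD f g z a b : has_cderiv f z a -> has_cderiv g z b ->
  has_cderiv (fun x => f x + g x) z (a + b).
Proof.
move=> df dg e e0.
have e20 : 0 < e / 2 by lra.
have [d1 d10 H1] := df _ e20; have [d2 d20 H2] := dg _ e20.
exists (Num.min d1 d2); first by rewrite lt_min d10.
move=> w; rewrite lt_min => /andP[/H1 {}H1 /H2 {}H2].
have -> : f (z + w) + g (z + w) - (f z + g z) - (a + b) * w =
  (f (z + w) - f z - a * w) + (g (z + w) - g z - b * w) by ring.
apply: le_trans (cabsD _ _) _; lra.
Qed.

Lemma has_cderivM f g z a b : has_cderiv f z a -> has_cderiv g z b ->
  has_cderiv (fun x => f x * g x) z (a * g z + f z * b).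
Proof.
move=> df dg e e0.
(* M dominates |f z|, |g z| and |b|; the summand e gives e / M <= 1, which keeps |f(z + w)| below
   M. *)
pose M := 1 + cabs (f z) + cabs (g z) + cabs b + e.
have M0 : 0 < M by rewrite /M; have := cabs_ge0 (f z); have := cabs_ge0 (g z);
  have := cabs_ge0 b; lra.
have M1 : e / M <= 1 by rewrite ler_pdivrMr// /M; have := cabs_ge0 (f z);
  have := cabs_ge0 (g z); have := cabs_ge0 b; lra.
have eM0 : 0 < e / (3 * M) by rewrite divr_gt0//; lra.
have [d1 d10 H1] := df _ eM0; have [d2 d20 H2] := dg _ eM0.
have [d3 d30 H3] := has_cderiv_cont df eM0.
exists (Num.min d1 (Num.min d2 d3)); first by rewrite !lt_min d10 d20.
move=> w; rewrite !lt_min => /and3P[/H1 {}H1 /H2 {}H2 /H3 {}H3].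
set F := f (z + w) in H1 H3 *; set G := g (z + w) in H2 *.
have -> : F * G - f z * g z - (a * g z + f z * b) * w =
  (F - f z - a * w) * g z + F * (G - g z - b * w) + (F - f z) * (b * w) by ring.
have HF : cabs F <= M.
  rewrite -[F](subrK (f z)); apply: le_trans (cabsD _ _) _.
  suff : e / (3 * M) <= 1 by rewrite /M; have := cabs_ge0 (g z); have := cabs_ge0 b; lra.
  rewrite ler_pdivrMr; last lra.
  by move: M1; rewrite ler_pdivrMr//; lra.
have Mg : cabs (g z) <= M by rewrite /M; have := cabs_ge0 (f z); have := cabs_ge0 b; lra.
have Mb : cabs b <= M by rewrite /M; have := cabs_ge0 (f z); have := cabs_ge0 (g z); lra.
have w0 := cabs_ge0 w.
have key (x y : RR) : 0 <= x -> 0 <= y -> x <= e / (3 * M) * cabs w -> y <= M ->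
    x * y <= e / 3 * cabs w.
  move=> x0 y0 xe yM; apply: (@le_trans _ _ (e / (3 * M) * cabs w * M)).
    by apply: ler_pM.
  rewrite le_eqVlt; apply/orP; left; apply/eqP; field; lra.
apply: le_trans (cabsD _ _) _.
apply: (@le_trans _ _ (e / 3 * cabs w + e / 3 * cabs w + e / 3 * cabs w)); last lra.
apply: lerD; first apply: le_trans (cabsD _ _) _; first apply: lerD.
- by rewrite cabsM key ?cabs_ge0.
- by rewrite cabsM mulrC key ?cabs_ge0.
- rewrite !cabsM mulrCA mulrC key ?cabs_ge0 ?mulr_ge0 ?cabs_ge0//.
  by apply: ler_wpM2r => //; exact: ltW.
Qed.

Lemma has_cderiv_comp f g z a b : has_cderiv g z a -> has_cderiv f (g z) b ->
  has_cderiv (fun x => f (g x)) z (b * a).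
Proof.
move=> dg df e e0.
pose M := 1 + cabs a + cabs b.
have a0 := cabs_ge0 a; have b0 := cabs_ge0 b.
have M0 : 0 < M by rewrite /M; lra.
have eM0 : 0 < e / (2 * M) by rewrite divr_gt0//; lra.
have [d1 d10 H1] := df _ eM0.
(* The entry 1 gives |g(z + w) - g z| <= M |w|; the other entry keeps the error of g small after
   multiplication by b. *)
have m0 : 0 < Num.min 1 (e / (2 * M)) by rewrite lt_min ltr01.
have [d2 d20 H2] := dg _ m0.
have [d3 d30 H3] := has_cderiv_cont dg d10.
exists (Num.min d2 d3); first by rewrite !lt_min d20.
move=> w; rewrite !lt_min => /andP[/H2 {}H2 /H3 {}H3].
have := H1 _ H3; rewrite [g z + _]addrC subrK => {}H1.
have w0 := cabs_ge0 w.
have Hg : cabs (g (z + w) - g z) <= M * cabs w.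
  rewrite -[_ - _](subrK (a * w)); apply: le_trans (cabsD _ _) _; rewrite cabsM.
  have : Num.min 1 (e / (2 * M)) <= 1 by rewrite ge_min lexx.
  rewrite /M; nra.
have Hm : Num.min 1 (e / (2 * M)) <= e / (2 * M) by rewrite ge_min lexx orbT.
have -> : f (g (z + w)) - f (g z) - b * a * w =
  (f (g (z + w)) - f (g z) - b * (g (z + w) - g z)) + b * (g (z + w) - g z - a * w) by ring.
apply: le_trans (cabsD _ _) _; rewrite (cabsM b).
have E : e = e / (2 * M) * M + M * (e / (2 * M)) by field; lra.
rewrite [leRHS](_ : _ = e / (2 * M) * (M * cabs w) + M * (e / (2 * M) * cabs w)); last first.
  by rewrite {1}E; ring.
apply: lerD.
  by apply: le_trans H1 _; rewrite ler_wpM2l// ltW.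
apply: ler_pM; rewrite ?cabs_ge0//; first by rewrite /M; lra.
by apply: le_trans H2 _; rewrite ler_wpM2r.
Qed.

Lemma has_cderivV z : z != 0 -> has_cderiv (fun x => x^-1) z (- z^-2).
Proof.
move=> z0 e e0; have z0' : 0 < cabs z by rewrite cabs_gt0.
have c30 : 0 < cabs z ^+ 3 by rewrite exprn_gt0.
exists (Num.min (cabs z / 2) (e * cabs z ^+ 3 / 2)).
  by rewrite lt_min !divr_gt0//= mulr_gt0.
move=> w; rewrite lt_min => /andP[w1 w2].
have zw : cabs z / 2 <= cabs (z + w).
  by have := cabs_leB z (- w); rewrite opprK cabsN; lra.
have zw0 : z + w != 0 by rewrite -cabs_gt0; lra.
have -> : (z + w)^-1 - z^-1 - - z^-2 * w = w * (w * ((z + w)^-1 * z^-2)).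
  by field; rewrite z0 zw0.
rewrite !cabsM mulrC ler_wpM2r ?cabs_ge0// !cabsV cabsX.
rewrite mulrA ler_pdivrMr ?exprn_gt0// ler_pdivrMr; last by rewrite cabs_gt0.
have : e * cabs z ^+ 3 / 2 <= e * cabs z ^+ 2 * cabs (z + w).
  rewrite [leLHS](_ : _ = e * cabs z ^+ 2 * (cabs z / 2)); last by field.
  by rewrite ler_wpM2l// mulr_ge0 ?sqr_ge0// ltW.
by move/(lt_le_trans w2)/ltW.
Qed.

Lemma has_cderivZ f z a c : has_cderiv f z a -> has_cderiv (fun x => c * f x) z (c * a).
Proof.
by move=> df; have := has_cderivM (has_cderiv_cst c z) df; rewrite mul0r add0r.
Qed.

Lemma has_cderivN f z a : has_cderiv f z a -> has_cderiv (fun x => - f x) z (- a).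
Proof.
move=> df; have := has_cderivZ (-1) df; rewrite mulN1r.
by apply: (has_cderiv_ext ltr01) => w _; rewrite mulN1r.
Qed.

Lemma has_cderivB f g z a b : has_cderiv f z a -> has_cderiv g z b ->
  has_cderiv (fun x => f x - g x) z (a - b).
Proof. by move=> df dg; exact: has_cderivD df (has_cderivN dg). Qed.

Lemma has_cderivX z n : has_cderiv (fun x => x ^+ n) z (n%:R * z ^+ n.-1).
Proof.
elim: n => [|n IH]; first by rewrite mul0r; exact: has_cderiv_cst.
have := has_cderivM (has_cderiv_id z) IH; rewrite [X in has_cderiv _ _ X](_ : _ = n.+1%:R * z ^+ n.+1.-1).
  by apply: (has_cderiv_ext ltr01) => w _; rewrite exprS.
case: n {IH} => [|n] /=; first by ring.
by rewrite !exprS -!natr1; ring.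
Qed.

(** * The exponential and the unit circle *)

Lemma rderiv_eps (R : realType) (f : R -> R) (x l : R) : is_derive x 1 f l ->
  forall e : R, 0 < e -> exists2 d : R, 0 < d &
    forall h, `|h| < d -> `|f (x + h) - f x - l * h| <= e * `|h|.
Proof.
move=> [dfx <-] e e0.
move: dfx; rewrite /derivable /derive => /cvgrPdist_le /= /(_ _ e0) [d /= d0 H].
exists d => // h hd; have [->|h0] := eqVneq h 0.
  by rewrite mulr0 addr0 !subrr normr0 mulr0.
have := H h; rewrite /= sub0r normrN => /(_ hd h0).
rewrite distrC /GRing.scale /= mulr1 [h + x]addrC => K.
rewrite -ler_pdivrMr ?normr_gt0// -normfV -normrM.
move: K; congr (`|_| <= _); set L := lim _; field; exact: h0.
Qed.

Lemma continuous_eps (R : realType) (f : R -> R) (x : R) :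
  (forall e : R, 0 < e -> exists2 d : R, 0 < d & forall h, `|h| < d -> `|f (x + h) - f x| < e) ->
  {for x, continuous f}.
Proof.
move=> H; apply/cvgrPdist_lt => /= e /H [d d0 {}H].
exists d => //= y xy; rewrite distrC -[y in f y](subrKC x); apply: H.
by rewrite distrC.
Qed.

Lemma eps_continuous (R : realType) (f : R -> R) (x : R) : {for x, continuous f} ->
  (forall e : R, 0 < e -> exists2 d : R, 0 < d & forall h, `|h| < d -> `|f (x + h) - f x| < e).
Proof.
move=> /cvgrPdist_lt H e /H [d /= d0 {}H].
exists d => // h hd; rewrite distrC; apply: H => /=.
by rewrite opprD addNKr normrN.
Qed.

Definition cexp (z : CC) : CC := (expR (cRe z))%:C * (cos (cIm z) +i* sin (cIm z))%C.

Lemma cexpD z w : cexp (z + w) = cexp z * cexp w.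
Proof.
rewrite /cexp; case: z w => [a b] [c d] /=.
rewrite expRD cosD sinD; congr (_ +i* _)%C; ring.
Qed.

Lemma cexp0 : cexp 0 = 1.
Proof. by rewrite /cexp /= expR0 cos0 sin0 mul1r. Qed.

Lemma cexp_neq0 z : cexp z != 0.
Proof.
apply/negP => /eqP z0; have := oner_neq0 CC; rewrite -cexp0 -(subrr z) cexpD z0 mul0r.
by rewrite subrr eqxx.
Qed.

Lemma cabs_cexp z : cabs (cexp z) = expR (cRe z).
Proof.
by rewrite cabsM cabsR_ge0 ?expR_ge0// /cabs /= cos2Dsin2 sqrtr1 mulr1.
Qed.

(** At 0 the real derivatives of exp, sin and cos suffice; the functional equation transports the
    result to all points in [has_cderiv_cexp]. *)
Lemma has_cderiv_cexp0 : has_cderiv cexp 0 1.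
Proof.
move=> e e0.
pose e' : RR := Num.min (e / 16) 1.
have e'0 : 0 < e' by rewrite lt_min divr_gt0//= ltr01.
have e'e : e' <= e / 16 by rewrite ge_min lexx.
have e'1 : e' <= 1 by rewrite ge_min lexx orbT.
clearbody e'.
have [d1 d10 H1] := rderiv_eps (is_derive_expR (0 : RR)) e'0.
have [d2 d20 H2] := rderiv_eps (is_derive_sin (0 : RR)) e'0.
have [d3 d30 H3] := rderiv_eps (is_derive_cos (0 : RR)) e'0.
exists (Num.min (Num.min (Num.min d1 d2) d3) e'); first by rewrite !lt_min d10 d20 d30 e'0.
move=> [s t]; rewrite !lt_min => /andP[/andP[/andP[w1 w2] w3] we].
have st := Re_le_cabs (s +i* t)%C; have tt := Im_le_cabs (s +i* t)%C.
rewrite /= in st tt.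
have {H1} := H1 _ (le_lt_trans st w1).
have {H2} := H2 _ (le_lt_trans tt w2).
have {H3} := H3 _ (le_lt_trans tt w3).
rewrite !add0r sin0 cos0 expR0 !oppr0 mul0r !mul1r ?addr0 ?subr0 => H3 H2 H1.
set W := cabs _ in st tt we w1 w2 w3 *.
have W0 : 0 <= W by exact: cabs_ge0.
apply: le_trans (cabs_le_ReIm _) _.
rewrite cexp0 /cexp /=.
have -> : expR s * cos t - 0 * sin t - 1 - s = expR s * (cos t - 1) + (expR s - 1 - s) by ring.
have -> : expR s * sin t + 0 * cos t - 0 - t = expR s * (sin t - t) + (expR s - 1) * t by ring.
have E1 : `|expR s - 1| <= 2 * W.
  rewrite -[expR s - 1](subrK s); apply: le_trans (ler_normD _ _) _.
  apply: le_trans (lerD H1 st) _; nra.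
have E2 : `|expR s| <= 3.
  rewrite -[expR s](subrK 1); apply: le_trans (ler_normD _ _) _; rewrite normr1; nra.
have A1 : `|expR s * (cos t - 1)| <= 3 * (e' * W).
  rewrite normrM ler_pM// (le_trans H3)// ler_wpM2l// ltW//.
have A2 : `|expR s * (sin t - t)| <= 3 * (e' * W).
  rewrite normrM ler_pM// (le_trans H2)// ler_wpM2l// ltW//.
have A3 : `|(expR s - 1) * t| <= 2 * W * e'.
  by rewrite normrM ler_pM// (le_trans tt)// ltW.
have A4 : `|expR s - 1 - s| <= e' * W by rewrite (le_trans H1)// ler_wpM2l// ltW.
apply: le_trans (lerD (ler_normD _ _) (ler_normD _ _)) _.
have : e' * W <= e / 16 * W by rewrite ler_wpM2r.
have : 0 <= e * W by rewrite mulr_ge0// ltW.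
by clear -A1 A2 A3 A4; lra.
Qed.

Lemma has_cderiv_cexp z : has_cderiv cexp z (cexp z).
Proof.
have := has_cderiv_cexp0 => H e e0.
have e1 : 0 < e / expR (cRe z) by rewrite divr_gt0 ?expR_gt0.
have [d d0 {}H] := H _ e1; exists d => // w /H.
rewrite add0r cexp0 mul1r cexpD => K.
have -> : cexp z * cexp w - cexp z - cexp z * w = cexp z * (cexp w - 1 - w) by ring.
rewrite cabsM cabs_cexp mulrC -ler_pdivlMr ?expR_gt0// mulrAC; exact: K.
Qed.

(** The unit circle is parametrised by [0, 1] instead of [0, 2 pi], so that normalised circle means
    are plain integrals over the unit interval. *)
Definition ecirc (t : RR) : CC := cexp (0 +i* (2 * pi * t))%C.

Lemma cabs_ecirc t : cabs (ecirc t) = 1.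
Proof. by rewrite cabs_cexp /= expR0. Qed.

Lemma ecirc_neq0 t : ecirc t != 0.
Proof. exact: cexp_neq0. Qed.

Lemma ecircD s t : ecirc (s + t) = ecirc s * ecirc t.
Proof. by rewrite /ecirc -cexpD; congr cexp; rewrite mulrDr; congr (_ +i* _)%C; rewrite addr0. Qed.

Lemma ecirc0 : ecirc 0 = 1.
Proof. by rewrite /ecirc mulr0 cexp0. Qed.

Lemma ecirc1 : ecirc 1 = 1.
Proof. by rewrite /ecirc /cexp mulr1 /= expR0 mul1r mulrC mulr_natr cos2pi sin2pi. Qed.

Lemma ecirc_periodic t : ecirc (t + 1) = ecirc t.
Proof. by rewrite ecircD ecirc1 mulr1. Qed.

Lemma ecirc_conj t : cconj (ecirc t) = (ecirc t)^-1.
Proof.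
apply: (mulfI (ecirc_neq0 t)); rewrite mulc_conj cabs_ecirc expr1n divff ?ecirc_neq0//.
Qed.

Lemma polarE (z : CC) : exists2 t : RR, 0 <= t <= 1 & z = (cabs z)%:C * ecirc t.
Proof.
have [->|z0] := eqVneq z 0.
  by exists 0; rewrite ?lexx ?ler01// cabs0 mul0r.
have r0 : 0 < cabs z by rewrite cabs_gt0.
have z2 := sqr_cabs z.
pose a := cRe z / cabs z; pose b := cIm z / cabs z.
have ab : a ^+ 2 + b ^+ 2 = 1.
  by rewrite /a /b !expr_div_n -mulrDl -z2 divff// expf_neq0// gt_eqF.
have a1 : -1 <= a <= 1.
  by rewrite -ler_norml -(ler_pXn2r (n := 2))// ?nnegrE// expr1n real_normK ?num_real// -ab lerDl sqr_ge0.
have zab : z = (cabs z)%:C * (a +i* b)%C.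
  by rewrite {1}[z]cReImE /a /b; congr (_ +i* _)%C; field; rewrite gt_eqF.
have p0 := pi_gt0 RR.
have ac0 := acos_ge0 a1; have acp := acos_lepi a1.
have sa : sin (acos a) = `|b|.
  by rewrite sin_acos// -sqrtr_sqr; congr Num.sqrt; lra.
have [b0|b0] := leP 0 b.
  exists (acos a / (2 * pi)).
    by rewrite divr_ge0 ?ler_pdivrMr//= ?mulr_ge0//; clear -p0 ac0 acp; lra.
  rewrite {1}zab /ecirc /cexp /= expR0 mul1r; congr (_ * (_ +i* _)%C).
    by rewrite mulrC divfK ?acosK//; lra.
  by rewrite mulrC divfK ?sa ?ger0_norm//; lra.
(* Below the real axis the angle is 2 pi - acos a, because sin (acos a) = |b| = -b. *)
exists (1 - acos a / (2 * pi)).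
  by rewrite subr_ge0 gerBl divr_ge0 ?ler_pdivrMr//= ?mulr_ge0 ?andbT//; clear -p0 ac0 acp; lra.
have E : 2 * pi * (1 - acos a / (2 * pi)) = - acos a + pi *+ 2 :> RR.
  by rewrite mulr2n; field; lra.
rewrite {1}zab /ecirc /cexp /= expR0 mul1r E cosD2pi sinD2pi cosN sinN sa acosK//.
by rewrite ltr0_norm// opprK.
Qed.

(** * Integrals over intervals *)

(** Two-sided continuity at every point, endpoints included: stronger than continuity on the
    interval, but stable under restriction and arithmetic without subspace topologies. *)
Definition cont_on (R : realType) (a b : R) (u : R -> R) : Prop :=
  forall t, a <= t <= b -> {for t, continuous u}.

Definition rint (R : realType) (a b : R) (u : R -> R) : R := Rintegral (@lebesgue_measure R) `[a, b] u.

Lemma cont_on_integrable (R : realType) (a b : R) (u : R -> R) : cont_on a b u -> (@lebesgue_measure R).-integrable `[a, b] (EFin \o u).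
Proof.
move=> H; apply: continuous_compact_integrable; first exact: segment_compact.
apply: continuous_in_subspaceT => t; rewrite inE /= in_itv /= => tab.
exact: H.
Qed.

Lemma eq_rint (R : realType) (a b : R) (u v : R -> R) : (forall t, a <= t <= b -> u t = v t) -> rint a b u = rint a b v.
Proof.
move=> uv; apply: eq_Rintegral => t; rewrite inE /= in_itv /=; exact: uv.
Qed.

Lemma leb_itvcc (R : realType) (a b : R) : a <= b -> lebesgue_measure `[a, b] = (b - a)%:E.
Proof.
move=> ab; rewrite [LHS](@lebesgue_measure_itv R `[a, b]%R) /= lte_fin.
case: ltP => // ba; have -> : a = b by apply/eqP; rewrite eq_le ab ba.
by rewrite subrr.
Qed.

Lemma rint_cst (R : realType) (a b c : R) : a <= b -> rint a b (fun=> c) = c * (b - a).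
Proof. by move=> ab; rewrite /rint Rintegral_cst//; congr (_ * _); exact: (congr1 fine (leb_itvcc ab)). Qed.

Lemma rintD (R : realType) (a b : R) (u v : R -> R) : cont_on a b u -> cont_on a b v ->
  rint a b (fun t => u t + v t) = rint a b u + rint a b v.
Proof. by move=> cu cv; rewrite /rint RintegralD//; exact: cont_on_integrable. Qed.

Lemma rintB (R : realType) (a b : R) (u v : R -> R) : cont_on a b u -> cont_on a b v ->
  rint a b (fun t => u t - v t) = rint a b u - rint a b v.
Proof. by move=> cu cv; rewrite /rint RintegralB//; exact: cont_on_integrable. Qed.

Lemma rintZ (R : realType) (a b c : R) (u : R -> R) : cont_on a b u -> rint a b (fun t => c * u t) = c * rint a b u.
Proof. by move=> cu; rewrite /rint RintegralZl//; exact: cont_on_integrable. Qed.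

Lemma le_rint (R : realType) (a b : R) (u v : R -> R) : cont_on a b u -> cont_on a b v ->
  (forall t, a <= t <= b -> u t <= v t) -> rint a b u <= rint a b v.
Proof.
move=> cu cv uv; apply: le_Rintegral => //; try exact: cont_on_integrable.
Qed.

Lemma rint_ge0 (R : realType) (a b : R) (u : R -> R) : (forall t, a <= t <= b -> 0 <= u t) -> 0 <= rint a b u.
Proof. by move=> u0; apply: Rintegral_ge0 => t /=; rewrite in_itv /=; exact: u0. Qed.

Lemma cont_cst (R : realType) (a b c : R) : cont_on a b (fun=> c).
Proof. by move=> t _; exact: cst_continuous. Qed.

Lemma contD (R : realType) (a b : R) (u v : R -> R) : cont_on a b u -> cont_on a b v -> cont_on a b (fun t => u t + v t).
Proof. by move=> cu cv t tab; apply: continuousD; [exact: cu|exact: cv]. Qed.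

Lemma contM (R : realType) (a b : R) (u v : R -> R) : cont_on a b u -> cont_on a b v -> cont_on a b (fun t => u t * v t).
Proof. by move=> cu cv t tab; apply: continuousM; [exact: cu|exact: cv]. Qed.

Lemma rint_abs_le (R : realType) (a b : R) (u : R -> R) M : a <= b -> cont_on a b u ->
  (forall t, a <= t <= b -> `|u t| <= M) -> `|rint a b u| <= M * (b - a).
Proof.
move=> ab cu uM; rewrite ler_norml -mulNr -!rint_cst//.
by apply/andP; split; (apply: le_rint; [first [exact: cont_cst|exact: cu]|first [exact: cont_cst|exact: cu]|]) => t /uM;
  rewrite ler_norml => /andP[].
Qed.

Lemma rint_split (R : realType) (a b c : R) (u : R -> R) : a <= b -> b <= c -> cont_on a c u ->
  rint a c u = rint a b u + rint b c u.
Proof.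
move=> ab bc cu; have := @Rintegral_itvB R u (BLeft a) (BRight c) b.
move=> /(_ (cont_on_integrable cu)); rewrite !bnd_simp => /(_ ab bc).
rewrite Rintegral_itv_obnd_cbnd.
  by move=> /eqP; rewrite subr_eq addrC => /eqP.
apply: integrableS (cont_on_integrable cu) => //.
by apply: subset_itv; rewrite bnd_simp.
Qed.

Lemma rint_shift (R : realType) (a b s : R) (u : R -> R) : a <= b -> cont_on (a + s) (b + s) u ->
  rint a b (fun t => u (t + s)) = rint (a + s) (b + s) u.
Proof.
move=> ab cu; rewrite /rint /Rintegral.
have D1 : (fun t : R => t + s)^`() = cst 1.
  by apply/funext => z; rewrite derive1E deriveD ?derive_id ?derive_cst ?addr0.
rewrite (@integration_by_substitution_increasing R (fun t => t + s) u a b)//.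
- congr fine; apply: eq_integral => t _; congr EFin.
  by rewrite /= D1 /= mulr1.
- by move=> x y _ _; rewrite ltrD2r.
- by move=> x _; rewrite D1; exact: cst_continuous.
- by rewrite D1; apply: is_cvg_cst.
- by rewrite D1; apply: is_cvg_cst.
- split.
  + by move=> x _; apply: derivableD => //; exact: derivable_cst.
  + by apply: cvg_at_right_filter; apply: cvgD => //; exact: cvg_cst.
  + by apply: cvg_at_left_filter; apply: cvgD => //; exact: cvg_cst.
- apply: continuous_in_subspaceT => t; rewrite inE /= in_itv /= => tab.
  exact: cu.
Qed.

Definition mean (R : realType) (u : R -> R) : R := rint 0 1 u.

(** The shifted period [s, 1 + s] is cut at 1, and periodicity moves the piece [1, 1 + s] back to
    [0, s]. *)
Lemma mean_shift (R : realType) (u : R -> R) (s : R) : continuous u -> (forall t, u (t + 1) = u t) -> 0 <= s <= 1 ->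
  mean (fun t => u (t + s)) = mean u.
Proof.
move=> cu pu /andP[s0 s1].
have cu' a b : cont_on a b u by move=> t _; exact: cu.
rewrite /mean rint_shift// add0r (@rint_split _ s 1 (1 + s))//; last by lra.
rewrite (@rint_split _ 0 s 1)// [RHS]addrC; congr (_ + _).
have -> : rint 1 (1 + s) u = rint (0 + 1) (s + 1) u by rewrite add0r [s + 1]addrC.
rewrite -rint_shift//; apply: eq_rint => t _; exact: pu.
Qed.

(** * Continuity and integrals of complex-valued functions of a real variable *)

Definition ccont (F : RR -> CC) (t : RR) : Prop :=
  forall e : RR, 0 < e -> exists2 d : RR, 0 < d &
    forall h : RR, `|h| < d -> cabs (F (t + h) - F t) < e.

Lemma ccont_comp_lip (f : CC -> CC) (g : RR -> CC) (t L : RR) l : has_cderiv f (g t) l ->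
  (forall s, cabs (g s - g t) <= L * `|s - t|) -> ccont (fun s => f (g s)) t.
Proof.
move=> df gL e /(has_cderiv_cont df) [d d0 H].
have L0 : 0 <= L.
  by have := gL (t + 1); rewrite [t + 1]addrC addrK normr1 mulr1; apply: le_trans; exact: cabs_ge0.
have L1 : 0 < L + 1 by lra.
exists (d / (L + 1)); first by rewrite divr_gt0.
move=> h; rewrite ltr_pdivlMr// => hd.
rewrite -[g (t + h)](subrKC (g t)); apply: H.
apply: le_lt_trans (gL _) _; rewrite [t + h]addrC addrK.
have := normr_ge0 h; nra.
Qed.

Lemma ccont_Re F t : ccont F t -> {for t, continuous (fun s => cRe (F s))}.
Proof.
move=> cF; apply: continuous_eps => e /cF [d d0 H]; exists d => // h /H {}H.
by rewrite -cReB; apply: le_lt_trans (Re_le_cabs _) H.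
Qed.

Lemma ccont_Im F t : ccont F t -> {for t, continuous (fun s => cIm (F s))}.
Proof.
move=> cF; apply: continuous_eps => e /cF [d d0 H]; exists d => // h /H {}H.
by rewrite -cImB; apply: le_lt_trans (Im_le_cabs _) H.
Qed.

Lemma ccont_cabs F t : ccont F t -> {for t, continuous (fun s => cabs (F s))}.
Proof.
move=> cF; apply: continuous_eps => e /cF [d d0 H]; exists d => // h /H {}H.
by apply: le_lt_trans (cabs_distn _ _) H.
Qed.

Lemma ccontP F t : {for t, continuous (fun s => cRe (F s))} ->
  {for t, continuous (fun s => cIm (F s))} -> ccont F t.
Proof.
move=> /eps_continuous cR /eps_continuous cI e e0.
have e2 : 0 < e / 2 by lra.
have [d d0 H] := cR _ e2; have [d' d'0 H'] := cI _ e2.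
exists (Num.min d d'); first by rewrite lt_min d0.
move=> h; rewrite lt_min => /andP[/H {}H /H' {}H'].
by apply: le_lt_trans (cabs_le_ReIm _) _; rewrite cReB cImB; lra.
Qed.

Lemma ccont_cst c t : ccont (fun=> c) t.
Proof. by move=> e e0; exists 1 => // h _; rewrite subrr cabs0. Qed.

Lemma cont_ext (R : realType) (u v : R -> R) (t : R) : u =1 v ->
  {for t, continuous u} -> {for t, continuous v}.
Proof. by move=> /funext ->. Qed.

Lemma contD_at (R : realType) (u v : R -> R) (t : R) : {for t, continuous u} ->
  {for t, continuous v} -> {for t, continuous (fun s => u s + v s)}.
Proof. by move=> cu cv; apply: continuousD. Qed.

Lemma contB_at (R : realType) (u v : R -> R) (t : R) : {for t, continuous u} ->
  {for t, continuous v} -> {for t, continuous (fun s => u s - v s)}.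
Proof. by move=> cu cv; apply: continuousB. Qed.

Lemma contM_at (R : realType) (u v : R -> R) (t : R) : {for t, continuous u} ->
  {for t, continuous v} -> {for t, continuous (fun s => u s * v s)}.
Proof. by move=> cu cv; apply: continuousM. Qed.

Lemma ccontD F G t : ccont F t -> ccont G t -> ccont (fun s => F s + G s) t.
Proof.
move=> cF cG; apply: ccontP.
  apply: (@cont_ext RR _ _ _ (fun s => esym (cReD (F s) (G s)))).
  by apply: (@contD_at RR); apply: ccont_Re.
apply: (@cont_ext RR _ _ _ (fun s => esym (cImD (F s) (G s)))).
by apply: (@contD_at RR); apply: ccont_Im.
Qed.

Lemma ccontM F G t : ccont F t -> ccont G t -> ccont (fun s => F s * G s) t.
Proof.
move=> cF cG.
have cFR := ccont_Re cF; have cFI := ccont_Im cF.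
have cGR := ccont_Re cG; have cGI := ccont_Im cG.
apply: ccontP.
  apply: (@cont_ext RR (fun s => cRe (F s) * cRe (G s) - cIm (F s) * cIm (G s))) => [s|].
    by rewrite cReM.
  by apply: (@contB_at RR); apply: (@contM_at RR).
apply: (@cont_ext RR (fun s => cRe (F s) * cIm (G s) + cIm (F s) * cRe (G s))) => [s|].
  by rewrite cImM.
by apply: (@contD_at RR); apply: (@contM_at RR).
Qed.

Lemma ccontN F t : ccont F t -> ccont (fun s => - F s) t.
Proof.
move=> cF e /cF [d d0 H]; exists d => // h /H.
by rewrite -opprD cabsN.
Qed.

Lemma ccontB F G t : ccont F t -> ccont G t -> ccont (fun s => F s - G s) t.
Proof. by move=> cF cG; exact: ccontD cF (ccontN cG). Qed.

Definition ccont_on (a b : RR) (F : RR -> CC) := forall t, a <= t <= b -> ccont F t.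

Lemma ccont_on_Re a b F : ccont_on a b F -> cont_on a b (fun t => cRe (F t)).
Proof. by move=> cF t /cF /ccont_Re. Qed.
Lemma ccont_on_Im a b F : ccont_on a b F -> cont_on a b (fun t => cIm (F t)).
Proof. by move=> cF t /cF /ccont_Im. Qed.
Lemma ccont_on_cabs a b F : ccont_on a b F -> cont_on a b (fun t => cabs (F t)).
Proof. by move=> cF t /cF /ccont_cabs. Qed.
Lemma ccont_onB a b F G : ccont_on a b F -> ccont_on a b G -> ccont_on a b (fun t => F t - G t).
Proof. by move=> cF cG t tab; apply: ccontB; [exact: cF|exact: cG]. Qed.
Lemma ccont_onM a b F G : ccont_on a b F -> ccont_on a b G -> ccont_on a b (fun t => F t * G t).
Proof. by move=> cF cG t tab; apply: ccontM; [exact: cF|exact: cG]. Qed.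
Lemma ccont_on_cst a b c : ccont_on a b (fun=> c).
Proof. by move=> t _; exact: ccont_cst. Qed.

Definition cint (a b : RR) (F : RR -> CC) : CC :=
  (rint a b (fun t => cRe (F t)) +i* rint a b (fun t => cIm (F t)))%C.

Lemma eq_cint a b F G : (forall t, a <= t <= b -> F t = G t) -> cint a b F = cint a b G.
Proof. by move=> FG; rewrite /cint; congr (_ +i* _)%C; apply: eq_rint => t /FG ->. Qed.

Lemma cint_cst a b c : a <= b -> cint a b (fun=> c) = c * (b - a)%:C.
Proof.
move=> ab; rewrite /cint !rint_cst//; case: c => x y; rewrite /=; congr (_ +i* _)%C; ring.
Qed.

Lemma cintB a b F G : ccont_on a b F -> ccont_on a b G ->
  cint a b (fun t => F t - G t) = cint a b F - cint a b G.
Proof.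
move=> cF cG; rewrite /cint.
rewrite (_ : (fun t => cRe (F t - G t)) = (fun t => cRe (F t) - cRe (G t))); last first.
  by apply/funext => t; rewrite cReB.
rewrite (_ : (fun t => cIm (F t - G t)) = (fun t => cIm (F t) - cIm (G t))); last first.
  by apply/funext => t; rewrite cImB.
by rewrite !rintB; try exact: ccont_on_Re; try exact: ccont_on_Im.
Qed.

Lemma cintZ a b c F : ccont_on a b F -> cint a b (fun t => c * F t) = c * cint a b F.
Proof.
move=> cF; have cR := ccont_on_Re cF; have cI := ccont_on_Im cF.
have cc := @cont_cst RR a b; rewrite /cint.
rewrite (_ : (fun t => cRe (c * F t)) = (fun t => cRe c * cRe (F t) - cIm c * cIm (F t))); last first.
  by apply/funext => t; rewrite cReM.
rewrite (_ : (fun t => cIm (c * F t)) = (fun t => cRe c * cIm (F t) + cIm c * cRe (F t))); last first.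
  by apply/funext => t; rewrite cImM.
rewrite rintB ?rintD ?rintZ//; try by apply: contM.
by case: c.
Qed.

Lemma cint_split a b c F : a <= b -> b <= c -> ccont_on a c F ->
  cint a c F = cint a b F + cint b c F.
Proof.
move=> ab bc cF; rewrite /cint (@rint_split _ a b c)//; last exact: ccont_on_Re.
by rewrite [rint a c _](@rint_split _ a b c)//; exact: ccont_on_Im.
Qed.

(** A unimodular constant u rotates the integral onto the positive real axis; then only the real
    part of u F matters, and it is at most |F|. *)
Lemma cint_triangle a b F : a <= b -> ccont_on a b F ->
  cabs (cint a b F) <= rint a b (fun t => cabs (F t)).
Proof.
move=> ab cF; set I := cint a b F.
have [->|I0] := eqVneq I 0.
  by rewrite cabs0 rint_ge0// => t _; exact: cabs_ge0.
have I0' : 0 < cabs I by rewrite cabs_gt0.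
pose u := (cabs I)^-1%:C * cconj I.
have cu : cabs u = 1.
  by rewrite cabsM cabs_conj cabsR_ge0 ?invr_ge0 ?cabs_ge0// mulVf ?gt_eqF.
have -> : cabs I = cRe (u * I).
  rewrite -mulrA [cconj I * I]mulrC mulc_conj -rmorphM /= expr2 mulKf ?gt_eqF//.
have cuF : ccont_on a b (fun t => u * F t).
  by apply: ccont_onM => //; exact: ccont_on_cst.
rewrite -cintZ//= ; apply: le_rint.
- exact: ccont_on_Re.
- exact: ccont_on_cabs.
- move=> t _; apply: le_trans (ler_norm _) _; apply: le_trans (Re_le_cabs _) _.
  by rewrite cabsM cu mul1r.
Qed.

Lemma cint_abs_le a b F M : a <= b -> ccont_on a b F ->
  (forall t, a <= t <= b -> cabs (F t) <= M) -> cabs (cint a b F) <= M * (b - a).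
Proof.
move=> ab cF FM; apply: le_trans (cint_triangle ab cF) _.
by rewrite -rint_cst//; apply: le_rint => //; [exact: ccont_on_cabs|exact: cont_cst].
Qed.

(** * Goursat's theorem and circle means *)

Lemma cint_pt a F : cint a a F = 0.
Proof. by rewrite /cint /rint set_itv1 !Rintegral_set1. Qed.

(** Bisection principle, shared by Goursat's theorem and by the passage from local to global bounds.
    In each coordinate the limit point is the supremum of the left ends of nested intervals. *)
Lemma nested_squares (Q : RR -> RR -> RR -> Prop) (a c l : RR) : 0 <= l -> Q a c l ->
  (forall a c l, Q a c l -> exists i j : bool, Q (a + i%:R * (l / 2)) (c + j%:R * (l / 2)) (l / 2)) ->
  exists x y : RR, [/\ a <= x <= a + l, c <= y <= c + l & forall n, exists a' c' : RR,
    [/\ Q a' c' (l / 2 ^+ n), a <= a' /\ a' + l / 2 ^+ n <= a + l,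
        c <= c' /\ c' + l / 2 ^+ n <= c + l,
        a' <= x <= a' + l / 2 ^+ n & c' <= y <= c' + l / 2 ^+ n]].
Proof.
move=> l0 Q0 step.
have /choice [f Hf] : forall p : RR * RR * RR, exists b : bool * bool, Q p.1.1 p.1.2 p.2 ->
    Q (p.1.1 + b.1%:R * (p.2 / 2)) (p.1.2 + b.2%:R * (p.2 / 2)) (p.2 / 2).
  move=> [[a1 c1] l1] /=.
  have [/step [i [j H]]|nQ] := pselect (Q a1 c1 l1); first by exists (i, j).
  by exists (false, false).
pose g (p : RR * RR * RR) := (p.1.1 + (f p).1%:R * (p.2 / 2), p.1.2 + (f p).2%:R * (p.2 / 2), p.2 / 2).
pose s n := iter n g (a, c, l).
have sl n : (s n).2 = l / 2 ^+ n.
  elim: n => [|n IH]; first by rewrite expr0 divr1.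
  by rewrite /s iterS -/(s n) /= IH exprSr invfM mulrA.
have sQ n : Q (s n).1.1 (s n).1.2 (s n).2.
  by elim: n => [//|n IH]; rewrite /s iterS -/(s n); apply: Hf.
have ln0 n : 0 <= (s n).2 by rewrite sl divr_ge0// exprn_ge0.
have b01 (b : bool) : (0 : RR) <= (b%:R : RR) <= (1 : RR) by case: b; rewrite ?lexx ?ler01.
have s1 n : (s n).1.1 <= (s n.+1).1.1 /\ (s n.+1).1.1 + (s n.+1).2 <= (s n).1.1 + (s n).2.
  by rewrite /s iterS -/(s n) /=; have := b01 (f (s n)).1; have := ln0 n; split; nra.
have s2 n : (s n).1.2 <= (s n.+1).1.2 /\ (s n.+1).1.2 + (s n.+1).2 <= (s n).1.2 + (s n).2.
  by rewrite /s iterS -/(s n) /=; have := b01 (f (s n)).2; have := ln0 n; split; nra.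
have key (u : nat -> RR) : (forall n, u n <= u n.+1 /\ u n.+1 + (s n.+1).2 <= u n + (s n).2) ->
    exists x, forall n, [/\ u n <= x <= u n + (s n).2, u 0 <= u n & u n + (s n).2 <= u 0 + (s 0).2].
  move=> H.
  have mono m k : u m <= u (m + k)%N /\ u (m + k)%N + (s (m + k)%N).2 <= u m + (s m).2.
    elim: k => [|k [IH1 IH2]]; first by rewrite addn0.
    rewrite addnS; have [h1 h2] := H (m + k)%N; split; lra.
  have ub m n : u n <= u m + (s m).2.
    have [mn|/ltnW nm] := leqP m n.
      have [h1 h2] := mono m (n - m)%N; rewrite subnKC// in h1 h2.
      by have := ln0 n; lra.
    have [h1 h2] := mono n (m - n)%N; rewrite subnKC// in h1 h2.
    by have := ln0 m; lra.
  exists (sup (range u)) => n; split; last 2 first.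
  - by have [] := mono 0 n; rewrite add0n.
  - by have [] := mono 0 n; rewrite add0n.
  apply/andP; split.
    apply: ub_le_sup; last by exists n.
    by exists (u 0 + (s 0).2) => _ [m _ <-]; exact: ub.
  apply: ge_sup; first by exists (u 0), 0%N.
  by move=> _ [m _ <-]; exact: ub.
have [x Hx] := key (fun n => (s n).1.1) s1.
have [y Hy] := key (fun n => (s n).1.2) s2.
exists x, y; split.
- by have [] := Hx 0%N.
- by have [] := Hy 0%N.
- move=> n; exists (s n).1.1, (s n).1.2; rewrite -sl; split.
  + exact: sQ.
  + by have [] := Hx n.
  + by have [] := Hy n.
  + by have [] := Hx n.
  + by have [] := Hy n.
Qed.

Lemma pow_half_lt (e : RR) (c : RR) : 0 < e -> exists n, c / 2 ^+ n < e.
Proof.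
move=> e0.
have [c0|c0] := leP c 0.
  by exists 0%N; rewrite expr0 divr1; lra.
pose n := Num.truncn (c / e).
exists n.+1; rewrite ltr_pdivrMr ?exprn_gt0// mulrC -ltr_pdivrMr//.
apply: lt_le_trans (_ : n.+1%:R <= _).
  by apply: truncnS_gt; rewrite divr_ge0// ltW.
by rewrite -natrX ler_nat ltnW// ltn_expl.
Qed.

(** The counterclockwise contour integral of [Phi] along the boundary of the square, divided by i.
    Opposite sides are paired, so that only differences of [Phi] occur. *)
Definition square_int (Phi : CC -> CC) (a c l : RR) : CC :=
  cint c (c + l) (fun y => Phi ((a + l) +i* y)%C - Phi (a +i* y)%C) +
  'i%C * cint a (a + l) (fun x => Phi (x +i* (c + l))%C - Phi (x +i* c)%C).

Definition hderiv_square (Phi : CC -> CC) (a c l : RR) := forall x y : RR,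
  a <= x <= a + l -> c <= y <= c + l -> exists d, has_cderiv Phi (x +i* y)%C d.

Lemma hderiv_ver Phi a c l x : hderiv_square Phi a c l -> a <= x <= a + l ->
  ccont_on c (c + l) (fun y => Phi (x +i* y)%C).
Proof.
move=> H xa y ya; have [d dd] := H _ _ xa ya.
apply: (@ccont_comp_lip Phi (fun y : RR => (x +i* y)%C) y 1 d) => // s.
rewrite mul1r (_ : _ - _ = (0 +i* (s - y))%C); last by rewrite /=; congr (_ +i* _)%C; ring.
by rewrite /cabs /= expr0n add0r sqrtr_sqr.
Qed.

Lemma hderiv_hor Phi a c l y : hderiv_square Phi a c l -> c <= y <= c + l ->
  ccont_on a (a + l) (fun x => Phi (x +i* y)%C).
Proof.
move=> H yc x xa; have [d dd] := H _ _ xa yc.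
apply: (@ccont_comp_lip Phi (fun x : RR => (x +i* y)%C) x 1 d) => // s.
rewrite mul1r (_ : _ - _ = (s - x)%:C); last by rewrite /=; congr (_ +i* _)%C; ring.
by rewrite cabsR.
Qed.

Lemma hderiv_square_sub Phi a c l a' c' l' : hderiv_square Phi a c l ->
  a <= a' /\ a' + l' <= a + l -> c <= c' /\ c' + l' <= c + l -> hderiv_square Phi a' c' l'.
Proof. by move=> H [a1 a2] [c1 c2] x y /andP[x1 x2] /andP[y1 y2]; apply: H; lra. Qed.

Lemma square_int_split Phi (a c l : RR) : 0 <= l -> hderiv_square Phi a c l ->
  square_int Phi a c l = square_int Phi a c (l / 2) + square_int Phi (a + l / 2) c (l / 2) +
    square_int Phi a (c + l / 2) (l / 2) + square_int Phi (a + l / 2) (c + l / 2) (l / 2).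
Proof.
move=> l0 H; rewrite /square_int.
have E (x : RR) : x + l / 2 + l / 2 = x + l by rewrite -addrA -splitr.
have h1 (x : RR) : x <= x + l / 2 by rewrite lerDl divr_ge0.
have h2 (x : RR) : x + l / 2 <= x + l by rewrite lerD2l ler_pdivrMr// ler_peMr// ler1n.
have h3 (x : RR) : x <= x + l by rewrite lerDl.
have V x : a <= x <= a + l -> forall y1 y2, c <= y1 -> y2 <= c + l ->
    ccont_on y1 y2 (fun y => Phi (x +i* y)%C).
  move=> xa y1 y2 k1 k2 y /andP[k3 k4]; apply: (hderiv_ver H xa).
  by rewrite (le_trans k1 k3) (le_trans k4 k2).
have W y : c <= y <= c + l -> forall x1 x2, a <= x1 -> x2 <= a + l ->
    ccont_on x1 x2 (fun x => Phi (x +i* y)%C).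
  move=> ya x1 x2 k1 k2 x /andP[k3 k4]; apply: (hderiv_hor H ya).
  by rewrite (le_trans k1 k3) (le_trans k4 k2).
have hh (x : RR) : [/\ x <= x <= x + l, x <= x + l / 2 <= x + l & x <= x + l <= x + l].
  by split; rewrite ?h1 ?h2 ?h3 ?lexx.
have [a1 a2 a3] := hh a; have [c1 c2 c3] := hh c.
have VB x x' y1 y2 : a <= x <= a + l -> a <= x' <= a + l -> c <= y1 -> y2 <= c + l ->
    cint y1 y2 (fun y => Phi (x +i* y)%C - Phi (x' +i* y)%C) =
    cint y1 y2 (fun y => Phi (x +i* y)%C) - cint y1 y2 (fun y => Phi (x' +i* y)%C).
  by move=> k1 k2 k3 k4; apply: cintB; exact: V.
have WB y y' x1 x2 : c <= y <= c + l -> c <= y' <= c + l -> a <= x1 -> x2 <= a + l ->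
    cint x1 x2 (fun x => Phi (x +i* y)%C - Phi (x +i* y')%C) =
    cint x1 x2 (fun x => Phi (x +i* y)%C) - cint x1 x2 (fun x => Phi (x +i* y')%C).
  by move=> k1 k2 k3 k4; apply: cintB; exact: W.
have [a4 a5 a6] : [/\ a <= a + l / 2, a + l / 2 <= a + l & a <= a + l] by split.
have [c4 c5 c6] : [/\ c <= c + l / 2, c + l / 2 <= c + l & c <= c + l] by split.
rewrite !E !VB// !WB//.
have VS x : a <= x <= a + l -> cint c (c + l) (fun y => Phi (x +i* y)%C) =
    cint c (c + l / 2) (fun y => Phi (x +i* y)%C) + cint (c + l / 2) (c + l) (fun y => Phi (x +i* y)%C).
  by move=> xa; apply: cint_split => //; apply: V.
have WS y : c <= y <= c + l -> cint a (a + l) (fun x => Phi (x +i* y)%C) =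
    cint a (a + l / 2) (fun x => Phi (x +i* y)%C) + cint (a + l / 2) (a + l) (fun x => Phi (x +i* y)%C).
  by move=> xa; apply: cint_split => //; apply: W.
rewrite (VS a)// (VS (a + l))// (WS c)// (WS (c + l))//.
by do 12!(move: (cint _ _ _) => ?); ring.
Qed.

(** Each of the two integrands is within 2e of its value A = L l, respectively B = i L l, for the
    affine approximation; and A + i B = 0, so the affine part contributes nothing. *)
Lemma square_int_small (Phi : CC -> CC) (a c l x0 y0 e : RR) (L : CC) : 0 <= l -> hderiv_square Phi a c l ->
  (forall x y : RR, a <= x <= a + l -> c <= y <= c + l ->
     cabs (Phi (x +i* y)%C - Phi (x0 +i* y0)%C - L * ((x - x0) +i* (y - y0))%C) <= e) ->
  cabs (square_int Phi a c l) <= 4 * e * l.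
Proof.
move=> l0 H He; rewrite /square_int.
have aL : a <= a + l by lra.
have cL : c <= c + l by lra.
have cV : ccont_on c (c + l) (fun y => Phi ((a + l) +i* y)%C - Phi (a +i* y)%C).
  by apply: ccont_onB; apply: (hderiv_ver H); lra.
have cH : ccont_on a (a + l) (fun x => Phi (x +i* (c + l))%C - Phi (x +i* c)%C).
  by apply: ccont_onB; apply: (hderiv_hor H); lra.
pose A : CC := L * l%:C; pose B : CC := L * (0 +i* l)%C.
set I1 := cint c _ _; set I2 := cint a _ _.
have E1 : cabs (I1 - A * l%:C) <= 2 * e * l.
  have -> : I1 - A * l%:C = cint c (c + l) (fun y => Phi ((a + l) +i* y)%C - Phi (a +i* y)%C - A).
    rewrite cintB//; last exact: ccont_on_cst.
    by rewrite cint_cst//; congr (_ - _ * _%:C); lra.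
  have -> : 2 * e * l = 2 * e * (c + l - c) by ring.
  apply: cint_abs_le => //; first by apply: ccont_onB => //; exact: ccont_on_cst.
  move=> y yc.
  have h1 := He (a + l) y _ yc; have h2 := He a y _ yc.
  rewrite mulr2n mulrDl mul1r.
  have := cabsB (Phi ((a + l) +i* y)%C - Phi (x0 +i* y0)%C - L * ((a + l - x0) +i* (y - y0))%C)
     (Phi (a +i* y)%C - Phi (x0 +i* y0)%C - L * ((a - x0) +i* (y - y0))%C).
  set X := cabs (_ - _ - (_ - _)) => hX.
  have -> : cabs (Phi ((a + l) +i* y)%C - Phi (a +i* y)%C - A) = X.
    rewrite /X; congr cabs; rewrite /A.
    have -> : ((a + l - x0) +i* (y - y0))%C = ((a - x0) +i* (y - y0))%C + l%:C :> CC.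
      by congr (_ +i* _)%C; ring.
    by ring.
  apply: le_trans hX _; apply: lerD; [apply: h1|apply: h2]; lra.
have E2 : cabs (I2 - B * l%:C) <= 2 * e * l.
  have -> : I2 - B * l%:C = cint a (a + l) (fun x => Phi (x +i* (c + l))%C - Phi (x +i* c)%C - B).
    rewrite cintB//; last exact: ccont_on_cst.
    by rewrite cint_cst//; congr (_ - _ * _%:C); lra.
  have -> : 2 * e * l = 2 * e * (a + l - a) by ring.
  apply: cint_abs_le => //; first by apply: ccont_onB => //; exact: ccont_on_cst.
  move=> x xa.
  have h1 := He x (c + l) xa; have h2 := He x c xa.
  rewrite mulr2n mulrDl mul1r.
  have := cabsB (Phi (x +i* (c + l))%C - Phi (x0 +i* y0)%C - L * ((x - x0) +i* (c + l - y0))%C)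
     (Phi (x +i* c)%C - Phi (x0 +i* y0)%C - L * ((x - x0) +i* (c - y0))%C).
  set X := cabs (_ - _ - (_ - _)) => hX.
  have -> : cabs (Phi (x +i* (c + l))%C - Phi (x +i* c)%C - B) = X.
    rewrite /X; congr cabs; rewrite /B.
    have -> : ((x - x0) +i* (c + l - y0))%C = ((x - x0) +i* (c - y0))%C + (0 +i* l)%C :> CC.
      by congr (_ +i* _)%C; ring.
    by ring.
  apply: le_trans hX _; apply: lerD; [apply: h1|apply: h2]; lra.
have -> : I1 + 'i%C * I2 = (I1 - A * l%:C) + 'i%C * (I2 - B * l%:C).
  have -> : A * l%:C = - ('i%C * (B * l%:C)).
    rewrite /A /B; have -> : (0 +i* l)%C = 'i%C * l%:C :> CC by rewrite RCeq add0r.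
    have i2 : ('i%C : CC) ^+ 2 = -1 by exact: sqr_i.
    move: i2; move: ('i%C : CC) (l%:C) => J m i2.
    rewrite [RHS](_ : _ = - (J ^+ 2) * (L * m * m)); last by ring.
    by rewrite i2; ring.
  by ring.
apply: le_trans (cabsD _ _) _; rewrite cabsM (_ : cabs 'i%C = 1); last first.
  by rewrite /cabs /= expr0n add0r expr1n sqrtr1.
by lra.
Qed.

(* Goursat: bisect, keeping a quarter that carries at least a quarter of the integral. *)
Lemma square_int_eq0 Phi (a c l : RR) : 0 <= l -> hderiv_square Phi a c l -> square_int Phi a c l = 0.
Proof.
move=> l0 H; apply/eqP; rewrite -cabs_eq0; apply: contraT => I0.
have {}I0 : 0 < cabs (square_int Phi a c l) by rewrite lt0r I0 cabs_ge0.
have lpos : 0 < l.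
  rewrite lt0r l0 andbT; apply: contraTneq I0 => ->.
  by rewrite /square_int !addr0 !cint_pt mulr0 addr0 cabs0 ltxx.
(* The factor 2 makes the initial inequality K l^2 < |integral| strict; a quarter that carries a
   quarter of the integral preserves it, since K (l/2)^2 is a quarter of K l^2. *)
pose K := cabs (square_int Phi a c l) / (2 * l ^+ 2).
have l20 : 0 < l ^+ 2 by rewrite exprn_gt0.
have K0 : 0 < K by rewrite divr_gt0//; lra.
pose Q a' c' l' := [/\ hderiv_square Phi a' c' l', 0 <= l' & K * l' ^+ 2 < cabs (square_int Phi a' c' l')].
have Q0 : Q a c l.
  split=> //; rewrite /K; have -> : cabs (square_int Phi a c l) / (2 * l ^+ 2) * l ^+ 2 = cabs (square_int Phi a c l) / 2.
    by field; lra.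
  lra.
have step a' c' l' : Q a' c' l' -> exists i j : bool,
    Q (a' + i%:R * (l' / 2)) (c' + j%:R * (l' / 2)) (l' / 2).
  move=> [h1 h2 h3].
  apply: contrapT => /forallNP nQ.
  have small (i j : bool) : cabs (square_int Phi (a' + i%:R * (l' / 2)) (c' + j%:R * (l' / 2)) (l' / 2)) <= K * (l' / 2) ^+ 2.
    rewrite leNgt; apply/negP => hlt.
    have /forallNP /(_ j) := nQ i; apply; split => //; last by clear -h2; lra.
    have b01 (b : bool) : (0 : RR) <= (b%:R : RR) <= (1 : RR) by case: b; rewrite ?lexx ?ler01.
    have := b01 i; have := b01 j => hj hi.
    apply: hderiv_square_sub h1 _ _; clear -hi hj h2; split; nra.
  have := small false false; have := small false true; have := small true false; have := small true true.
  rewrite !mul0r !addr0 !mul1r.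
  have := square_int_split h2 h1.
  set S := square_int Phi a' c' l' in h3 *; set S1 := square_int Phi a' c' _; set S2 := square_int Phi _ c' _.
  set S3 := square_int Phi a' _ _; set S4 := square_int Phi _ _ _.
  move=> SE h4 h5 h6 h7.
  have : cabs S <= cabs S1 + cabs S2 + cabs S3 + cabs S4.
    rewrite SE; apply: le_trans (cabsD _ _) _; rewrite lerD2r.
    by apply: le_trans (cabsD _ _) _; rewrite lerD2r cabsD.
  clear SE; clearbody S S1 S2 S3 S4.
  have E : K * l' ^+ 2 = 4 * (K * (l' / 2) ^+ 2) by field.
  move: h4 h5 h6 h7 h3; rewrite E; move: (K * (l' / 2) ^+ 2) (cabs S) (cabs S1) (cabs S2) (cabs S3) (cabs S4) => X0 X X1 X2 X3 X4 g1 g2 g3 g4 g5 g6; clear -g1 g2 g3 g4 g5 g6; lra.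
have [x [y [xa yc HQ]]] := nested_squares l0 Q0 step.
have [L dL] := H _ _ xa yc.
(* On a square of side l' the distance to the limit point is at most 2 l', so the integral is at
   most 4 (K/16) (2 l') l' = K l'^2 / 2, below the lower bound K l'^2. *)
have e0 : 0 < K / 16 by lra.
have [d d0 Hd] := dL _ e0.
have d20 : 0 < d / 2 by lra.
have [n ln] := pow_half_lt l d20.
have [a' [c' [[h1 h2 h3] a1 c1 xa' yc']]] := HQ n.
set l' := l / 2 ^+ n in ln h1 h2 h3 a1 c1 xa' yc'.
have : cabs (square_int Phi a' c' l') <= 4 * (K / 16 * (2 * l')) * l'.
  apply: (square_int_small (x0 := x) (y0 := y) (L := L)) => // x1 y1 hx1 hy1.
  have hw : cabs ((x1 - x) +i* (y1 - y))%C <= 2 * l'.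
    apply: le_trans (cabs_le_ReIm _) _ => /=.
    have : `|x1 - x| <= l' by rewrite ler_norml; clear -hx1 a1 xa'; lra.
    have : `|y1 - y| <= l' by rewrite ler_norml; clear -hy1 c1 yc'; lra.
    by clear; lra.
  have := Hd _ (le_lt_trans hw (_ : 2 * l' < d)).
  have -> : (x +i* y)%C + ((x1 - x) +i* (y1 - y))%C = (x1 +i* y1)%C :> CC.
    by rewrite /=; congr (_ +i* _)%C; ring.
  move=> Hd'; apply: le_trans (Hd' _) _; first by clear -ln; lra.
  by rewrite ler_pM2l.
have := mulr_ge0 (ltW K0) (mulr_ge0 h2 h2).
move: h3; rewrite expr2; clear; lra.
Qed.

Lemma ccont_ecirc t : ccont ecirc t.
Proof.
apply: (@ccont_comp_lip cexp (fun s : RR => (0 +i* (2 * pi * s))%C) t (2 * pi) _ (has_cderiv_cexp _)) => s.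
have -> : (0 +i* (2 * pi * s))%C - (0 +i* (2 * pi * t))%C = (0 +i* (2 * pi * (s - t)))%C :> CC.
  by congr (_ +i* _)%C; ring.
rewrite /cabs /= expr0n add0r sqrtr_sqr normrM ger0_norm// mulr_ge0//; exact: pi_ge0.
Qed.

Lemma ccont_comp f (g : RR -> CC) t l : has_cderiv f (g t) l -> ccont g t -> ccont (fun s => f (g s)) t.
Proof.
move=> df cg e /(has_cderiv_cont df) [d d0 H]; have [d' d'0 H'] := cg _ d0.
exists d' => // h /H' /H; by rewrite subrKC.
Qed.

Lemma ccont_circle c w t : ccont (fun s => c + w * ecirc s) t.
Proof. by apply: ccontD; [exact: ccont_cst|apply: ccontM; [exact: ccont_cst|exact: ccont_ecirc]]. Qed.

Definition cmean (F : RR -> CC) : CC := cint 0 1 F.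

(** Goursat's theorem for xi -> F(c + w exp(2 pi xi)) on the square [-1, 0] x [0, 1]: the horizontal
    sides cancel by periodicity, and the vertical ones give the means over two concentric circles
    with ratio exp(-2 pi). *)
Lemma circle_mean_shrink (F : CC -> CC) (c w : CC) : w != 0 ->
  (forall z, 0 < cabs (z - c) <= cabs w -> exists d, has_cderiv F z d) ->
  cmean (fun t => F (c + w * ecirc t)) =
  cmean (fun t => F (c + w * (expR (- (2 * pi)))%:C * ecirc t)).
Proof.
move=> w0 HF.
pose Phi (xi : CC) := F (c + w * cexp ((2 * pi)%:C * xi)).
have pi0 : 0 <= 2 * pi :> RR by rewrite mulr_ge0// pi_ge0.
have HPhi : hderiv_square Phi (-1) 0 1.
  move=> x y xa yc.
  set z := (x +i* y)%C; set Z := c + w * cexp ((2 * pi)%:C * z).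
  have /HF [d dF] : 0 < cabs (Z - c) <= cabs w.
    rewrite /Z [c + _]addrC addrK cabsM cabs_cexp /z /= mul0r subr0.
    rewrite mulr_gt0 ?cabs_gt0// ?expR_gt0//=.
    have x0 : x <= 0 by lra.
    have := mulr_ge0_le0 pi0 x0; rewrite -ler_expR expR0 => h.
    by rewrite ler_piMr ?cabs_ge0.
  have h1 := has_cderivZ ((2 * pi)%:C) (has_cderiv_id z).
  have h2 := has_cderiv_comp h1 (has_cderiv_cexp ((2 * pi)%:C * z)).
  have h3 := has_cderivD (has_cderiv_cst c z) (has_cderivZ w h2).
  by eexists; exact: (has_cderiv_comp h3 dF).
have := square_int_eq0 ler01 HPhi; rewrite /square_int addNr add0r.
have E x y : cexp ((2 * pi)%:C * (x +i* y)%C) = (expR (2 * pi * x))%:C * ecirc y.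
  rewrite /ecirc /cexp /= expR0 mul1r !mul0r subr0 addr0 //.
rewrite [X in _ + 'i%C * X](_ : _ = 0); last first.
  rewrite (@eq_cint _ _ _ (fun=> 0)) ?cint_cst ?mul0r// => t _.
  by rewrite /Phi !E ecirc1 ecirc0 subrr.
rewrite mulr0 addr0 cintB.
- move=> /eqP; rewrite subr_eq0 => /eqP; rewrite /cmean.
  rewrite (@eq_cint _ _ _ (fun t => F (c + w * ecirc t))); last first.
    by move=> t _; rewrite /Phi E mulr0 expR0 mul1r.
  move=> ->; apply: eq_cint => t _; rewrite /Phi E mulrA mulrN1 //.
- have := hderiv_ver HPhi; rewrite addNr add0r => H; apply: H; lra.
- have := hderiv_ver HPhi; rewrite addNr add0r => H; apply: H; lra.
Qed.

(** Shrinking the circle repeatedly leaves the mean unchanged while the values approach l. Only a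
    limit at the centre is required, so the lemma applies to difference quotients. *)
Lemma circle_mean_punctured (F : CC -> CC) (c w l : CC) : w != 0 ->
  (forall z, 0 < cabs (z - c) <= cabs w -> exists d, has_cderiv F z d) ->
  (forall e : RR, 0 < e -> exists2 d : RR, 0 < d & forall z, 0 < cabs (z - c) < d -> cabs (F z - l) <= e) ->
  cmean (fun t => F (c + w * ecirc t)) = l.
Proof.
move=> w0 HF Hl; pose q : RR := expR (- (2 * pi)).
have q0 : 0 < q by exact: expR_gt0.
(* Comparing the ratio with 1/2 lets [pow_half_lt] measure the shrinking radii. *)
have q2 : q < 1 / 2.
  rewrite /q expRN mul1r ltf_pV2 ?posrE ?expR_gt0//.
  have : 1 + 2 * pi <= expR (2 * pi) :> RR by exact: expR_ge1Dx.
  have := pi_ge2 RR; lra.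
have step n : w * (q ^+ n)%:C != 0 /\ cabs (w * (q ^+ n)%:C) <= cabs w / 2 ^+ n /\
    cmean (fun t => F (c + w * ecirc t)) = cmean (fun t => F (c + w * (q ^+ n)%:C * ecirc t)).
  elim: n => [|n [IH1 [IH2 IH3]]]; first by rewrite expr0 mulr1 expr0 divr1.
  have E : w * (q ^+ n.+1)%:C = w * (q ^+ n)%:C * q%:C by rewrite exprSr rmorphM mulrA.
  have qC : (q%:C : CC) != 0 by rewrite -cabs_gt0 cabsR_ge0// ltW.
  split; first by rewrite E mulf_neq0.
  split.
    rewrite E cabsM cabsR_ge0 ?(ltW q0)// exprSr invfM mulrA ler_pM ?cabs_ge0// ?(ltW q0)//; lra.
  rewrite IH3 circle_mean_shrink// ?E// => z /andP[z0 z1]; apply: HF; rewrite z0 (le_trans z1)//.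
  by rewrite (le_trans IH2)// ler_pdivrMr ?exprn_gt0// ler_peMr ?cabs_ge0// exprn_ege1// ler1n.
set m := cmean _ in step *.
apply/eqP; rewrite -subr_eq0 -cabs_eq0 eq_le cabs_ge0 andbT leNgt; apply/negP => X0.
have X20 : 0 < cabs (m - l) / 2 by lra.
have [d d0 Hd] := Hl _ X20.
have [n wn] := pow_half_lt (cabs w) d0.
have [w1 [w2 w3]] := step n.
have cF : ccont_on 0 1 (fun t => F (c + w * (q ^+ n)%:C * ecirc t)).
  move=> t _.
  have [|D HD] := HF (c + w * (q ^+ n)%:C * ecirc t).
    rewrite [c + _]addrC addrK cabsM cabs_ecirc mulr1 cabs_gt0 w1 /=.
    by rewrite (le_trans w2)// ler_pdivrMr ?exprn_gt0// ler_peMr ?cabs_ge0// exprn_ege1// ler1n.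
  by apply: (ccont_comp HD); exact: ccont_circle.
have : cabs (m - l) <= cabs (m - l) / 2 * (1 - 0).
  rewrite {1}w3 (_ : l = cint 0 1 (fun=> l)); last by rewrite cint_cst// subr0 mulr1.
  rewrite /cmean -cintB//; last exact: ccont_on_cst.
  apply: cint_abs_le => //; first by apply: ccont_onB => //; exact: ccont_on_cst.
  move=> t _; rewrite cint_cst// subr0 mulr1; apply: Hd.
  rewrite [c + _]addrC addrK cabsM cabs_ecirc mulr1 cabs_gt0 w1 /=.
  exact: le_lt_trans w2 wn.
lra.
Qed.

Lemma circle_mean (F : CC -> CC) (c w : CC) :
  (forall z, cabs (z - c) <= cabs w -> exists d, has_cderiv F z d) ->
  cmean (fun t => F (c + w * ecirc t)) = F c.
Proof.
move=> HF; have [->|w0] := eqVneq w 0.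
  rewrite /cmean (@eq_cint _ _ _ (fun=> F c)); last by move=> t _; rewrite mul0r addr0.
  by rewrite cint_cst// subr0 mulr1.
apply: circle_mean_punctured => // [z /andP[_]|e e0]; first exact: HF.
have [|D HD] := HF c; first by rewrite subrr cabs0 cabs_ge0.
have [d d0 H] := has_cderiv_cont HD e0.
exists d => // z /andP[_ /H]; rewrite subrKC; exact: ltW.
Qed.

(** * Derivatives of analytic functions *)

Lemma analyticP (f : CC -> CC) z : analytic_disc f -> cabs z < 1 -> has_cderiv f z (cderiv f z).
Proof. by move=> H /H /derivableP_cderiv. Qed.

Lemma analytic_disc_hol (f : CC -> CC) :
  (forall z, cabs z < 1 -> exists d, has_cderiv f z d) -> analytic_disc f.
Proof. by move=> H z /H [d /has_cderiv_derivable []]. Qed.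

Definition is_rderive (R : realType) (f : R -> R) (x l : R) : Prop := is_derive x 1 f l.

Lemma eps_rderiv (R : realType) (f : R -> R) (x l : R) :
  (forall e : R, 0 < e -> exists2 d : R, 0 < d &
    forall h, `|h| < d -> `|f (x + h) - f x - l * h| <= e * `|h|) -> is_rderive f x l.
Proof.
move=> df.
have H : h^-1 *: ((f \o shift x) (h *: 1) - f x) @[h --> (0:R)^'] --> l.
  apply/cvgrPdist_le => /= e /df [d d0 H].
  exists d => //= w /=; rewrite sub0r normrN => /H {}H w0.
  rewrite distrC; move: H; rewrite -ler_pdivrMr ?normr_gt0// -normfV -normrM.
  congr (`|_| <= _).
  rewrite /GRing.scale /= mulr1 [w + x]addrC; field; exact: w0.
by split; [apply/cvg_ex; exists l | apply: cvg_lim].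
Qed.

Lemma is_derive_line (f : CC -> CC) (a v k l : CC) (t : RR) : has_cderiv f (a + t%:C * v) l ->
  is_rderive (fun s : RR => cRe (k * f (a + s%:C * v))) t (cRe (k * l * v)).
Proof.
move=> df; apply: eps_rderiv => e e0.
have k0 := cabs_ge0 k; have v0 := cabs_ge0 v.
pose M := (cabs k + 1) * (cabs v + 1).
have M0 : 0 < M by rewrite mulr_gt0//; lra.
have [d d0 H] := df _ (divr_gt0 e0 M0).
exists (d / (cabs v + 1)); first by rewrite divr_gt0//; lra.
move=> h; rewrite ltr_pdivlMr; last lra.
move=> hd.
have h0 := normr_ge0 h.
have := H (h%:C * v); rewrite cabsM cabsR => /(_ _) K.
have {K}/K : `|h| * cabs v < d by nra.
have -> : a + t%:C * v + h%:C * v = a + (t + h)%:C * v by rewrite rmorphD /=; ring.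
set A := f _; set B := f _ => {}H.
have -> : cRe (k * A) - cRe (k * B) - cRe (k * l * v) * h = cRe (k * (A - B - l * (h%:C * v))).
  rewrite !(cReM, cImM, cReB, cImB) /=; ring.
apply: le_trans (Re_le_cabs _) _; rewrite cabsM.
apply: le_trans (ler_wpM2l k0 H) _.
rewrite [leLHS](_ : _ = e * `|h| * (cabs k * cabs v / M)); last by ring.
have eh : 0 <= e * `|h| by rewrite mulr_ge0// ltW.
by rewrite ler_piMr// ler_pdivrMr// mul1r /M; nra.
Qed.

(** The real mean value theorem for the component of f along the direction of f b - f a, selected by
    multiplying with the conjugate of f b - f a and taking real parts. *)
Lemma cderiv_mvt (f : CC -> CC) (a b : CC) (L : RR) :
  (forall t : RR, 0 <= t <= 1 -> exists2 l, has_cderiv f (a + t%:C * (b - a)) l & cabs l <= L) ->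
  cabs (f b - f a) <= L * cabs (b - a).
Proof.
move=> H; have [E|E0] := eqVneq (f b - f a) 0.
  rewrite E cabs0 mulr_ge0 ?cabs_ge0//.
  by have [|l _] := H 0; rewrite ?lexx ?ler01//; apply: le_trans; exact: cabs_ge0.
set k := cconj (f b - f a).
pose u (s : RR) := cRe (k * f (a + s%:C * (b - a))).
have [l0 Hl0] : {l0 : RR -> CC & forall t : RR, 0 <= t <= 1 -> has_cderiv f (a + t%:C * (b - a)) (l0 t) /\ cabs (l0 t) <= L}.
  suff /choice [l0 Hl0] : forall t : RR, exists l, 0 <= t <= 1 -> has_cderiv f (a + t%:C * (b - a)) l /\ cabs l <= L.
    by exists l0.
  move=> t; have [/H [l h1 h2]|nt] := pselect (0 <= t <= 1); first by exists l.
  by exists 0 => /nt.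
have du t : 0 <= t <= 1 -> is_rderive u t (cRe (k * l0 t * (b - a))).
  by move=> /Hl0 [h _]; exact: is_derive_line.
have [||t t01] := @MVT RR u (fun t => cRe (k * l0 t * (b - a))) 0 1 ltr01.
- by move=> t; rewrite in_itv /= => /andP[t0 t1]; apply: du; rewrite !ltW.
- apply: derivable_within_continuous => t; rewrite in_itv /= => /du [] //.
rewrite subr0 mulr1 /u.
have -> : a + (1 : RR)%:C * (b - a) = b by rewrite mul1r subrKC.
have -> : a + (0 : RR)%:C * (b - a) = a by rewrite mul0r addr0.
rewrite -cReB -mulrBr {1}/k [cconj _ * _]mulrC mulc_conj /= => K.
have {t01}/Hl0 [_ lt] : 0 <= t <= 1 by move: t01; rewrite in_itv /= => /andP[/ltW -> /ltW ->].
have c0 : 0 < cabs (f b - f a) by rewrite cabs_gt0.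
rewrite -(ler_pM2l c0) -expr2 K; apply: le_trans (ler_norm _) _; apply: le_trans (Re_le_cabs _) _.
rewrite !cabsM cabs_conj -mulrA ler_pM2l// ler_wpM2r// cabs_ge0//.
Qed.

(* Otherwise bisection gives squares shrinking to a point, on each of which f is unbounded. *)
Lemma locally_bounded_disc (f : CC -> CC) (r : RR) : 0 <= r ->
  (forall z, cabs z <= r -> exists d B : RR, 0 < d /\ forall w, cabs w < d -> cabs (f (z + w)) <= B) ->
  exists B : RR, 0 <= B /\ forall z, cabs z <= r -> cabs (f z) <= B.
Proof.
move=> r0 H; apply: contrapT => nB.
pose Q (a c l : RR) := 0 <= l /\ ~ exists B : RR, forall x y : RR, a <= x <= a + l -> c <= y <= c + l ->
  cabs (x +i* y)%C <= r -> cabs (f (x +i* y)%C) <= B.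
have Q0 : Q (- r) (- r) (2 * r).
  split; first lra.
  move=> [B HB]; apply: nB; exists `|B|; split => // -[x y] zr.
  apply: le_trans (ler_norm B); apply: HB => //.
    by have := le_trans (Re_le_cabs _) zr; rewrite /= ler_norml; lra.
  by have := le_trans (Im_le_cabs _) zr; rewrite /= ler_norml; lra.
have step a c l : Q a c l -> exists i j : bool,
    Q (a + i%:R * (l / 2)) (c + j%:R * (l / 2)) (l / 2).
  move=> [l0 nQ]; apply: contrapT => /forallNP nq; apply: nQ.
  have h (i j : bool) : exists B : RR, forall x y : RR, a + i%:R * (l / 2) <= x <= a + i%:R * (l / 2) + l / 2 ->
     c + j%:R * (l / 2) <= y <= c + j%:R * (l / 2) + l / 2 ->
     cabs (x +i* y)%C <= r -> cabs (f (x +i* y)%C) <= B.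
    apply: contrapT => hn; have /forallNP /(_ j) := nq i; apply; split => //; lra.
  have [B1 h1] := h false false; have [B2 h2] := h false true.
  have [B3 h3] := h true false; have [B4 h4] := h true true.
  exists (`|B1| + `|B2| + `|B3| + `|B4|) => x y xa yc zr.
  have n1 := ler_norm B1; have n2 := ler_norm B2; have n3 := ler_norm B3; have n4 := ler_norm B4.
  have p1 := normr_ge0 B1; have p2 := normr_ge0 B2; have p3 := normr_ge0 B3; have p4 := normr_ge0 B4.
  rewrite !mul0r !addr0 !mul1r in h1 h2 h3 h4.
  have [xl|xl] := leP x (a + l / 2); have [yl|yl] := leP y (c + l / 2).
  - by apply: le_trans (h1 x y _ _ zr) _; clear -n1 n2 n3 n4 p1 p2 p3 p4 xa yc xl yl; lra.
  - by apply: le_trans (h2 x y _ _ zr) _; clear -n1 n2 n3 n4 p1 p2 p3 p4 xa yc xl yl; lra.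
  - by apply: le_trans (h3 x y _ _ zr) _; clear -n1 n2 n3 n4 p1 p2 p3 p4 xa yc xl yl; lra.
  - by apply: le_trans (h4 x y _ _ zr) _; clear -n1 n2 n3 n4 p1 p2 p3 p4 xa yc xl yl; lra.
have l0 : 0 <= 2 * r by lra.
have [x [y [_ _ HQ]]] := nested_squares l0 Q0 step.
have near n z1 : cabs z1 <= r -> forall a' c' l', a' <= cRe z1 <= a' + l' -> c' <= cIm z1 <= c' + l' ->
   a' <= x <= a' + l' -> c' <= y <= c' + l' -> l' = 2 * r / 2 ^+ n -> cabs (z1 - (x +i* y)%C) <= 2 * (2 * r / 2 ^+ n).
  move=> _ a' c' l' h1 h2 h3 h4 <-; apply: le_trans (cabs_le_ReIm _) _; rewrite cReB cImB /=.
  have : `|cRe z1 - x| <= l' by rewrite ler_norml; lra.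
  have : `|cIm z1 - y| <= l' by rewrite ler_norml; lra.
  lra.
have zr : cabs (x +i* y)%C <= r.
  rewrite leNgt; apply/negP => rlt.
  have e0 : 0 < (cabs (x +i* y)%C - r) / 2 by lra.
  have [n ln] := pow_half_lt (2 * r) e0.
  have [a' [c' [[_ nQ] _ _ xa yc]]] := HQ n.
  apply: nQ; exists 0 => x1 y1 x1a y1c z1r.
  have := near n (x1 +i* y1)%C z1r _ _ _ x1a y1c xa yc erefl.
  rewrite cabsC; have := cabs_leB (x +i* y)%C (x1 +i* y1)%C; lra.
have [d [B [d0 HB]]] := H _ zr.
have e0 : 0 < d / 2 by lra.
have [n ln] := pow_half_lt (2 * r) e0.
have [a' [c' [[_ nQ] _ _ xa yc]]] := HQ n.
apply: nQ; exists B => x1 y1 x1a y1c z1r.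
have <- : (x +i* y)%C + ((x1 +i* y1)%C - (x +i* y)%C) = (x1 +i* y1)%C :> CC by rewrite subrKC.
apply: HB.
have := near n (x1 +i* y1)%C z1r _ _ _ x1a y1c xa yc erefl; lra.
Qed.

Lemma analytic_bounded f r : analytic_disc f -> 0 <= r < 1 ->
  exists B : RR, 0 <= B /\ forall z, cabs z <= r -> cabs (f z) <= B.
Proof.
move=> af /andP[r0 r1]; apply: locally_bounded_disc => // z zr.
have [d d0 H] := has_cderiv_cont (analyticP af (le_lt_trans zr r1)) (ltr01 : 0 < (1 : RR)).
exists d, (1 + cabs (f z)); split => // w /H; have := cabs_leB (f (z + w)) (f z); lra.
Qed.

Lemma cabs_circle_le c w t : cabs (c + w * ecirc t) <= cabs c + cabs w.
Proof. by apply: le_trans (cabsD _ _) _; rewrite cabsM cabs_ecirc mulr1. Qed.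

(** Cauchy's formula for f'(c). Subtracting f c gives the quotient the limit f'(c) at the centre,
    which is what [circle_mean_punctured] asks for. *)
Lemma cderiv_mean f (c w : CC) : analytic_disc f -> w != 0 -> cabs c + cabs w < 1 ->
  cmean (fun t => (f (c + w * ecirc t) - f c) / (w * ecirc t)) = cderiv f c.
Proof.
move=> af w0 cw.
have c1 : cabs c < 1 by have := cabs_ge0 w; lra.
have df := analyticP af c1.
pose k (z : CC) := (f z - f c) / (z - c).
have := @circle_mean_punctured k c w (cderiv f c) w0.
rewrite /cmean (@eq_cint 0 1 _ (fun t => (f (c + w * ecirc t) - f c) / (w * ecirc t))); last first.
  by move=> t _; rewrite /k [c + _ - c]addrC addrA addNr add0r.
apply.
- move=> z /andP[z0 zw].
  have z1 : cabs z < 1 by have := cabs_leB z c; lra.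
  have zc : z - c != 0 by rewrite -cabs_gt0.
  have h1 := has_cderivB (analyticP af z1) (has_cderiv_cst (f c) z).
  have h2 := has_cderivB (has_cderiv_id z) (has_cderiv_cst c z).
  have h3 := has_cderiv_comp h2 (has_cderivV zc).
  by eexists; exact: (has_cderivM h1 h3).
- move=> e e0; have [d d0 H] := df _ e0; exists d => // z /andP[z0 zd].
  have zc : z - c != 0 by rewrite -cabs_gt0.
  have := H _ zd; rewrite subrKC.
  rewrite -ler_pdivrMr// -cabsV -cabsM /k; congr (cabs _ <= _).
  by field.
Qed.

Lemma cabs_segment (a b : CC) (t r : RR) : 0 <= t <= 1 -> cabs a <= r -> cabs b <= r ->
  cabs (a + t%:C * (b - a)) <= r.
Proof.
move=> /andP[t0 t1] ar br.
have -> : a + t%:C * (b - a) = (1 - t)%:C * a + t%:C * b by rewrite rmorphB /=; ring.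
apply: le_trans (cabsD _ _) _; rewrite !cabsM !cabsR_ge0//; last lra.
nra.
Qed.

Lemma ccont_quot f c w t : analytic_disc f -> w != 0 -> cabs c + cabs w < 1 ->
  ccont (fun t => (f (c + w * ecirc t) - f c) / (w * ecirc t)) t.
Proof.
move=> af w0 cw; apply: ccontM.
  apply: ccontB; last exact: ccont_cst.
  apply: (ccont_comp (analyticP af (le_lt_trans (cabs_circle_le c w t) cw))).
  exact: ccont_circle.
have wt : w * ecirc t != 0 by rewrite mulf_neq0 ?ecirc_neq0.
apply: (ccont_comp (has_cderivV wt)).
by apply: ccontM; [exact: ccont_cst|exact: ccont_ecirc].
Qed.

(** By [cderiv_mean] over circles of radius d, a bound B for f on the disc of radius r + d gives
    |f'| <= 2B/d on the disc of radius r; its convexity then allows the mean value inequality. *)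
Lemma analytic_lipschitz f r : analytic_disc f -> 0 <= r < 1 ->
  exists L : RR, 0 <= L /\ forall a b, cabs a <= r -> cabs b <= r -> cabs (f a - f b) <= L * cabs (a - b).
Proof.
move=> af /andP[r0 r1].
pose d := (1 - r) / 2.
have d0 : 0 < d by rewrite /d; lra.
have [|B [B0 HB]] := @analytic_bounded f (r + d) af; first by rewrite /d; lra.
exists (2 * B / d); split; first by rewrite divr_ge0//; lra.
move=> a b ar br; rewrite cabsC [cabs (a - b)]cabsC; apply: cderiv_mvt => t t01.
have zr := cabs_segment t01 ar br; set z := a + _ in zr *.
exists (cderiv f z); first by apply: analyticP => //; lra.
have dC : cabs d%:C = d by rewrite cabsR_ge0// ltW.
rewrite -(@cderiv_mean f z d%:C af) ?dC; last 2 first.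
- by rewrite -cabs_gt0 dC.
- by rewrite /d; lra.
rewrite /cmean -[leRHS]mulr1 -[X in _ * X](subr0 1); apply: cint_abs_le => //.
  move=> s _; apply: ccont_quot => //; rewrite ?dC; last by rewrite /d; lra.
  by rewrite -cabs_gt0 dC.
move=> s _; rewrite cabsM cabsV [cabs (_ * ecirc _)]cabsM dC cabs_ecirc mulr1 ler_pM2r ?invr_gt0//.
apply: le_trans (cabsB _ _) _.
have := HB (z + d%:C * ecirc s); have := HB z.
have := cabs_circle_le z d%:C s; rewrite dC => h1 h2 h3.
have := h2 _; have := h3 _ => k1 k2.
rewrite mulr2n mulrDl mul1r; apply: lerD; [apply: k1|apply: k2]; lra.
Qed.

Lemma cmean_abs_le F M : (forall t, ccont F t) -> (forall t, cabs (F t) <= M) -> cabs (cmean F) <= M.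
Proof.
move=> cF FM; rewrite -[M]mulr1 -[X in _ * X](subr0 1); by apply: cint_abs_le.
Qed.

(** No second derivative is available yet: the difference of the two formulas of [cderiv_mean] is
    estimated with the Lipschitz constant of f itself. *)
Lemma cderiv_lipschitz f r : analytic_disc f -> 0 <= r < 1 ->
  exists L : RR, 0 <= L /\ forall a b, cabs a <= r -> cabs b <= r ->
    cabs (cderiv f a - cderiv f b) <= L * cabs (a - b).
Proof.
move=> af /andP[r0 r1].
pose d := (1 - r) / 2.
have d0 : 0 < d by rewrite /d; lra.
have dr : r + d < 1 by rewrite /d; lra.
have [|L [L0 HL]] := @analytic_lipschitz f (r + d) af; first lra.
have dC : cabs d%:C = d by rewrite cabsR_ge0// ltW.
have dC0 : d%:C != 0 :> CC by rewrite -cabs_gt0 dC.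
exists (2 * L / d); split; first by rewrite divr_ge0//; lra.
move=> a b ar br.
have ra : cabs a + cabs d%:C < 1 by rewrite dC; lra.
have rb : cabs b + cabs d%:C < 1 by rewrite dC; lra.
rewrite -(cderiv_mean af dC0 ra) -(cderiv_mean af dC0 rb) /cmean -cintB; last 2 first.
- by move=> t _; exact: ccont_quot.
- by move=> t _; exact: ccont_quot.
apply: cmean_abs_le => t; first by apply: ccontB; exact: ccont_quot.
rewrite -mulrBl cabsM cabsV [cabs (_ * ecirc _)]cabsM dC cabs_ecirc mulr1 [leRHS]mulrAC ler_pM2r ?invr_gt0//.
have ha := cabs_circle_le a d%:C t; have hb := cabs_circle_le b d%:C t.
have -> : f (a + d%:C * ecirc t) - f a - (f (b + d%:C * ecirc t) - f b) =
  (f (a + d%:C * ecirc t) - f (b + d%:C * ecirc t)) - (f a - f b) by ring.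
apply: le_trans (cabsB _ _) _.
have -> : 2 * L * cabs (a - b) = L * cabs (a - b) + L * cabs (a - b) by ring.
apply: lerD; last by apply: HL; lra.
have E : a + d%:C * ecirc t - (b + d%:C * ecirc t) = a - b by ring.
by rewrite -E; apply: HL; rewrite dC in ha hb; lra.
Qed.

Lemma quot_identity (A B C D G1 G0 h u : CC) :
  (A - B) * u - (C - D) * u - h * ((G1 - G0) * u) = ((A - C - h * G1) - (B - D - h * G0)) * u.
Proof. by ring. Qed.

Lemma quot_identity2 (F A D w : CC) : w != 0 ->
  F / w - A - D / 2 * w = (F - w * A - D / 2 * w ^+ 2) / w.
Proof.
move=> w0; rewrite [w * A]mulrC expr2 mulrA !mulrBl !mulfK//.
Qed.

(** Differentiation of [cderiv_mean] under the integral sign: the candidate M is the mean of the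
    differentiated quotient, and the bound [taylor], uniform on the circle, makes the remainder of
    order |h|^2. *)
Lemma cderiv_analytic f : analytic_disc f -> analytic_disc (cderiv f).
Proof.
move=> af; apply: analytic_disc_hol => c c1.
(* A quarter of the distance to the boundary: the circle of radius d about c, moved by at most d,
   stays in the disc of radius 1 - 2d, where f' is Lipschitz. *)
pose d := (1 - cabs c) / 4.
have d0 : 0 < d by rewrite /d; lra.
have dE : cabs c = 1 - 4 * d by rewrite /d; lra.
clearbody d.
have c0 := cabs_ge0 c.
have dC : cabs d%:C = d by rewrite cabsR_ge0// ltW.
have dC0 : d%:C != 0 :> CC by rewrite -cabs_gt0 dC.
have [|L [L0 HL]] := @cderiv_lipschitz f (1 - 2 * d) af; first lra.
pose M := cmean (fun t => (cderiv f (c + d%:C * ecirc t) - cderiv f c) / (d%:C * ecirc t)).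
exists M => e e0.
have taylor z h : cabs z <= 1 - 3 * d -> cabs h <= d ->
    cabs (f (z + h) - f z - h * cderiv f z) <= L * cabs h * cabs h.
  move=> zd hd.
  pose g (x : CC) := f x - x * cderiv f z.
  have -> : f (z + h) - f z - h * cderiv f z = g (z + h) - g z by rewrite /g; ring.
  have E : z + h - z = h by ring.
  have := @cderiv_mvt g z (z + h) (L * cabs h); rewrite E; apply => t /andP[t0 t1].
  have ht : cabs (t%:C * h) <= cabs h.
    by rewrite cabsM cabsR_ge0// ler_piMl// cabs_ge0.
  have zt : cabs (z + t%:C * h) <= 1 - 2 * d by apply: le_trans (cabsD _ _) _; lra.
  exists (cderiv f (z + t%:C * h) - 1 * cderiv f z).
    apply: has_cderivB; first by apply: analyticP => //; lra.
    have := has_cderivM (has_cderiv_id (z + t%:C * h)) (has_cderiv_cst (cderiv f z) (z + t%:C * h)).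
    by rewrite /= mulr0 addr0.
  rewrite mul1r; apply: le_trans (HL _ _ zt _) _; first lra.
  have -> : z + t%:C * h - z = t%:C * h by ring.
  by rewrite ler_wpM2l.
have cG t : cabs (c + d%:C * ecirc t) <= 1 - 3 * d.
  by have := cabs_circle_le c d%:C t; rewrite dC; lra.
have cGc t : ccont (fun t => cderiv f (c + d%:C * ecirc t)) t.
  move=> e1 e10; have L1 : 0 < L * d + 1 by rewrite ltr_wpDl// mulr_ge0// ltW.
  have [d1 d10 H1] := @ccont_ecirc t _ (divr_gt0 e10 L1).
  exists d1 => // h /H1; rewrite ltr_pdivlMr// => H2.
  have h3 := cG (t + h); have h4 := cG t.
  apply: le_lt_trans (HL _ _ _ _) _; [lra|lra|].
  rewrite [X in cabs X](_ : _ = d%:C * (ecirc (t + h) - ecirc t)); last by ring.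
  by rewrite cabsM dC; have := cabs_ge0 (ecirc (t + h) - ecirc t); nra.
have cE t : ccont (fun t => (d%:C * ecirc t)^-1) t.
  have wt : d%:C * ecirc t != 0 by rewrite mulf_neq0 ?ecirc_neq0.
  apply: (ccont_comp (has_cderivV wt)).
  by apply: ccontM; [exact: ccont_cst|exact: ccont_ecirc].
exists (Num.min d (e * d / (2 * L + 1))).
  by rewrite lt_min d0 divr_gt0 ?mulr_gt0//; lra.
move=> h; rewrite lt_min ltr_pdivlMr; last lra.
move=> /andP[hd he].
have h0 := cabs_ge0 h.
have rc : cabs c + cabs d%:C < 1 by rewrite dC; lra.
have ch1 : cabs (c + h) <= 1 - 3 * d by apply: le_trans (cabsD _ _) _; lra.
have rch : cabs (c + h) + cabs d%:C < 1 by rewrite dC; lra.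
rewrite -(cderiv_mean af dC0 rch) -(cderiv_mean af dC0 rc).
have cM t : ccont (fun t => (cderiv f (c + d%:C * ecirc t) - cderiv f c) / (d%:C * ecirc t)) t.
  by apply: ccontM; [apply: ccontB; [exact: cGc|exact: ccont_cst]|exact: cE].
rewrite /M [_ * h]mulrC /cmean -cintZ; last by move=> t _; exact: cM.
rewrite -cintB; last 2 first.
- by move=> t _; exact: ccont_quot.
- by move=> t _; exact: ccont_quot.
rewrite -cintB; last 2 first.
- by move=> t _; apply: ccontB; exact: ccont_quot.
- by move=> t _; apply: ccontM; [exact: ccont_cst|exact: cM].
apply: cmean_abs_le => t.
  apply: ccontB; first by apply: ccontB; exact: ccont_quot.
  by apply: ccontM; [exact: ccont_cst|exact: cM].
have -> : (f (c + h + d%:C * ecirc t) - f (c + h)) / (d%:C * ecirc t) -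
   (f (c + d%:C * ecirc t) - f c) / (d%:C * ecirc t) -
   h * ((cderiv f (c + d%:C * ecirc t) - cderiv f c) / (d%:C * ecirc t)) =
  ((f (c + d%:C * ecirc t + h) - f (c + d%:C * ecirc t) - h * cderiv f (c + d%:C * ecirc t)) -
   (f (c + h) - f c - h * cderiv f c)) / (d%:C * ecirc t).
  by rewrite [c + h + _]addrAC; exact: quot_identity.
rewrite cabsM cabsV [cabs (_ * ecirc _)]cabsM dC cabs_ecirc mulr1 ler_pdivrMr//.
apply: le_trans (cabsB _ _) _.
have t1 := taylor _ h (cG t) (ltW hd).
have t2 := taylor c h _ (ltW hd).
have {}t2 : cabs (f (c + h) - f c - h * cderiv f c) <= L * cabs h * cabs h.
  by apply: t2; rewrite dE; move: d0; clear; lra.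
apply: le_trans (lerD t1 t2) _.
move: he h0 L0 d0; clear; move: (cabs h) => x; nra.
Qed.

(** Removable singularity at 0: f z / z takes the value f'(0) there, and its derivative at 0 is half
    the second derivative of f. *)
Lemma analytic_div_id f : analytic_disc f -> f 0 = 0 ->
  exists k, analytic_disc k /\ forall z, f z = z * k z.
Proof.
move=> af f0; have af' := cderiv_analytic af.
have c1 : cabs 0 < 1 by rewrite cabs0.
have df0 := analyticP af c1.
have ddf0 := analyticP af' c1.
pose k (z : CC) := if z == 0 then cderiv f 0 else f z / z.
exists k; split; last first.
  by move=> z; rewrite /k; have [->|z0] := eqVneq z 0; [rewrite mul0r f0|rewrite mulrC divfK].
apply: analytic_disc_hol => z z1.
have [->|z0] := eqVneq z 0; last first.
  exists (cderiv f z / z + f z * - z^-2).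
  have := has_cderivM (analyticP af z1) (has_cderivV z0).
  have zz : 0 < cabs z by rewrite cabs_gt0.
  apply: (has_cderiv_ext zz) => w wz; rewrite /k.
  case: eqP => // E; have : cabs w = cabs z by rewrite -(addr0_eq E) cabsN.
  by move=> e; rewrite e ltxx in wz.
pose D := cderiv (cderiv f) 0.
exists (D / 2) => e e0.
have [d d0 H] := ddf0 _ e0.
exists (Num.min d 1); first by rewrite lt_min d0 ltr01.
move=> w; rewrite lt_min add0r => /andP[wd w1].
rewrite /k eqxx; have [->|w0] := eqVneq w 0.
  by rewrite subrr mulr0 subr0 cabs0 mulr0.
have wpos : 0 < cabs w by rewrite cabs_gt0.
have -> : f w / w - cderiv f 0 - D / 2 * w = (f w - w * cderiv f 0 - D / 2 * w ^+ 2) / w.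
  exact: quot_identity2.
rewrite cabsM cabsV ler_pdivrMr//.
(* The derivative f'(x) - f'(0) - D x of g is at most e |x| by differentiability of f' at 0; the
   mean value inequality then bounds g w - g 0 by e |w|^2. *)
pose g (x : CC) := f x - x * cderiv f 0 - D / 2 * x ^+ 2.
have -> : f w - w * cderiv f 0 - D / 2 * w ^+ 2 = g w - g 0.
  by rewrite /g f0; ring.
have := @cderiv_mvt g 0 w (e * cabs w); rewrite subr0; apply => t /andP[t0 t1].
rewrite add0r.
have ht : cabs (t%:C * w) <= cabs w.
  by rewrite cabsM cabsR_ge0// ler_piMl// cabs_ge0.
exists (cderiv f (t%:C * w) - 1 * cderiv f 0 - D / 2 * (2%:R * (t%:C * w) ^+ 1)).
  apply: has_cderivB; last by apply: has_cderivZ; exact: has_cderivX.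
  apply: has_cderivB; first by apply: analyticP => //; lra.
  have := has_cderivM (has_cderiv_id (t%:C * w)) (has_cderiv_cst (cderiv f 0) (t%:C * w)).
  by rewrite /= mulr0 addr0.
have := H _ (le_lt_trans ht wd); rewrite add0r => K.
rewrite [X in cabs X](_ : _ = cderiv f (t%:C * w) - cderiv f 0 - D * (t%:C * w)); last first.
  by rewrite mul1r expr1 mulrA divfK ?pnatr_eq0.
by apply: le_trans K _; rewrite ler_wpM2l// ltW.
Qed.

(** * Circular means of |h|^q *)

(* f is the pointwise limit of the functions f (floor (n x) / n, y). *)
Lemma measurable_sep_cont (R : realType) (D : set (R * R)) (f : R * R -> R) : measurable D ->
  (forall x y, D (x, y) -> {for x, continuous (fun s : R => f (s, y))}) ->
  (forall x, measurable_fun setT (fun y : R => f (x, y))) -> measurable_fun D f.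
Proof.
move=> mD cf mf.
pose g (n : nat) (z : R * R) := f ((Num.floor (z.1 * n.+1%:R))%:~R / n.+1%:R, z.2).
apply: (@measurable_fun_cvg _ _ _ D g f).
  move=> n _ B mB.
  have -> : D `&` g n @^-1` B = D `&` \bigcup_(k : int)
     ([set x : R | k%:~R <= x * n.+1%:R < (k + 1)%:~R] `*` [set y | B (f (k%:~R / n.+1%:R, y))]).
    apply/seteqP; split => -[x y] /= [Dxy].
      move=> Bg; split => //; exists (Num.floor (x * n.+1%:R)) => //=; split => //.
      by rewrite floor_le_tmp floorD1_gt.
    move=> [k _ /= [xk By]]; split => //; rewrite /g /=.
    by rewrite (floor_def xk).
  apply: measurableI => //; apply: countable_bigcupT_measurable => // k.
  apply: measurableX.
    have -> : [set x : R | k%:~R <= x * n.+1%:R < (k + 1)%:~R] = `[k%:~R / n.+1%:R, (k + 1)%:~R / n.+1%:R[%classic.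
      by apply/seteqP; split => x /=; rewrite in_itv /= ler_pdivrMr// ltr_pdivlMr.
    exact: measurable_itv.
  by have := mf (k%:~R / n.+1%:R) measurableT _ mB; rewrite setTI.
move=> [x y] Dxy; apply/cvgrPdist_lt => e e0.
have [d d0 H] := eps_continuous (cf x y Dxy) e0.
exists (Num.truncn d^-1) => // n /= nd.
rewrite distrC /g /=; set s := _ / _.
have sx : `|s - x| < d.
  have n0 : (0 : R) < n.+1%:R by rewrite ltr0n.
  have h1 := floor_le_tmp (x * n.+1%:R); have h2 := floorD1_gt (x * n.+1%:R).
  have : d^-1 < n.+1%:R.
    apply: lt_le_trans (truncnS_gt _) _.
    by rewrite ler_nat ltnS.
  rewrite invf_plt ?posrE// => nd'; apply: le_lt_trans nd'.
  rewrite distrC ger0_norm; last by rewrite /s subr_ge0 ler_pdivrMr.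
  rewrite /s -(ler_pM2r n0) mulrBl divfK ?gt_eqF// mulVf ?gt_eqF//.
  by move: h2; rewrite intrD; lra.
by have := H _ sx; rewrite subrKC.
Qed.

Lemma mean_EFin (R : realType) (u : R -> R) : continuous u ->
  (\int[@lebesgue_measure R]_(t in [set` `[(0:R), 1]%R]) (u t)%:E)%E = (mean u)%:E.
Proof.
move=> cu; rewrite /mean /rint /Rintegral fineK//.
apply: integrable_fin_num => //; apply: cont_on_integrable => t _; exact: cu.
Qed.

(** Tonelli on the unit square. Separate continuity already yields joint measurability
    ([measurable_sep_cont]), and continuity of the partial means turns the extended integrals back
    into [mean]. *)
Lemma mean_swap_ge0 (R : realType) (f : R -> R -> R) :
  (forall x y, 0 <= f x y) -> (forall y, continuous (f ^~ y)) -> (forall x, continuous (f x)) ->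
  continuous (fun x => mean (f x)) -> continuous (fun y => mean (f ^~ y)) ->
  mean (fun x => mean (f x)) = mean (fun y => mean (f ^~ y)).
Proof.
move=> f0 c1 c2 cm1 cm2; apply/EFin_inj; apply: (etrans (esym (mean_EFin cm1))); apply: etrans (mean_EFin cm2).
pose I := `[0 : R, 1]%classic.
pose mu := @lebesgue_measure R.
pose g := (fun z : R * R => (f z.1 z.2)%:E) \_ (I `*` I).
have mI : measurable I by exact: measurable_itv.
have mg : measurable_fun setT g.
  apply/(measurable_restrictT _ _).1 => //; first exact: measurableX.
  apply: measurable_funTS; apply/measurable_EFinP.
  apply: measurable_sep_cont => //=.
    by move=> x y _; exact: c1.
  by move=> x; apply: continuous_measurable_fun; exact: c2.
have g0 z : (0 <= g z)%E by rewrite /g patchE; case: ifP => // _; rewrite lee_fin.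
have e1 x : I x -> (\int[mu]_y g (x, y) = (mean (f x))%:E)%E.
  move=> Ix; rewrite -mean_EFin// [RHS]integral_mkcond; apply: eq_integral => y _.
  rewrite /g !patchE /=; congr (if _ then _ else _).
  by rewrite in_setX (mem_set Ix).
have e1' x : ~ I x -> (\int[mu]_y g (x, y) = 0)%E.
  move=> Ix; apply: integral0_eq => y _; rewrite /g patchE in_setX.
  by case: ifP => // /andP[/set_mem].
have e2 y : I y -> (\int[mu]_x g (x, y) = (mean (f ^~ y))%:E)%E.
  move=> Ix; rewrite -mean_EFin// [RHS]integral_mkcond; apply: eq_integral => x _.
  rewrite /g !patchE /=; congr (if _ then _ else _).
  by rewrite in_setX (mem_set Ix) andbT.
have e2' y : ~ I y -> (\int[mu]_x g (x, y) = 0)%E.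
  move=> Ix; apply: integral0_eq => x _; rewrite /g patchE in_setX.
  by case: ifP => // /andP[_ /set_mem].
have := @fubini_tonelli _ _ _ _ R mu mu g mg g0.
rewrite [X in X = _ -> _](_ : _ = (\int[mu]_(x in I) (mean (f x))%:E)%E); last first.
  rewrite [RHS]integral_mkcond; apply: eq_integral => x _; rewrite patchE.
  by case: ifPn => [/set_mem /e1 //|/negP xI]; apply: e1' => /mem_set.
rewrite [X in _ = X -> _](_ : _ = (\int[mu]_(x in I) (mean (f ^~ x))%:E)%E)//.
rewrite [RHS]integral_mkcond; apply: eq_integral => x _; rewrite patchE.
by case: ifPn => [/set_mem /e2 //|/negP xI]; apply: e2' => /mem_set.
Qed.

Lemma mean_cst (R : realType) (c : R) : mean (fun=> c) = c.
Proof. by rewrite /mean rint_cst// subr0 mulr1. Qed.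

Lemma meanD (R : realType) (u v : R -> R) : continuous u -> continuous v ->
  mean (fun t => u t + v t) = mean u + mean v.
Proof. by move=> cu cv; apply: rintD => t _; [exact: cu|exact: cv]. Qed.

Lemma meanZ (R : realType) (c : R) (u : R -> R) : continuous u ->
  mean (fun t => c * u t) = c * mean u.
Proof. by move=> cu; apply: rintZ => t _; exact: cu. Qed.

Lemma le_mean (R : realType) (u v : R -> R) : continuous u -> continuous v ->
  (forall t, u t <= v t) -> mean u <= mean v.
Proof. by move=> cu cv uv; apply: le_rint => // t _; [exact: cu|exact: cv]. Qed.

Lemma mean_ge0 (R : realType) (u : R -> R) : (forall t, 0 <= u t) -> 0 <= mean u.
Proof. by move=> u0; apply: rint_ge0 => t _; exact: u0. Qed.

Lemma mean_le (R : realType) (u : R -> R) M : continuous u -> (forall t, u t <= M) -> mean u <= M.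
Proof. by move=> cu uM; rewrite -[M]mean_cst; apply: le_mean => // t; exact: cst_continuous. Qed.

Lemma continuousDcst (R : realType) (u : R -> R) (M : R) : continuous u -> continuous (fun t => u t + M).
Proof. by move=> cu t; apply: (contD_at (cu t)); exact: cst_continuous. Qed.

Lemma meanDcst (R : realType) (u : R -> R) (M : R) : continuous u ->
  mean (fun t => u t + M) = mean u + M.
Proof. by move=> cu; rewrite meanD// ?mean_cst// => t; exact: cst_continuous. Qed.

Lemma mean_dist (R : realType) (u v : R -> R) (M : R) : continuous u -> continuous v ->
  (forall t, `|u t - v t| <= M) -> `|mean u - mean v| <= M.
Proof.
move=> cu cv uv.
have key (f g : R -> R) : continuous f -> continuous g -> (forall t, f t <= g t + M) ->
    mean f <= mean g + M.
  move=> cf cg fg; rewrite -[leRHS](meanDcst _ cg).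
  by apply: le_mean => //; exact: continuousDcst.
have h1 : mean u <= mean v + M by apply: key => // t; have := uv t; rewrite ler_norml; lra.
have h2 : mean v <= mean u + M by apply: key => // t; have := uv t; rewrite ler_norml; lra.
by rewrite ler_norml; lra.
Qed.

(** Adding the bound M makes the integrand nonnegative and raises both iterated means by M. *)
Lemma mean_swap (R : realType) (f : R -> R -> R) (M : R) :
  (forall x y, `|f x y| <= M) -> (forall y, continuous (f ^~ y)) -> (forall x, continuous (f x)) ->
  continuous (fun x => mean (f x)) -> continuous (fun y => mean (f ^~ y)) ->
  mean (fun x => mean (f x)) = mean (fun y => mean (f ^~ y)).
Proof.
move=> fM c1 c2 cm1 cm2.
have cD (u : R -> R) : continuous u -> continuous (fun t => u t + M) by exact: continuousDcst.
have E1 x : mean (fun y => f x y + M) = mean (f x) + M by rewrite meanDcst.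
have E2 y : mean (fun x => f x y + M) = mean (f ^~ y) + M by rewrite meanDcst.
have := @mean_swap_ge0 R (fun x y => f x y + M).
rewrite (eq_fun E1) (eq_fun E2) (meanDcst _ cm1) (meanDcst _ cm2) => H; apply: (addIr M); apply: H.
- by move=> x y; have := fM x y; rewrite ler_norml; lra.
- by move=> y; exact: cD.
- by move=> x; exact: cD.
- exact: cD.
- exact: cD.
Qed.

(** Young's inequality for x times 1 with the conjugate exponents s and s / (s - 1). *)
Lemma powR_tangent (R : realType) (x s : R) : 0 <= x -> 1 <= s -> 1 + s * (x - 1) <= x `^ s.
Proof.
move=> x0; rewrite le_eqVlt => /predU1P[<-|s1]; first by rewrite powRr1//; lra.
have s0 : 0 < s by lra.
have q0 : 0 < s / (s - 1) by rewrite divr_gt0//; lra.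
have := @conjugate_powR R x 1 s (s / (s - 1)) x0 ler01 s0 q0.
rewrite powR1 mulr1 mul1r invf_div => H.
have {}H : x <= x `^ s / s + (s - 1) / s by apply: H; field; lra.
have : s * x <= s * (x `^ s / s + (s - 1) / s) by rewrite ler_pM2l.
have -> : s * (x `^ s / s + (s - 1) / s) = x `^ s + (s - 1) by field; lra.
lra.
Qed.

Lemma continuous_Ml (R : realType) (c : R) (u : R -> R) : continuous u -> continuous (fun t => c * u t).
Proof. by move=> cu t; apply: (contM_at _ (cu t)); exact: cst_continuous. Qed.

Lemma powRV (R : realType) (a q : R) : 0 <= a -> a^-1 `^ q = (a `^ q)^-1.
Proof. by move=> a0; rewrite -(powR_inv1 a0) -powRrM mulN1r powRN. Qed.

(** The ratios a/(a+b) and b/(a+b) lie in [0, 1], so each is at most its power q; their sum is 1. *)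
Lemma powRD_le (R : realType) (a b q : R) : 0 <= a -> 0 <= b -> 0 < q <= 1 ->
  (a + b) `^ q <= a `^ q + b `^ q.
Proof.
move=> a0 b0 /andP[q0 q1].
have [ab0|abn] := eqVneq (a + b) 0.
  rewrite ab0 powR0 ?gt_eqF// addr_ge0// powR_ge0//.
have s0 : 0 < a + b by rewrite lt0r abn addr_ge0.
have key (x : R) : 0 <= x <= a + b -> x / (a + b) * (a + b) `^ q <= x `^ q.
  move=> /andP[x0 xs]; have [->|xn] := eqVneq x 0; first by rewrite !mul0r powR_ge0.
  have d0 : 0 <= x / (a + b) by rewrite divr_ge0// ltW.
  rewrite [leRHS](_ : _ = (x / (a + b)) `^ q * (a + b) `^ q); last first.
    by rewrite -powRM ?divfK// ltW.
  rewrite ler_wpM2r ?powR_ge0//.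
  apply: ger1_powR => //; apply/andP; split; last by rewrite ler_pdivrMr// mul1r.
  by rewrite divr_gt0// lt0r xn.
have := key a _; have := key b _ => hb ha.
have {}ha := ha (ltac:(lra)); have {}hb := hb (ltac:(lra)).
apply: le_trans (lerD ha hb).
by rewrite -mulrDl -mulrDl divff// mul1r.
Qed.

(** A power q < 1 is not Lipschitz at 0; this Hoelder bound gives uniform estimates for |h|^q across
    the zeros of h. *)
Lemma powR_dist (R : realType) (a b q : R) : 0 <= a -> 0 <= b -> 0 < q <= 1 ->
  `|a `^ q - b `^ q| <= `|a - b| `^ q.
Proof.
move=> a0 b0 q01; have /andP[q0 q1] := q01.
have key (x y : R) : 0 <= x -> 0 <= y -> x `^ q - y `^ q <= `|x - y| `^ q.
  move=> x0 y0; rewrite lerBlDl; apply: le_trans (powRD_le _ _ q01) => //.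
  apply: ge0_ler_powR; rewrite ?nnegrE ?addr_ge0// ?(ltW q0)//.
  have := ler_norm (x - y); lra.
by rewrite ler_norml lerNl opprB {1}distrC !key.
Qed.

Lemma powR_small (R : realType) (q e : R) : 0 < q -> 0 < e ->
  exists2 d : R, 0 < d & forall x, 0 <= x -> x < d -> x `^ q < e.
Proof.
move=> q0 e0; exists (e `^ q^-1); first exact: powR_gt0.
move=> x x0 xd; rewrite -[ltRHS](_ : (e `^ q^-1) `^ q = e); last first.
  by rewrite -powRrM mulVf ?gt_eqF// powRr1// ltW.
by apply: gt0_ltr_powR => //; rewrite ?nnegrE ?powR_ge0.
Qed.

Lemma cont_powR_cabs (F : RR -> CC) (t q eta : RR) : ccont F t -> 0 < q <= 1 -> 0 <= eta ->
  {for t, continuous (fun s => (cabs (F s) + eta) `^ q)}.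
Proof.
move=> cF q01 eta0; have /andP[q0 q1] := q01; apply: continuous_eps => e e0.
have [d d0 H] := powR_small q0 e0.
have [d' d'0 H'] := cF _ d0.
exists d' => // h /H' {}H'.
apply: le_lt_trans (powR_dist _ _ q01) _; rewrite ?addr_ge0 ?cabs_ge0//.
apply: H; rewrite ?normr_ge0//; apply: le_lt_trans H'.
by rewrite opprD addrACA subrr addr0 cabs_distn.
Qed.

Notation csqrt := (@sqrtc RR : CC -> CC).

Lemma csqrt_sqr (z : CC) : csqrt z * csqrt z = z.
Proof. by have := sqr_sqrtc z; rewrite expr2. Qed.

Lemma Re_csqrt_gt0 (z : CC) : 0 < cRe z -> 0 < cRe (csqrt z).
Proof.
case: z => a b /= a0; rewrite sqrtr_gt0 divr_gt0//.
by rewrite ltr_wpDl// sqrtr_ge0.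
Qed.

Lemma cabs_csqrt (z : CC) : cabs (csqrt z) ^+ 2 = cabs z.
Proof. by rewrite -cabsX expr2 csqrt_sqr. Qed.

(** With s = sqrt z and s1 = sqrt (z + w) one has w = (s1 - s)(s1 + s); both roots have positive
    real part, so |s1 + s| >= Re s keeps the denominators away from 0. *)
Lemma has_cderiv_csqrt (z : CC) : 0 < cRe z -> has_cderiv csqrt z (2 * csqrt z)^-1.
Proof.
move=> z0 e e0.
set s := csqrt z; have s0 : 0 < cRe s := Re_csqrt_gt0 z0.
set m := cRe s in s0.
have sm : m <= cabs s by apply: le_trans (Re_le_cabs s); exact: ler_norm.
have m3 : 0 < 2 * m ^+ 3 by rewrite mulr_gt0// exprn_gt0.
exists (Num.min (cRe z) (e * (2 * m ^+ 3))).
  by rewrite lt_min z0 mulr_gt0.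
move=> w; rewrite lt_min => /andP[wz we].
have w0 := cabs_ge0 w.
have zw0 : 0 < cRe (z + w).
  rewrite cReD; have := Re_le_cabs w; rewrite ler_norml; lra.
set s1 := csqrt (z + w); have s10 : 0 < cRe s1 := Re_csqrt_gt0 zw0.
have sD : m <= cabs (s1 + s).
  apply: le_trans (Re_le_cabs _); apply: le_trans (ler_norm _); rewrite cReD -/m; lra.
have sn0 : s != 0 by rewrite -cabs_gt0; lra.
have ssn0 : s1 + s != 0 by rewrite -cabs_gt0; lra.
have wE : w = (s1 - s) * (s1 + s).
  have h1 := csqrt_sqr (z + w); have h2 := csqrt_sqr z.
  rewrite -/s -/s1 in h1 h2.
  have -> : (s1 - s) * (s1 + s) = s1 * s1 - s * s by ring.
  by rewrite h1 h2 [z + w]addrC addrK.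
have -> : s1 - s - (2 * s)^-1 * w = - (w * (w * (((s1 + s) * (s1 + s)) * (2 * s))^-1)).
  by rewrite wE; field; rewrite ssn0 sn0.
rewrite cabsN !cabsM cabsV mulrC ler_wpM2r//.
have c2 : cabs (2 : CC) = 2 by rewrite -(cabsR_ge0 (_ : 0 <= 2))// rmorph_nat.
have den : 2 * m ^+ 3 <= cabs ((s1 + s) * (s1 + s) * (2 * s)).
  rewrite !cabsM c2.
  have -> : 2 * m ^+ 3 = m * m * (2 * m) by ring.
  rewrite ler_pM ?mulr_ge0 ?(ltW s0)//; last by rewrite ler_pM2l.
  by rewrite ler_pM ?(ltW s0).
rewrite ler_pdivrMr; last by apply: lt_le_trans den.
apply: le_trans (ltW we) _; by rewrite ler_pM2l.
Qed.

(* On the circle k/k(z) has a holomorphic square root S with S(z) = 1; as |S|^(2q) lies above its tangent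
   1 + 2q (|S| - 1) and Re S <= |S|, the mean value property of S suffices. This is where 1/2 <= q enters. *)
Lemma submean_nonvanishing (k : CC -> CC) (z w : CC) (q : RR) : 1 / 2 <= q <= 1 ->
  (forall x, cabs (x - z) <= cabs w -> exists d, has_cderiv k x d) ->
  (forall x, cabs (x - z) <= cabs w -> cabs (k x - k z) < cabs (k z)) ->
  cabs (k z) `^ q <= mean (fun t => cabs (k (z + w * ecirc t)) `^ q).
Proof.
move=> /andP[q2 q1] dk near.
have q01 : 0 < q <= 1 by lra.
have kz0 : 0 < cabs (k z).
  by apply: le_lt_trans (near z _); rewrite ?subrr ?cabs0 ?cabs_ge0.
have kzn : k z != 0 by rewrite -cabs_gt0.
pose g x := (k z)^-1 * k x.
have gRe x : cabs (x - z) <= cabs w -> 0 < cRe (g x).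
  move=> xw; have h : cabs (g x - 1) < 1.
    have -> : g x - 1 = (k z)^-1 * (k x - k z) by rewrite /g mulrBr mulVf.
    by rewrite cabsM cabsV mulrC ltr_pdivrMr// mul1r near.
  have := Re_le_cabs (g x - 1); rewrite cReB /= ler_norml; lra.
have circ t : cabs (z + w * ecirc t - z) <= cabs w.
  by rewrite [z + _]addrC addrK cabsM cabs_ecirc mulr1.
pose S x := csqrt (g x).
have dg x : cabs (x - z) <= cabs w -> exists d, has_cderiv g x d.
  by move=> /dk [d hd]; exists ((k z)^-1 * d); exact: has_cderivZ.
have dS x : cabs (x - z) <= cabs w -> exists d, has_cderiv S x d.
  move=> xw; have [d hd] := dg _ xw; eexists.
  exact: (has_cderiv_comp hd (has_cderiv_csqrt (gRe _ xw))).
have cS t : ccont (fun t => S (z + w * ecirc t)) t.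
  have [d hd] := dS _ (circ t); apply: (ccont_comp hd); exact: ccont_circle.
have ck t : ccont (fun t => k (z + w * ecirc t)) t.
  have [d hd] := dk _ (circ t); apply: (ccont_comp hd); exact: ccont_circle.
have Sz : S z = 1 by rewrite /S /g mulVf// [csqrt _]sqrtc1.
have m1 : 1 <= mean (fun t => cabs (S (z + w * ecirc t))).
  have := circle_mean dS; rewrite Sz => E.
  by rewrite -cabs1 -E; apply: cint_triangle => // t _; exact: cS.
have Skq x : cabs (S x) `^ (2 * q) = (cabs (k z) `^ q)^-1 * cabs (k x) `^ q.
  rewrite powRrM (powR_mulrn 2 (cabs_ge0 _)) cabs_csqrt /g.
  rewrite cabsM cabsV powRM ?invr_ge0 ?cabs_ge0//; congr (_ * _).
  by rewrite powRV// cabs_ge0.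
have kq0 : 0 < cabs (k z) `^ q by exact: powR_gt0.
have cSc : continuous (fun t => cabs (S (z + w * ecirc t))) by move=> t; apply: ccont_cabs.
have ckq : continuous (fun t => cabs (k (z + w * ecirc t)) `^ q).
  move=> t; have := cont_powR_cabs (ck t) q01 (lexx 0).
  by apply: cont_ext => s; rewrite addr0.
suff : 1 <= mean (fun t => cabs (S (z + w * ecirc t)) `^ (2 * q)).
  rewrite (_ : (fun t => cabs (S (z + w * ecirc t)) `^ (2 * q)) =
     (fun t => (cabs (k z) `^ q)^-1 * cabs (k (z + w * ecirc t)) `^ q)); last by apply/funext => t.
  by rewrite meanZ// mulrC ler_pdivlMr// mul1r.
apply: (@le_trans _ _ (mean (fun t => 2 * q * cabs (S (z + w * ecirc t)) + (1 - 2 * q)))).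
  rewrite meanDcst; last exact: (@continuous_Ml RR).
  by rewrite meanZ//; nra.
apply: le_mean.
- by apply: (@continuousDcst RR); exact: (@continuous_Ml RR).
- rewrite (_ : (fun t => cabs (S (z + w * ecirc t)) `^ (2 * q)) =
     (fun t => (cabs (k z) `^ q)^-1 * cabs (k (z + w * ecirc t)) `^ q)); last by apply/funext => t.
  exact: (@continuous_Ml RR).
- move=> t; have := @powR_tangent RR (cabs (S (z + w * ecirc t))) (2 * q) (cabs_ge0 _); lra.
Qed.

Lemma continuous_D (R : realType) (u v : R -> R) : continuous u -> continuous v ->
  continuous (fun t => u t + v t).
Proof. by move=> cu cv t; apply: (contD_at (cu t) (cv t)). Qed.

Lemma powR_le (R : realType) (a b q : R) : 0 < q -> 0 <= a -> a <= b -> a `^ q <= b `^ q.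
Proof. by move=> q0 a0 ab; apply: ge0_ler_powR; rewrite ?nnegrE// ?(ltW q0)// (le_trans a0). Qed.

Lemma ecirc_lip s t : cabs (ecirc s - ecirc t) <= 2 * pi * `|s - t|.
Proof.
have p0 : 0 <= 2 * pi :> RR by rewrite mulr_ge0// pi_ge0.
have E (a b : RR) : cabs ((0 +i* a)%C - (0 +i* b)%C) = `|a - b|.
  by rewrite /cabs /= subrr expr0n add0r sqrtr_sqr.
have := @cderiv_mvt cexp (0 +i* (2 * pi * t))%C (0 +i* (2 * pi * s))%C 1.
have -> : cabs ((0 +i* (2 * pi * s))%C - (0 +i* (2 * pi * t))%C) = 2 * pi * `|s - t|.
  rewrite E; have -> : 2 * pi * s - 2 * pi * t = 2 * pi * (s - t) by ring.
  by rewrite normrM ger0_norm.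
rewrite mul1r; apply => x _.
eexists; first exact: has_cderiv_cexp.
by rewrite cabs_cexp /= subrr !mul0r mulr0 subr0 addr0 expR0.
Qed.

Lemma cabs_mulcirc c t : cabs (c * ecirc t) = cabs c.
Proof. by rewrite cabsM cabs_ecirc mulr1. Qed.

Lemma continuous_mean_param (F : RR -> RR -> RR) (K q : RR) : 0 < q -> 0 <= K ->
  (forall x, continuous (F x)) -> (forall x x' y, `|F x y - F x' y| <= (K * `|x - x'|) `^ q) ->
  continuous (fun x => mean (F x)).
Proof.
move=> q0 K0 cF FK x; apply: (@continuous_eps RR) => e e0.
have [d d0 H] := powR_small q0 e0.
have K1 : 0 < K + 1 by lra.
exists (d / (K + 1)); first by rewrite divr_gt0.
move=> h; rewrite ltr_pdivlMr// => hd.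
have h0 := normr_ge0 h.
apply: le_lt_trans (mean_dist (M := (K * `|h|) `^ q) _ _ _) _ => //.
  move=> t; have := FK (x + h) x t; by rewrite [x + h]addrC addrK.
by apply: H; [rewrite mulr_ge0|nra].
Qed.

Definition powmod (h : CC -> CC) (eta q : RR) (z : CC) : RR := (cabs (h z) + eta) `^ q.

Lemma powmod_dist h (eta q r : RR) : analytic_disc h -> 0 <= eta -> 0 < q <= 1 -> 0 <= r < 1 ->
  exists L : RR, 0 <= L /\ forall a b, cabs a <= r -> cabs b <= r ->
    `|powmod h eta q a - powmod h eta q b| <= (L * cabs (a - b)) `^ q.
Proof.
move=> ah eta0 q01 r01; have [L [L0 HL]] := analytic_lipschitz ah r01.
exists L; split => // a b ar br.
apply: le_trans (powR_dist _ _ q01) _; rewrite ?addr_ge0 ?cabs_ge0//.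
apply: ge0_ler_powR; rewrite ?nnegrE ?mulr_ge0 ?cabs_ge0//; first by lra.
rewrite opprD addrACA subrr addr0; apply: le_trans (cabs_distn _ _) _; exact: HL.
Qed.

Lemma powmod_cont h eta q (g : RR -> CC) t : analytic_disc h -> 0 <= eta -> 0 < q <= 1 ->
  cabs (g t) < 1 -> ccont g t -> {for t, continuous (fun s => powmod h eta q (g s))}.
Proof.
move=> ah eta0 q01 gt1 cg; apply: cont_powR_cabs => //.
exact: (ccont_comp (analyticP ah gt1)).
Qed.

(** For a unimodular c with h z = |h z| c, the function k = h + eta c satisfies |k| <= |h| + eta
    with equality at z, where |k z| >= eta. Hence the radius on which k stays close to k z depends
    only on eta and a Lipschitz constant, not on z. *)
Lemma powmod_submean h (eta q r : RR) : analytic_disc h -> 0 < eta -> 1 / 2 <= q <= 1 -> 0 <= r < 1 ->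
  exists2 e : RR, 0 < e & forall z w, cabs z <= r -> cabs w <= e ->
    cabs z + cabs w < 1 /\ powmod h eta q z <= mean (fun t => powmod h eta q (z + w * ecirc t)).
Proof.
move=> ah eta0 q2 /andP[r0 r1].
have q01 : 0 < q <= 1 by lra.
have eta0' := ltW eta0.
have r'1 : 0 <= (1 + r) / 2 < 1 by lra.
have [L [L0 HL]] := analytic_lipschitz ah r'1.
have L1 : 0 < L + 1 by lra.
exists (Num.min ((1 - r) / 4) (eta / (L + 1) / 2)).
  by rewrite lt_min !divr_gt0//; lra.
move=> z w zr; rewrite le_min => /andP[w1 w2].
have zw : cabs z + cabs w < 1 by lra.
split => //.
pose c : CC := if h z == 0 then 1 else (cabs (h z))^-1%:C * h z.
have hc : h z = (cabs (h z))%:C * c.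
  rewrite /c; case: eqP => [->|/eqP hz]; first by rewrite cabs0 mul0r.
  by rewrite mulrA -rmorphM /= divff ?mul1r// cabs_eq0.
have c1 : cabs c = 1.
  rewrite /c; case: eqP => [_|/eqP hz]; first exact: cabs1.
  by rewrite cabsM cabsR_ge0 ?invr_ge0 ?cabs_ge0// mulVf// cabs_eq0.
pose k x := h x + eta%:C * c.
have kz : cabs (k z) = cabs (h z) + eta.
  rewrite /k hc -mulrDl -rmorphD /= cabsM c1 mulr1 cabsR_ge0; last by rewrite addr_ge0 ?cabs_ge0.
  by rewrite cabsM c1 mulr1 cabsR_ge0 ?cabs_ge0.
have kx x : cabs (k x) <= cabs (h x) + eta.
  by apply: le_trans (cabsD _ _) _; rewrite cabsM c1 mulr1 cabsR_ge0.
have xr x : cabs (x - z) <= cabs w -> cabs x <= (1 + r) / 2.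
  by move=> xw; have := cabs_leB x z; lra.
rewrite /powmod -kz.
have dk x : cabs (x - z) <= cabs w -> exists d, has_cderiv k x d.
  move=> /xr xr'; eexists; apply: has_cderivD (has_cderiv_cst _ _).
  by apply: analyticP => //; lra.
have wL : L * cabs w < eta.
  move: w2; rewrite -mulrA -invfM ler_pdivlMr; last lra.
  by have := cabs_ge0 w; nra.
apply: le_trans (submean_nonvanishing q2 dk _) _.
  move=> x xw; rewrite /k opprD addrACA subrr addr0 -/(k z) kz.
  apply: le_lt_trans (HL _ _ (xr _ xw) _) _; first by lra.
  apply: le_lt_trans (_ : L * cabs w < _); first by rewrite ler_wpM2l.
  by have := cabs_ge0 (h z); lra.
have inD t : cabs (z + w * ecirc t) < 1 by apply: le_lt_trans (cabs_circle_le _ _ _) zw.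
apply: le_mean.
- move=> t; have : ccont (fun t => k (z + w * ecirc t)) t.
    have [|d hd] := dk (z + w * ecirc t).
      by rewrite [z + _]addrC addrK cabs_mulcirc.
    by apply: (ccont_comp hd); exact: ccont_circle.
  move=> /cont_powR_cabs /(_ q01 (lexx 0)); apply: cont_ext => s; by rewrite addr0.
- by move=> t; apply: powmod_cont => //; exact: ccont_circle.
- move=> t; apply: ge0_ler_powR; rewrite ?nnegrE ?addr_ge0 ?cabs_ge0//; lra.
Qed.

Definition circ_avg (v : CC -> RR) (r : RR) : RR := mean (fun t => v (r%:C * ecirc t)).

Lemma circ_avgE (v : CC -> RR) (z : CC) : continuous (fun t => v ((cabs z)%:C * ecirc t)) ->
  mean (fun t => v (z * ecirc t)) = circ_avg v (cabs z).
Proof.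
move=> cv; have [s s01 zE] := polarE z.
rewrite /circ_avg -[RHS](mean_shift cv _ s01) => [|t]; last by rewrite ecirc_periodic.
by congr mean; apply/funext => t; rewrite ecircD {1}zE -mulrA [ecirc s * _]mulrC.
Qed.

Lemma mean_Re_ecirc : mean (fun t => cRe (ecirc t)) = 0.
Proof.
have := @circle_mean id 0 1; rewrite (_ : (fun t => id (0 + 1 * ecirc t)) = ecirc); last first.
  by apply/funext => t /=; rewrite add0r mul1r.
move=> H; have E : cmean ecirc = 0 by apply: H => z _; exists 1; exact: has_cderiv_id.
exact: (congr1 cRe E).
Qed.

Lemma sqr_cabs_real_circle (c e : RR) (z : CC) : cabs z = 1 ->
  cabs (c%:C + e%:C * z) ^+ 2 = 2 * c * e * cRe z + (c ^+ 2 + e ^+ 2).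
Proof.
move=> z1; have := sqr_cabs z; rewrite z1 expr1n => E1.
rewrite sqr_cabs; case: z z1 E1 => a b _ /= E1.
transitivity (2 * c * e * a + (c ^+ 2 + e ^+ 2 * (a ^+ 2 + b ^+ 2))); first by ring.
by rewrite -E1 mulr1.
Qed.

Lemma cont_on_max (R : realType) (a b : R) (u : R -> R) : a <= b -> cont_on a b u ->
  exists2 c, a <= c <= b & forall t, a <= t <= b -> u t <= u c.
Proof.
move=> ab cu; have [|c cab H] := @EVT_max R u a b ab.
  apply: continuous_in_subspaceT => t; rewrite inE /= in_itv /= => tab.
  exact: cu.
by exists c; [move: cab; rewrite in_itv|move=> t tab; apply: H; rewrite in_itv].
Qed.

(* Strict maximum principle after adding tau |z|^2, whose circle means exceed its value at the centre by tau e^2. *)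
Lemma radial_max_principle (V : RR -> RR) (r : RR) : 0 <= r ->
  cont_on 0 r V ->
  (forall s, 0 <= s < r -> exists e : RR, [/\ 0 < e, s + e <= r,
     continuous (fun t => V (cabs (s%:C + e%:C * ecirc t))) &
     V s <= mean (fun t => V (cabs (s%:C + e%:C * ecirc t)))]) ->
  forall s, 0 <= s <= r -> V s <= V r.
Proof.
move=> r0 cV subm s s0r.
apply/ler_addgt0Pr => tau0 tau00.
pose tau := tau0 / (r ^+ 2 + 1).
have r21 : 0 < r ^+ 2 + 1 by have := sqr_ge0 r; lra.
have tau_gt0 : 0 < tau by rewrite divr_gt0.
have tau_r : tau * r ^+ 2 <= tau0.
  by rewrite /tau mulrAC ler_pdivrMr// ler_pM2l//; lra.
pose Vt x := V x + tau * x ^+ 2.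
have cVt : cont_on 0 r Vt.
  apply: contD => // x _; apply: (@continuous_Ml RR) => y; exact: exprn_continuous.
have [c c0r cmax] := cont_on_max r0 cVt.
have [cr|cr] := ltP c r; last first.
  have cE : c = r by apply/eqP; rewrite eq_le cr andbT; case/andP: c0r.
  have := cmax s s0r; rewrite cE /Vt.
  have := mulr_ge0 (ltW tau_gt0) (sqr_ge0 s); lra.
exfalso.
have [e [e0 cer cont Vc]] := subm c (ltac:(lra)).
have sq t : cabs (c%:C + e%:C * ecirc t) ^+ 2 = 2 * c * e * cRe (ecirc t) + (c ^+ 2 + e ^+ 2).
  by rewrite sqr_cabs_real_circle// cabs_ecirc.
have cRe_e : continuous (fun t => cRe (ecirc t)) by move=> t; apply: ccont_Re; exact: ccont_ecirc.
have msq : mean (fun t => cabs (c%:C + e%:C * ecirc t) ^+ 2) = c ^+ 2 + e ^+ 2.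
  rewrite (funext sq) meanDcst; last exact: (@continuous_Ml RR).
  by rewrite meanZ// mean_Re_ecirc mulr0 add0r.
have csq : continuous (fun t => cabs (c%:C + e%:C * ecirc t) ^+ 2).
  rewrite (funext sq); apply: (@continuousDcst RR); exact: (@continuous_Ml RR).
have : mean (fun t => V (cabs (c%:C + e%:C * ecirc t)) + tau * cabs (c%:C + e%:C * ecirc t) ^+ 2) <= Vt c.
  apply: mean_le.
    by apply: (@continuous_D RR) => //; exact: (@continuous_Ml RR _ _ csq).
  move=> t; apply: cmax; rewrite cabs_ge0 /=.
  apply: le_trans (cabs_circle_le _ _ _) _; rewrite !cabsR_ge0//; lra.
rewrite meanD//; last exact: (@continuous_Ml RR).
rewrite meanZ// msq /Vt.
have : 0 < tau * e ^+ 2 by rewrite mulr_gt0// exprn_gt0.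
lra.
Qed.

Lemma powmod_avg_shift h (eta q r : RR) : analytic_disc h -> 0 <= eta -> 0 < q <= 1 -> 0 <= r < 1 ->
  exists K : RR, 0 <= K /\ forall a b, cabs a <= r -> cabs b <= r ->
    `|mean (fun t => powmod h eta q (a * ecirc t)) - mean (fun t => powmod h eta q (b * ecirc t))|
    <= (K * cabs (a - b)) `^ q.
Proof.
move=> ah eta0 q01 /andP[r0 r1].
have [L [L0 HL]] := powmod_dist ah eta0 q01 (ltac:(lra) : 0 <= r < 1).
exists L; split => // a b ar br.
have cont c : cabs c <= r -> continuous (fun t => powmod h eta q (c * ecirc t)).
  move=> cr t; apply: powmod_cont => //.
    by rewrite cabs_mulcirc; lra.
  by apply: ccontM; [exact: ccont_cst|exact: ccont_ecirc].
apply: mean_dist; [exact: cont|exact: cont|] => t.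
apply: le_trans (HL _ _ _ _) _; rewrite ?cabs_mulcirc//.
by rewrite -mulrBl cabs_mulcirc.
Qed.

(** As a function of z, the average over the circle through z about 0 is radial and inherits the
    sub-mean property from u by an exchange of means; [radial_max_principle] then gives
    monotonicity. *)
Lemma powmod_avg_mono h (eta q s r : RR) : analytic_disc h -> 0 < eta -> 1 / 2 <= q <= 1 ->
  0 <= s <= r -> r < 1 -> circ_avg (powmod h eta q) s <= circ_avg (powmod h eta q) r.
Proof.
move=> ah eta0 q2 sr r1.
have q01 : 0 < q <= 1 by lra.
have r0 : 0 <= r by lra.
have eta0' := ltW eta0.
pose r' := (1 + r) / 2.
have r'1 : 0 <= r' < 1 by rewrite /r'; lra.
have rr' : r < r' by rewrite /r'; lra.
have [L [L0 HL]] := powmod_dist ah eta0' q01 r'1.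
have [K [K0 HK]] := powmod_avg_shift ah eta0' q01 r'1.
have [ep ep0 Hep] := powmod_submean ah eta0 q2 r'1.
set u := powmod h eta q in HL HK Hep *.
have cu (g : RR -> CC) t : cabs (g t) < 1 -> ccont g t -> {for t, continuous (fun s => u (g s))}.
  by move=> g1 cg; exact: powmod_cont.
have cue c : cabs c < 1 -> continuous (fun t => u (c * ecirc t)).
  move=> c1 t; apply: cu; first by rewrite cabs_mulcirc.
  by apply: ccontM; [exact: ccont_cst|exact: ccont_ecirc].
have avgE z : cabs z < 1 -> mean (fun t => u (z * ecirc t)) = circ_avg u (cabs z).
  by move=> z1; apply: circ_avgE; apply: cue; rewrite cabsR_ge0 ?cabs_ge0.
apply: (@radial_max_principle (circ_avg u) r) => // {s sr} s.
  move=> /andP[s0 sr]; apply: (@continuous_eps RR) => e e0.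
  have [d d0 H] := powR_small (proj1 (andP q01)) e0.
  have K1 : 0 < K + 1 by clear -K0; lra.
  exists (Num.min (r' - r) (Num.min (s + r') (d / (K + 1)))).
    by rewrite !lt_min divr_gt0// ?andbT; clear -rr' s0 r0; lra.
  move=> x; rewrite !lt_min => /and3P[x1 x2 x3].
  have x0 := normr_ge0 x.
  have xs : cabs (s + x)%:C <= r'.
    rewrite cabsR; apply: le_trans (ler_normD _ _) _; rewrite (ger0_norm s0); clear -x1 sr; lra.
  apply: le_lt_trans (HK _ _ xs _) _; first by rewrite cabsR_ge0//; clear -s0 sr rr'; lra.
  rewrite -rmorphB /= cabsR [s + x]addrC addrK; apply: H; first by rewrite mulr_ge0.
  by move: x3; rewrite ltr_pdivlMr//; clear -x0; lra.
move=> /andP[s0 sr].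
pose e := Num.min ep (r - s).
have e0 : 0 < e by rewrite lt_min ep0 subr_gt0.
have e1 : e <= ep by rewrite ge_min lexx.
have e2 : s + e <= r.
  have : e <= r - s by rewrite ge_min lexx orbT.
  by clear; lra.
clearbody e.
have inr t : cabs (s%:C + e%:C * ecirc t) <= r.
  by apply: le_trans (cabs_circle_le _ _ _) _; rewrite !cabsR_ge0// ltW.
have in1 t : cabs (s%:C + e%:C * ecirc t) < 1 by apply: le_lt_trans (inr t) r1.
have inr' t : cabs (s%:C + e%:C * ecirc t) <= r' by apply: le_trans (inr t) (ltW rr').
have p0 : 0 <= 2 * pi :> RR by rewrite mulr_ge0// pi_ge0.
have q0 : 0 < q by clear -q2; lra.
have sCr : cabs s%:C <= r' by rewrite cabsR_ge0//; clear -s0 sr rr'; lra.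
have sC1 : cabs s%:C < 1 by apply: le_lt_trans sCr _; clear -r'1; lra.
have eC : cabs e%:C <= ep by rewrite cabsR_ge0// ltW.
(* Averaging over phi gives the radial average at |s + e e^(i theta)|; averaging over theta gives
   the mean of u over the circle of radius e about s e^(i phi), which dominates u there. *)
pose F (phi theta : RR) := u ((s%:C + e%:C * ecirc theta) * ecirc phi).
have Fp theta : continuous (F^~ theta) by apply: cue.
have Ft phi : continuous (F phi).
  move=> t; apply: cu; first by rewrite cabs_mulcirc.
  by apply: ccontM; [exact: ccont_circle|exact: ccont_cst].
have EF : (fun t => circ_avg u (cabs (s%:C + e%:C * ecirc t))) = (fun t => mean (F^~ t)).
  by apply/funext => t; rewrite -avgE.
have cavg : continuous (fun t => mean (F^~ t)).
  apply: (@continuous_mean_param (fun t phi => F phi t) (L * (e * (2 * pi))) q q0 _ Fp).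
    exact: mulr_ge0 L0 (mulr_ge0 (ltW e0) p0).
  move=> x x' y; apply: le_trans (HL _ _ _ _) _; [by rewrite cabs_mulcirc inr'|by rewrite cabs_mulcirc inr'|].
  apply: powR_le; [exact: q0|exact: mulr_ge0 L0 (cabs_ge0 _)|].
  rewrite -mulrBl cabs_mulcirc -!mulrA; apply: ler_wpM2l; first exact: L0.
  have -> : s%:C + e%:C * ecirc x - (s%:C + e%:C * ecirc x') = e%:C * (ecirc x - ecirc x') by ring.
  rewrite cabsM cabsR_ge0; last exact: ltW.
  by apply: ler_wpM2l; [exact: ltW|rewrite mulrA; exact: ecirc_lip].
have cFm : continuous (fun phi => mean (F phi)).
  apply: (@continuous_mean_param F (L * (r * (2 * pi))) q q0 _ Ft).
    exact: mulr_ge0 L0 (mulr_ge0 r0 p0).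
  move=> x x' y; apply: le_trans (HL _ _ _ _) _; [by rewrite cabs_mulcirc inr'|by rewrite cabs_mulcirc inr'|].
  apply: powR_le; [exact: q0|exact: mulr_ge0 L0 (cabs_ge0 _)|].
  rewrite -mulrBr cabsM -!mulrA; apply: ler_wpM2l; first exact: L0.
  by apply: ler_pM; [exact: cabs_ge0|exact: cabs_ge0|exact: inr|rewrite mulrA; exact: ecirc_lip].
exists e; split; [exact: e0|exact: e2|by rewrite EF; exact: cavg|].
rewrite EF.
rewrite -(@mean_swap_ge0 RR F (fun _ _ => powR_ge0 _ _) Fp Ft cFm cavg).
apply: le_mean; [exact: cue sC1|exact: cFm|] => phi.
have [||_ H] := Hep (s%:C * ecirc phi) (e%:C * ecirc phi).
- by rewrite cabs_mulcirc.
- by rewrite cabs_mulcirc.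
apply: le_trans H _; rewrite le_eqVlt; apply/orP; left; apply/eqP; congr mean; apply/funext => t.
by rewrite /F; congr u; ring.
Qed.

Definition pmean (h : CC -> CC) (q r : RR) : RR := circ_avg (fun z => cabs (h z) `^ q) r.

Lemma cont_cabs_powR (F : RR -> CC) (t q : RR) : ccont F t -> 0 < q <= 1 ->
  {for t, continuous (fun s => cabs (F s) `^ q)}.
Proof.
move=> cF q01; have := cont_powR_cabs cF q01 (lexx 0).
by apply: cont_ext => s; rewrite addr0.
Qed.

Lemma cont_pmean_circle h (q : RR) c w : analytic_disc h -> 0 < q <= 1 -> cabs c + cabs w < 1 ->
  continuous (fun t => cabs (h (c + w * ecirc t)) `^ q).
Proof.
move=> ah q01 cw t; apply: cont_cabs_powR => //.
have := analyticP ah (le_lt_trans (cabs_circle_le c w t) cw) => H.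
apply: (ccont_comp H); exact: ccont_circle.
Qed.

Lemma cont_pmean h (q : RR) w : analytic_disc h -> 0 < q <= 1 -> cabs w < 1 ->
  continuous (fun t => cabs (h (w * ecirc t)) `^ q).
Proof.
move=> ah q01 w1; have := @cont_pmean_circle h q 0 w ah q01; rewrite cabs0 add0r => /(_ w1).
by rewrite (_ : (fun t => cabs (h (0 + w * ecirc t)) `^ q) = (fun t => cabs (h (w * ecirc t)) `^ q));
  last by apply/funext => t; rewrite add0r.
Qed.

(* [eta > 0] in [powmod] keeps the modulus away from 0; it is sent to 0 here. *)
Lemma pmean_mono h (q s r : RR) : analytic_disc h -> 1 / 2 <= q <= 1 -> 0 <= s <= r -> r < 1 ->
  pmean h q s <= pmean h q r.
Proof.
move=> ah q2 sr r1; apply/ler_addgt0Pr => e e0.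
have q01 : 0 < q <= 1 by lra.
have [d d0 H] := powR_small (proj1 (andP q01)) e0.
pose eta := d / 2.
have eta0 : 0 < eta by rewrite divr_gt0.
have etae : eta `^ q < e by apply: H; rewrite ?ltW// /eta; lra.
have cw (x : RR) : 0 <= x <= r -> cabs x%:C < 1 by move=> xr; rewrite cabsR_ge0; lra.
have cpow x : 0 <= x <= r -> continuous (fun t => powmod h eta q (x%:C * ecirc t)).
  move=> xr t; apply: powmod_cont => //; [exact: ltW| |].
    by rewrite cabs_mulcirc; exact: cw.
  by apply: ccontM; [exact: ccont_cst|exact: ccont_ecirc].
have cp x : 0 <= x <= r -> continuous (fun t => cabs (h (x%:C * ecirc t)) `^ q).
  by move=> xr; apply: cont_pmean => //; exact: cw.
have rr : 0 <= r <= r by lra.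
apply: (@le_trans _ _ (circ_avg (powmod h eta q) s)).
  apply: le_mean; [exact: cp|exact: cpow|] => t.
  apply: ge0_ler_powR; rewrite ?nnegrE ?addr_ge0 ?cabs_ge0 ?(ltW eta0)//; first by lra.
  by rewrite lerDl ltW.
apply: le_trans (powmod_avg_mono ah eta0 q2 sr r1) _.
rewrite -meanDcst; last exact: cp.
apply: le_mean; [exact: cpow|by apply: continuousDcst; exact: cp|] => t.
apply: le_trans (powRD_le _ _ q01) _; rewrite ?cabs_ge0 ?(ltW eta0)//.
by rewrite lerD2l ltW.
Qed.

Local Open Scope ereal_scope.

(** * Polar coordinates *)

(** By uniqueness of Lebesgue measure: a times its image under x -> a x + b agrees with it on
    half-open intervals. *)
Lemma lebesgue_integral_affine (R : realType) (a b : R) (f : R -> \bar R) : (0 < a)%R ->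
  measurable_fun setT f -> (forall x, 0 <= f x) ->
  \int[lebesgue_measure]_x f (a * x + b)%R = (a^-1)%:E * \int[lebesgue_measure]_x f x.
Proof.
move=> a0 mf f0; pose mu := @lebesgue_measure R.
pose phi (x : measurableTypeR R) : measurableTypeR R := (a * x + b)%R.
have mphi : measurable_fun setT phi.
  by apply: measurable_funD => //; exact: measurable_funM.
have a0' : (0 <= a)%R := ltW a0.
pose pf : {measure set (measurableTypeR R) -> \bar R} :=
  measure_function_pushforward__canonical__measure_function_Measure mu mphi.
have muE (X : set (measurableTypeR R)) : measurable X -> mu X = mscale (NngNum a0') pf X.
  apply: lebesgue_measure_unique => _ [[c d] _ <-] /=.
  rewrite /mscale /= /pushforward.
  have -> : phi @^-1` `]c, d] = `]((c - b) / a)%R, ((d - b) / a)%R]%classic.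
    apply/seteqP; split => x /=; rewrite !in_itv /= /phi ltr_pdivrMr// ler_pdivlMr// mulrC ltrBlDr lerBrDr //.
  rewrite !lebesgue_measure_itv /= !lte_fin ltr_pM2r ?invr_gt0// ltrD2r.
  case: ifP => _; last by rewrite mule0.
  by rewrite !EFinN -!EFinB -EFinM; congr EFin; field; rewrite gt_eqF.
rewrite [X in _ = _ * X](eq_measure_integral (mscale (NngNum a0') pf)); last first.
  by move=> A mA _; exact: muE.
rewrite ge0_integral_mscale//= ge0_integral_pushforward//=.
rewrite muleA -EFinM mulVf ?gt_eqF// mul1e.
by rewrite preimage_setT.
Qed.

Definition plane_measure (R : realType) := (@lebesgue_measure R \x @lebesgue_measure R).

(** The translation may depend on the other coordinate, which covers scalings and shears in one
    statement. *)
Lemma plane_integral_affine_fst (R : realType) (a : R) (b : R -> R) (f : R * R -> \bar R) : (0 < a)%R ->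
  measurable_fun setT b -> measurable_fun setT f -> (forall z, 0 <= f z) ->
  \int[@plane_measure R]_z f ((a * z.1 + b z.2)%R, z.2) = (a^-1)%:E * \int[@plane_measure R]_z f z.
Proof.
move=> a0 mb mf f0; rewrite /plane_measure.
have mg : measurable_fun setT (fun z : R * R => f ((a * z.1 + b z.2)%R, z.2)).
  apply: (measurableT_comp mf); apply: measurable_fun_pair => //=.
  by apply: measurable_funD; [apply: measurable_funM|exact: measurableT_comp].
rewrite !fubini_tonelli1// !fubini_tonelli//=.
have a0' : (0 <= a^-1)%R by rewrite invr_ge0 ltW.
rewrite -ge0_integralZl_EFin//=; last 2 first.
- by move=> y _; exact: integral_ge0.
- exact: measurable_fun_fubini_tonelli_G.
apply: eq_integral => y _.
have mfy : measurable_fun setT (fun x : R => f (x, y)).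
  by apply: (measurableT_comp mf); exact: pair2_measurable.
exact: (lebesgue_integral_affine (b y) a0 mfy (fun x => f0 (x, y))).
Qed.

Lemma plane_integral_affine_snd (R : realType) (a : R) (b : R -> R) (f : R * R -> \bar R) : (0 < a)%R ->
  measurable_fun setT b -> measurable_fun setT f -> (forall z, 0 <= f z) ->
  \int[@plane_measure R]_z f (z.1, (a * z.2 + b z.1)%R) = (a^-1)%:E * \int[@plane_measure R]_z f z.
Proof.
move=> a0 mb mf f0; rewrite /plane_measure.
have mg : measurable_fun setT (fun z : R * R => f (z.1, (a * z.2 + b z.1)%R)).
  apply: (measurableT_comp mf); apply: measurable_fun_pair => //=.
  by apply: measurable_funD; [apply: measurable_funM|exact: measurableT_comp].
rewrite !fubini_tonelli1//=.
have a0' : (0 <= a^-1)%R by rewrite invr_ge0 ltW.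
rewrite -ge0_integralZl_EFin//=; last 2 first.
- by move=> y _; exact: integral_ge0.
- exact: measurable_fun_fubini_tonelli_F.
apply: eq_integral => x _.
have mfx : measurable_fun setT (fun y : R => f (x, y)).
  by apply: (measurableT_comp mf); exact: pair1_measurable.
exact: (lebesgue_integral_affine (b x) a0 mfx (fun y => f0 (x, y))).
Qed.

Lemma measurable_plane_map (R : realType) (a b c a' b' c' : R) :
  measurable_fun setT (fun z : R * R => ((a * z.1 + b * z.2 + c)%R, (a' * z.1 + b' * z.2 + c')%R)).
Proof.
have m (u v w : R) : measurable_fun setT (fun z : R * R => (u * z.1 + v * z.2 + w)%R).
  by apply: measurable_funD => //; apply: measurable_funD; exact: measurable_funM.
by apply: measurable_fun_pair.
Qed.

Lemma plane_integral_scale (R : realType) (a c c' : R) (f : R * R -> \bar R) : (0 < a)%R ->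
  measurable_fun setT f -> (forall z, 0 <= f z) ->
  \int[@plane_measure R]_z f ((a * z.1 + c)%R, (a * z.2 + c')%R) = (a ^- 2)%:E * \int[@plane_measure R]_z f z.
Proof.
move=> a0 mf f0.
have mc (k : R) : measurable_fun setT (fun _ : R => k) by exact: measurable_cst.
pose g (z : R * R) := f (z.1, (a * z.2 + c')%R).
have mg : measurable_fun setT g.
  apply: (measurableT_comp mf); apply: measurable_fun_pair => //=.
  by apply: measurable_funD => //; apply: measurable_funM.
rewrite (plane_integral_affine_fst a0 (mc c) mg (fun z => f0 _)).
rewrite (plane_integral_affine_snd a0 (mc c') mf f0) muleA -EFinM.
by rewrite -expr2 exprVn.
Qed.

Lemma plane_integral_shear_fst (R : realType) (k : R) (f : R * R -> \bar R) :
  measurable_fun setT f -> (forall z, 0 <= f z) ->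
  \int[@plane_measure R]_z f ((z.1 + k * z.2)%R, z.2) = \int[@plane_measure R]_z f z.
Proof.
move=> mf f0; have mb : measurable_fun setT (fun y : R => (k * y)%R) by exact: measurable_funM.
have := plane_integral_affine_fst (ltr01 : (0 < 1 :> R)%R) mb mf f0.
by rewrite invr1 mul1e => <-; apply: eq_integral => z _; rewrite mul1r.
Qed.

Lemma plane_integral_shear_snd (R : realType) (k : R) (f : R * R -> \bar R) :
  measurable_fun setT f -> (forall z, 0 <= f z) ->
  \int[@plane_measure R]_z f (z.1, (z.2 + k * z.1)%R) = \int[@plane_measure R]_z f z.
Proof.
move=> mf f0; have mb : measurable_fun setT (fun y : R => (k * y)%R) by exact: measurable_funM.
have := plane_integral_affine_snd (ltr01 : (0 < 1 :> R)%R) mb mf f0.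
by rewrite invr1 mul1e => <-; apply: eq_integral => z _; rewrite mul1r.
Qed.

(* A rotation other than -Id is a product of three shears. *)
Lemma plane_integral_rotation (R : realType) (c s : R) (f : R * R -> \bar R) : (c ^+ 2 + s ^+ 2 = 1)%R ->
  measurable_fun setT f -> (forall z, 0 <= f z) ->
  \int[@plane_measure R]_z f ((c * z.1 - s * z.2)%R, (s * z.1 + c * z.2)%R) = \int[@plane_measure R]_z f z.
Proof.
have main (c' s' : R) (g : R * R -> \bar R) : (c' != - 1)%R -> (c' ^+ 2 + s' ^+ 2 = 1)%R ->
    measurable_fun setT g -> (forall z, 0 <= g z) ->
    \int[@plane_measure R]_z g ((c' * z.1 - s' * z.2)%R, (s' * z.1 + c' * z.2)%R) = \int[@plane_measure R]_z g z.
  move=> c1 cs mg g0.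
  have c0 : (1 + c' != 0)%R by rewrite addrC addr_eq0.
  (* k is minus the tangent of half the angle; the shears by k, s' and k compose to the rotation,
     and 1 + c' = 0 is exactly the excluded case -Id. *)
  pose k := (- s' / (1 + c'))%R.
  have ks : (k * s' = c' - 1)%R.
    rewrite /k mulrAC; apply: (mulIf c0); rewrite divfK//; lra.
  have s1 : measurable_fun setT (fun z : R * R => ((z.1 + k * z.2)%R, z.2)).
    have := measurable_plane_map 1%R k 0%R 0%R 1%R 0%R.
    by apply: eq_measurable_fun => z _; rewrite !mul1r !mul0r !addr0 add0r.
  have s2 : measurable_fun setT (fun z : R * R => (z.1, (z.2 + s' * z.1)%R)).
    have := measurable_plane_map 1%R 0%R 0%R s' 1%R 0%R.
    by apply: eq_measurable_fun => z _; rewrite !mul1r !mul0r !addr0 addrC.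
  rewrite -(plane_integral_shear_fst k mg g0).
  rewrite -(plane_integral_shear_snd s' (measurableT_comp mg s1) (fun z => g0 _)).
  rewrite -(plane_integral_shear_fst k (measurableT_comp (measurableT_comp mg s1) s2) (fun z => g0 _)).
  apply: eq_integral => -[x y] _ /=; congr (g (_, _)).
    have -> : (x + k * y + k * (y + s' * (x + k * y)) = x + (k * s') * x + (2 * k + k * (k * s')) * y)%R by ring.
    have -> : (2 * k + k * (k * s') = - s')%R.
      by transitivity (k * (1 + c'))%R; [rewrite ks; ring|rewrite /k divfK].
    by rewrite ks; ring.
  have -> : (y + s' * (x + k * y) = s' * x + (1 + k * s') * y)%R by ring.
  by rewrite ks; ring.
move=> cs mf f0.
have [c1|c1] := eqVneq c (-1)%R; last exact: main.
have s0 : s = 0%R.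
  by apply/eqP; rewrite -sqrf_eq0; apply/eqP; move: cs; rewrite c1; lra.
have n1 : (0 != -1 :> R)%R by rewrite eq_sym oppr_eq0 oner_eq0.
have c01 : (0 ^+ 2 + 1 ^+ 2 = 1 :> R)%R by rewrite expr0n add0r expr1n.
have mr : measurable_fun setT (fun z : R * R => ((0 * z.1 - 1 * z.2)%R, (1 * z.1 + 0 * z.2)%R)).
  have := measurable_plane_map 0%R (-1)%R 0%R 1%R 0%R (0 : R)%R.
  by apply: eq_measurable_fun => z _; rewrite !addr0 mulN1r !mul1r.
(* -Id is the square of the rotation by a right angle, to which [main] applies. *)
rewrite -(main 0%R 1%R f n1 c01 mf f0).
rewrite -(main 0%R 1%R _ n1 c01 (measurableT_comp mf mr) (fun z => f0 _)).
apply: eq_integral => -[x y] _ /=; rewrite c1 s0; congr (f (_, _)); ring.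
Qed.

(* Replaces the change of variables to polar coordinates: the images of the plane measure under two
   homogeneous gauges agree up to a factor, and for the gauge of a triangle the image is explicit. *)
Lemma quadratic_measure_unique (R : realType) (m1 m2 : {measure set (measurableTypeR R) -> \bar R}) (c1 c2 : {nonneg R}) :
  (forall x : R, (0 < x <= 1)%R -> m1 [set` `[0%R, x[%R] = (x ^+ 2 * c1%:num)%:E) ->
  (forall x : R, (0 < x <= 1)%R -> m2 [set` `[0%R, x[%R] = (x ^+ 2 * c2%:num)%:E) ->
  forall A : set (measurableTypeR R), measurable A -> A `<=` [set` `[0%R, 1%R[%R] -> c2%:num%:E * m1 A = c1%:num%:E * m2 A.
Proof.
move=> H1 H2 A mA A01.
have mI : measurable ([set` `[0%R, 1%R[%R] : set (measurableTypeR R)) by exact: measurable_itv.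
pose M1 : {measure set (measurableTypeR R) -> \bar R} := mscale c2 (mrestr m1 mI).
pose M2 : {measure set (measurableTypeR R) -> \bar R} := mscale c1 (mrestr m2 mI).
have rE (m : {measure set (measurableTypeR R) -> \bar R}) : mrestr m mI A = m A.
  by rewrite /mrestr; congr (m _); exact/setIidl.
rewrite -(rE m1) -(rE m2); change (M1 A = M2 A).
have capE (x : R) : [set` `]-oo, x[%R] `&` [set` `[0%R, 1%R[%R] =
    (if (0 < x)%R then [set` `[0%R, Num.min x 1%R[%R] else set0) :> set R.
  apply/seteqP; split => y /=; rewrite !in_itv /=.
    move=> [yx /andP[y0 y1]]; rewrite (le_lt_trans y0 yx) /= in_itv /= y0 lt_min yx y1 //.
  by case: ifP => // x0 /=; rewrite in_itv /= lt_min => /and3P[-> -> ->].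
have mval (m : {measure set (measurableTypeR R) -> \bar R}) (c : {nonneg R}) (x : R) :
    (forall x : R, (0 < x <= 1)%R -> m [set` `[0%R, x[%R] = (x ^+ 2 * c%:num)%:E) ->
    mrestr m mI [set` `]-oo, x[%R] = (if (0 < x)%R then (Num.min x 1 ^+ 2 * c%:num)%:E else 0).
  move=> H; rewrite /mrestr [X in m X]capE; case: ifP => x0; last by rewrite measure0.
  by apply: H; rewrite lt_min x0 ltr01 ge_min lexx orbT.
apply: (@measure_unique _ R (measurableTypeR R) (@RGenInftyO.G R) (fun n => [set` `]-oo, n%:R[%R]) _ _ _ _ M1 M2 _ _ A mA).
- exact: RGenInftyO.measurableE.
- move=> _ _ [x ->] [y ->]; exists (Num.min x y); apply/seteqP; split => z /=; rewrite !in_itv /= lt_min.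
    by move=> [-> ->].
  by move=> /andP[-> ->].
- by move=> n; eexists.
- apply/seteqP; split => // x _; exists (Num.truncn `|x|).+1 => //=; rewrite in_itv /=.
  apply: le_lt_trans (ler_norm x) _; exact: truncnS_gt.
- move=> _ [x ->]; change (c2%:num%:E * mrestr m1 mI [set` `]-oo, x[%R] = c1%:num%:E * mrestr m2 mI [set` `]-oo, x[%R]).
  rewrite (mval _ _ _ H1) (mval _ _ _ H2).
  by case: ifP => _; rewrite ?mule0// -!EFinM; congr EFin; ring.
- move=> n; change (c2%:num%:E * mrestr m1 mI [set` `]-oo, n%:R[%R] < +oo).
  by rewrite (mval _ _ _ H1); case: ifP => _; rewrite ?mule0// -?EFinM ltry.
Qed.

Definition homogeneous_gauge (R : realType) (rho : R * R -> R) : Prop :=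
  forall (a : R) z, (0 < a)%R -> rho ((a * z.1)%R, (a * z.2)%R) = (a * rho z)%R.

Lemma gauge_measure_scale (R : realType) (rho : R * R -> R) (x : R) : measurable_fun setT rho ->
  homogeneous_gauge rho -> (0 < x)%R ->
  @plane_measure R (rho @^-1` [set` `[0%R, x[%R]) =
  (x ^+ 2)%:E * @plane_measure R (rho @^-1` [set` `[0%R, 1%R[%R]).
Proof.
move=> mrho hom x0.
have mp (y : R) : measurable (rho @^-1` [set` `[0%R, y[%R]).
  by rewrite -[X in measurable X]setTI; apply: mrho => //; exact: measurable_itv.
have ie (y : R) : \int[@plane_measure R]_z (\1_(rho @^-1` [set` `[0%R, y[%R]) z)%:E =
    @plane_measure R (rho @^-1` [set` `[0%R, y[%R]).
  by rewrite integral_indic; [rewrite setIT|exact: measurableT|exact: mp].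
rewrite -!ie.
have xV : (0 < x^-1)%R by rewrite invr_gt0.
have mf : measurable_fun setT (EFin \o \1_(rho @^-1` [set` `[0%R, 1%R[%R]) : R * R -> \bar R).
  by apply/measurable_EFinP; apply: measurable_indic; exact: mp.
have f0 z : 0 <= (EFin \o \1_(rho @^-1` [set` `[0%R, 1%R[%R]) : R * R -> \bar R) z.
  by rewrite lee_fin.
have := plane_integral_scale 0%R 0%R xV mf f0.
rewrite exprVn invrK => <-; apply: eq_integral => z _ /=; congr EFin.
rewrite !indicE; congr (nat_of_bool _)%:R; rewrite !addr0.
apply/idP/idP; rewrite !inE /= !in_itv /= hom// mulrC ler_pdivlMr// ltr_pdivrMr// mul0r mul1r //.
Qed.

(** The integral of psi(rho) is taken against the image of the plane measure under rho, which by
    homogeneity gives [0, x) the mass c x^2. *)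
Lemma gauge_integral_proportional (R : realType) (rho1 rho2 : R * R -> R) (c1 c2 : {nonneg R}) (psi : R -> \bar R) :
  measurable_fun setT rho1 -> measurable_fun setT rho2 ->
  homogeneous_gauge rho1 -> homogeneous_gauge rho2 ->
  @plane_measure R (rho1 @^-1` [set` `[0%R, 1%R[%R]) = c1%:num%:E ->
  @plane_measure R (rho2 @^-1` [set` `[0%R, 1%R[%R]) = c2%:num%:E ->
  measurable_fun setT psi -> (forall x, 0 <= psi x) ->
  (forall x, psi x != 0 -> (0 <= x < 1)%R) ->
  c2%:num%:E * \int[@plane_measure R]_z psi (rho1 z) = c1%:num%:E * \int[@plane_measure R]_z psi (rho2 z).
Proof.
move=> m1 m2 h1 h2 e1 e2 mpsi psi0 psi1.
have mI : measurable ([set` `[0%R, 1%R[%R] : set (measurableTypeR R)) by exact: measurable_itv.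
have mR (rho : R * R -> R) : measurable_fun setT rho -> measurable_fun setT (rho : R * R -> measurableTypeR R) by [].
have pE (rho : R * R -> R) (mr : measurable_fun setT (rho : R * R -> measurableTypeR R)) :
   \int[@plane_measure R]_z psi (rho z) =
   \int[measure_function_pushforward__canonical__measure_function_Measure (@plane_measure R) mr]_(x in [set` `[0%R, 1%R[%R]) psi x.
  rewrite [RHS]integral_mkcond.
  have -> : (psi \_ [set` `[0%R, 1%R[%R] : measurableTypeR R -> \bar R) = psi.
    apply/funext => x; rewrite patchE; case: ifPn => // xI; apply/esym/eqP/negPn/negP => /psi1 x01.
    by move/negP: xI; apply; rewrite inE /= in_itv.
  by rewrite ge0_integral_pushforward//=.
have mpsiI : @measurable_fun _ _ (measurableTypeR R) _ [set` `[0%R, 1%R[%R] psi.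
  exact: (@measurable_funS _ _ (measurableTypeR R) _ setT _ psi measurableT (@subsetT _ _) mpsi).
have sE (m : {measure set (measurableTypeR R) -> \bar R}) (c : {nonneg R}) :
    c%:num%:E * \int[m]_(x in [set` `[0%R, 1%R[%R]) psi x = \int[mscale c m]_(x in [set` `[0%R, 1%R[%R]) psi x.
  exact/esym/(ge0_integral_mscale m mI c mpsiI (fun x _ => psi0 x)).
rewrite (pE _ (mR _ m1)) (pE _ (mR _ m2)) (sE _ c2) (sE _ c1).
apply: eq_measure_integral => A mA AI.
have hh (rho : R * R -> R) (c : {nonneg R}) (mr : measurable_fun setT rho) : homogeneous_gauge rho ->
    @plane_measure R (rho @^-1` [set` `[0%R, 1%R[%R]) = c%:num%:E -> forall x : R, (0 < x <= 1)%R ->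
   measure_function_pushforward__canonical__measure_function_Measure (@plane_measure R) (mR _ mr) [set` `[0%R, x[%R] =
   (x ^+ 2 * c%:num)%:E.
  by move=> hr er x /andP[x0 _]; rewrite EFinM -er -gauge_measure_scale.
exact: (quadratic_measure_unique (hh _ _ m1 h1 e1) (hh _ _ m2 h2 e2)).
Qed.

Definition rad (R : realType) (z : R * R) : R := Num.sqrt (z.1 ^+ 2 + z.2 ^+ 2).

Lemma measurable_rad (R : realType) : measurable_fun setT (@rad R).
Proof.
apply: (measurableT_comp (continuous_measurable_fun _)) => /=; first exact: sqrt_continuous.
by apply: measurable_funD; apply: measurable_funX; [exact: measurable_fst|exact: measurable_snd].
Qed.

Lemma homogeneous_rad (R : realType) : homogeneous_gauge (@rad R).
Proof.
move=> a z a0; rewrite /rad /= !exprMn -mulrDr sqrtrM ?sqr_ge0// sqrtr_sqr.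
by rewrite gtr0_norm.
Qed.

(* The level sets [0 <= tri_gauge z < x] are the triangles [0 <= z.2 <= z.1 < x]. *)
Definition tri_gauge (R : realType) (z : R * R) : R :=
  if (0 <= z.2 <= z.1)%R then z.1 else (- (`|z.1| + `|z.2|))%R.

Lemma measurable_tri_gauge (R : realType) : measurable_fun setT (@tri_gauge R).
Proof.
apply: measurable_fun_ifT => /=.
- apply: measurable_and; apply: measurable_fun_ler => //.
- exact: measurable_fst.
- by apply: measurableT_comp => //; apply: measurable_funD; apply: measurableT_comp.
Qed.

Lemma homogeneous_tri_gauge (R : realType) : homogeneous_gauge (@tri_gauge R).
Proof.
move=> a z a0; rewrite /tri_gauge /= ler_pM2l// pmulr_rge0//; case: ifP => // _.
by rewrite !normrM (gtr0_norm a0) -mulrDr mulrN.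
Qed.

Lemma tri_gauge_ge0 (R : realType) (z : R * R) : (0 <= tri_gauge z)%R = (0 <= z.2 <= z.1)%R.
Proof.
rewrite /tri_gauge; case: ifP => [/andP[h1 h2]|/negbT h]; first by rewrite (le_trans h1 h2).
apply/negbTE; rewrite -ltNge oppr_lt0 lt_neqAle addr_ge0// andbT eq_sym paddr_eq0// !normr_eq0.
by apply/negP => /andP[/eqP h1 /eqP h2]; move/negP: h; apply; rewrite h1 h2 lexx.
Qed.

Lemma plane_measure_box (R : realType) (a b c d : R) : (a <= b)%R -> (c <= d)%R ->
  @plane_measure R ([set` `[a, b]%R] `*` [set` `[c, d]%R]) = ((b - a) * (d - c))%:E.
Proof.
move=> ab cd; rewrite /plane_measure product_measure1E//=; try exact: measurable_itv.
by rewrite !leb_itvcc// -EFinM.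
Qed.

Lemma measurable_gauge_ball (R : realType) (rho : R * R -> R) : measurable_fun setT rho ->
  measurable (rho @^-1` [set` `[0%R, 1%R[%R]).
Proof.
by move=> mrho; rewrite -[X in measurable X]setTI; apply: mrho => //; exact: measurable_itv.
Qed.

Lemma measurable_box (R : realType) (a b c d : R) : 
  measurable ([set` `[a, b]%R] `*` [set` `[c, d]%R] : set (R * R)).
Proof. by apply: measurableX; exact: measurable_itv. Qed.

(** The box [1/2, 3/5] x [0, 1/2] lies both in the unit disc and in the triangle, and both lie in
    [-1, 1] x [-1, 1]; one statement thus gives a finite positive area for either gauge. *)
Lemma gauge_ball_measure (R : realType) (rho : R * R -> R) : measurable_fun setT rho ->
  (forall z, (0 <= rho z < 1)%R -> (`|z.1| <= 1)%R /\ (`|z.2| <= 1)%R) ->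
  (forall z, (1/2 <= z.1 <= 3/5)%R -> (0 <= z.2 <= 1/2)%R -> (0 <= rho z < 1)%R) ->
  exists2 c : {nonneg R}, (0 < c%:num)%R & @plane_measure R (rho @^-1` [set` `[0%R, 1%R[%R]) = c%:num%:E.
Proof.
move=> mrho h1 h2; set A := _ @^-1` _.
have mA : measurable A by exact: measurable_gauge_ball.
have up : @plane_measure R A <= 4%:E.
  have -> : (4 : R)%:E = @plane_measure R ([set` `[-1, 1]%R] `*` [set` `[-1, 1]%R]).
    by rewrite plane_measure_box; [congr EFin; ring|lra|lra].
  apply: le_measure; rewrite ?inE//; first exact: measurable_box.
  move=> z; rewrite /A /= !in_itv /= => /h1; rewrite !ler_norml => -[-> ->] //.
have lo : (1/20 : R)%:E <= @plane_measure R A.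
  have -> : (1/20 : R)%:E = @plane_measure R ([set` `[1/2, 3/5]%R] `*` [set` `[0, 1/2]%R]).
    by rewrite plane_measure_box; [congr EFin; field|lra|lra].
  apply: le_measure; rewrite ?inE//; first exact: measurable_box.
  by move=> z; rewrite /A /= !in_itv /= => -[k1 k2]; apply: h2.
have fA : @plane_measure R A \is a fin_num.
  by rewrite ge0_fin_numE ?measure_ge0//; apply: (le_lt_trans up); rewrite ltry.
have f0 : (0 <= fine (@plane_measure R A))%R by rewrite fine_ge0// measure_ge0.
exists (NngNum f0) => /=; last by rewrite fineK.
rewrite -lte_fin fineK//; apply: lt_le_trans lo; rewrite lte_fin; lra.
Qed.

Lemma rad_ge0 (R : realType) (z : R * R) : (0 <= rad z)%R.
Proof. exact: sqrtr_ge0. Qed.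

Lemma sqr_rad (R : realType) (z : R * R) : (rad z ^+ 2 = z.1 ^+ 2 + z.2 ^+ 2)%R.
Proof. by rewrite sqr_sqrtr// addr_ge0// sqr_ge0. Qed.

Lemma rad_lt (R : realType) (z : R * R) (x : R) : (0 <= x)%R -> (rad z < x)%R = (z.1 ^+ 2 + z.2 ^+ 2 < x ^+ 2)%R.
Proof. by move=> x0; rewrite -sqr_rad ltr_pXn2r// nnegrE// rad_ge0. Qed.

(** The vertical section of the triangle at abscissa x has length x, which plays the role of the
    Jacobian of polar coordinates. *)
Lemma plane_integral_fst_triangle (R : realType) (psi : R -> \bar R) :
  measurable_fun setT psi -> (forall x, 0 <= psi x) ->
  (forall x, psi x != 0 -> (0 <= x < 1)%R) ->
  \int[@plane_measure R]_z psi (tri_gauge z) = \int[@lebesgue_measure R]_x (psi x * x%:E).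
Proof.
move=> mpsi psi0 psi1; rewrite /plane_measure fubini_tonelli1//=; last first.
  exact: (measurableT_comp mpsi (@measurable_tri_gauge R)).
apply: eq_integral => x _; rewrite /fubini_F.
have [x0|x0] := ltP x 0%R.
  have -> : psi x = 0.
    by apply/eqP/negPn/negP => /psi1 /andP[]; rewrite leNgt x0.
  rewrite mul0e; apply: integral0_eq => y _; apply/eqP/negPn/negP => /psi1.
  by rewrite tri_gauge_ge0 /= => /andP[/andP[y0 yx] _]; move: (le_trans y0 yx); rewrite leNgt x0.
rewrite (_ : (fun y => psi (tri_gauge (x, y))) = (fun y => psi x * (\1_([set` `[0%R, x]%R]) y)%:E)).
  rewrite ge0_integralZl//=.
  - have ie : \int[@lebesgue_measure R]_y (\1_([set` `[0%R, x]%R]) y)%:E = x%:E.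
      rewrite integral_indic//.
      by rewrite setIT; apply: etrans (leb_itvcc x0) _; rewrite subr0.
    exact: (congr1 (fun u => psi x * u) ie).
  - by apply/measurable_EFinP; apply: measurable_indic; exact: measurable_itv.
apply/funext => y; rewrite indicE mem_setE in_itv /=.
rewrite /tri_gauge /=; case: ifPn => h; first by rewrite mule1.
rewrite mule0; apply/eqP/negPn/negP => /psi1; have := @tri_gauge_ge0 R (x, y).
by rewrite /tri_gauge /= (negbTE h) => -> //.
Qed.

(** kappa is the ratio of the areas of disc and triangle, that is 2 pi; only its positivity is
    carried along. *)
Lemma radial_plane_integral (R : realType) : exists2 kappa : R, (0 < kappa)%R &
  forall psi : R -> \bar R, measurable_fun setT psi -> (forall x, 0 <= psi x) ->
    (forall x, psi x != 0 -> (0 <= x < 1)%R) ->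
    \int[@plane_measure R]_z psi (rad z) = kappa%:E * \int[@lebesgue_measure R]_x (psi x * x%:E).
Proof.
have [c1 c1p e1] : exists2 c : {nonneg R}, (0 < c%:num)%R &
    @plane_measure R (@rad R @^-1` [set` `[0%R, 1%R[%R]) = c%:num%:E.
  apply: gauge_ball_measure; first exact: measurable_rad.
    move=> z; rewrite rad_ge0 rad_lt//= => h; rewrite !ler_norml; split; nra.
  move=> z h1 h2; rewrite rad_ge0 rad_lt//=; nra.
have [c2 c2p e2] : exists2 c : {nonneg R}, (0 < c%:num)%R &
    @plane_measure R (@tri_gauge R @^-1` [set` `[0%R, 1%R[%R]) = c%:num%:E.
  apply: gauge_ball_measure; first exact: measurable_tri_gauge.
    move=> z; rewrite tri_gauge_ge0 /tri_gauge; case: ifP => // /andP[a b] /= c.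
    by rewrite !ger0_norm//; lra.
  move=> z h1 h2; rewrite tri_gauge_ge0 /tri_gauge.
  by have -> : (0 <= z.2 <= z.1)%R; lra.
exists (c1%:num / c2%:num)%R; first by rewrite divr_gt0.
move=> psi mpsi psi0 psi1; rewrite -plane_integral_fst_triangle//.
have := gauge_integral_proportional (@measurable_rad R) (@measurable_tri_gauge R) (@homogeneous_rad R)
  (@homogeneous_tri_gauge R) e1 e2 mpsi psi0 psi1.
rewrite mulrC EFinM -muleA => <-; rewrite muleA -EFinM mulVf ?mul1e// gt_eqF//.
Qed.

Local Close Scope ereal_scope.

Lemma plane_measure_sigma_finite (R : realType) : sigma_finite setT (@plane_measure R).
Proof.
exists (fun n => [set` `[- n%:R, n%:R]%R] `*` [set` `[- n%:R, n%:R]%R]).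
  apply/esym; rewrite -subTset => -[x y] _; exists (Num.truncn (Num.max `|x| `|y|)).+1 => //=.
  have := truncnS_gt (Num.max `|x| `|y|); rewrite gt_max => /andP[hx hy].
  by rewrite !in_itv /= -!ler_norml !ltW.
move=> n; split; first exact: measurable_box.
by rewrite plane_measure_box ?ltry//; have := ler0n R n; lra.
Qed.

Lemma plane_integral_rotation_avg (R : realType) (c s : R -> R) (f : R * R -> \bar R) :
  measurable_fun setT c -> measurable_fun setT s -> (forall t, c t ^+ 2 + s t ^+ 2 = 1) ->
  measurable_fun setT f -> (forall z, 0 <= f z)%E ->
  (\int[@plane_measure R]_z f z = \int[@plane_measure R]_z
    \int[@lebesgue_measure R]_(t in [set` `[0%R, 1%R]%R]) f ((c t * z.1 - s t * z.2)%R, (s t * z.1 + c t * z.2)%R))%E.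
Proof.
move=> mc ms cs mf f0; pose I : set R := `[0, 1].
have mI : measurable I by exact: measurable_itv.
pose g (w : (R * R) * R) : \bar R :=
  (f ((c w.2 * w.1.1 - s w.2 * w.1.2)%R, (s w.2 * w.1.1 + c w.2 * w.1.2)%R) * (\1_I w.2)%:E)%E.
have g0 w : (0 <= g w)%E by rewrite mule_ge0// lee_fin.
have m11 : measurable_fun setT (fun w : (R * R) * R => w.1.1).
  by apply: (measurableT_comp measurable_fst); exact: measurable_fst.
have m12 : measurable_fun setT (fun w : (R * R) * R => w.1.2).
  by apply: (measurableT_comp measurable_snd); exact: measurable_fst.
have mc2 : measurable_fun setT (fun w : (R * R) * R => c w.2).
  by apply: (measurableT_comp mc); exact: measurable_snd.
have ms2 : measurable_fun setT (fun w : (R * R) * R => s w.2).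
  by apply: (measurableT_comp ms); exact: measurable_snd.
have mg : measurable_fun setT g.
  apply: emeasurable_funM.
    apply: (measurableT_comp mf); apply: measurable_fun_pair.
      by apply: measurable_funB; apply: measurable_funM.
    by apply: measurable_funD; apply: measurable_funM.
  apply/measurable_EFinP; apply: (measurableT_comp (measurable_indic mI)); exact: measurable_snd.
(* Tonelli between the plane and the rotation parameter asks for the plane measure as a sigma-finite
   measure. *)
pose P : {sigma_finite_measure set (measurableTypeR R * measurableTypeR R)%type -> \bar R} :=
  HB.pack (product_measure1 (@lebesgue_measure R) (@lebesgue_measure R))
    (Measure_isSigmaFinite.Build _ _ _ (product_measure1 (@lebesgue_measure R) (@lebesgue_measure R))
      (@plane_measure_sigma_finite R)).
have := @fubini_tonelli _ _ _ _ R P (@lebesgue_measure R) g mg g0.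
change (integral (P : set (measurableTypeR R * measurableTypeR R) -> \bar R)) with (integral (@plane_measure R)).
have -> : (\int[@plane_measure R]_z \int[@lebesgue_measure R]_t g (z, t) = \int[@plane_measure R]_z
    \int[@lebesgue_measure R]_(t in I) f ((c t * z.1 - s t * z.2)%R, (s t * z.1 + c t * z.2)%R))%E.
  apply: eq_integral => z _; rewrite [RHS]integral_mkcond; apply: eq_integral => t _.
  rewrite /g patchE indicE; case: ifP => _ /=; first by rewrite mule1.
  by rewrite mule0.
move=> ->.
have -> : (\int[@lebesgue_measure R]_t \int[@plane_measure R]_z g (z, t) =
   \int[@lebesgue_measure R]_(t in I) (\int[@plane_measure R]_z f z))%E.
  rewrite [RHS]integral_mkcond; apply: eq_integral => t _; rewrite patchE /g /=.
  case: ifPn => tI; rewrite indicE ?tI ?(negbTE tI).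
    under eq_integral => z _ do rewrite mule1.
    exact: plane_integral_rotation.
  by apply: integral0_eq => z _; rewrite mule0.
rewrite integral_cst//; apply: esym; apply: etrans (mule1 _); congr (_ * _)%E.
by apply: etrans (leb_itvcc ler01) _; rewrite subr0.
Qed.

(** Extension by 0, because rotations, scalings and translations are handled as changes of variables
    on the whole plane. *)
Definition disc_ext (F : CC -> RR) (z : RR * RR) : RR :=
  if z.1 ^+ 2 + z.2 ^+ 2 < 1 then F (z.1 +i* z.2)%C else 0.

Lemma cabs_rad (x y : RR) : cabs (x +i* y)%C = rad (x, y).
Proof. by []. Qed.

Lemma cabs_lt1 (x y : RR) : (cabs (x +i* y)%C < 1) = (x ^+ 2 + y ^+ 2 < 1).
Proof. by rewrite cabs_rad rad_lt// expr1n. Qed.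

Lemma ccont_ver (x y : RR) : ccont (fun s => (x +i* s)%C) y.
Proof. by apply: ccontP => /=; [exact: cst_continuous|exact: cvg_id]. Qed.

Lemma ccont_hor (x y : RR) : ccont (fun s => (s +i* y)%C) x.
Proof. by apply: ccontP => /=; [exact: cvg_id|exact: cst_continuous]. Qed.

Lemma continuous_eq_near (R : realType) (u v : R -> R) (t d : R) : 0 < d ->
  (forall h, `|h| < d -> u (t + h) = v (t + h)) -> {for t, continuous u} -> {for t, continuous v}.
Proof.
move=> d0 uv /eps_continuous cu; apply: continuous_eps => e e0.
have [d1 d10 H] := cu e e0; exists (Num.min d d1); first by rewrite lt_min d0 d10.
by move=> h; rewrite lt_min => /andP[h1 h2]; have := uv 0; rewrite normr0 !addr0 => <- //; rewrite -uv//; exact: H.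
Qed.

Lemma quad_lt1_near (R : realType) (x y : R) : x ^+ 2 + y ^+ 2 < 1 ->
  exists2 d : R, 0 < d & forall h, `|h| < d -> (x + h) ^+ 2 + y ^+ 2 < 1.
Proof.
move=> h1; pose e := 1 - (x ^+ 2 + y ^+ 2).
have e0 : 0 < e by rewrite subr_gt0.
exists (e / 3); first by rewrite divr_gt0.
move=> h; rewrite ltr_norml => /andP[h2 h3].
have : x < 1 by nra.
have : -1 < x by nra.
have : e <= 1 by rewrite /e; nra.
have ee : e = 1 - (x ^+ 2 + y ^+ 2) by [].
clearbody e; nra.
Qed.

Lemma measurable_fun_extend0 d (T : measurableType d) (R : realType) (D : set T) (f : T -> R) :
  measurable D -> measurable_fun D f -> measurable_fun setT (fun x => if x \in D then f x else 0).
Proof.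
move=> mD mf; rewrite (_ : (fun x => _) = f \_ D); last by apply/funext => x; rewrite patchE.
exact/(measurable_restrictT _ mD).1.
Qed.

Lemma open_measurable_extend0 (R : realType) (O : set R) (f : R -> R) : open O ->
  (forall x, O x -> {for x, continuous f}) ->
  measurable_fun setT (fun x => if x \in O then f x else 0).
Proof.
move=> oO cf; apply: measurable_fun_extend0; first exact: open_measurable.
by apply: open_continuous_measurable_fun => // x /set_mem; exact: cf.
Qed.

(** In x, continuity is required only at points of the open disc. In y the extension may jump at the
    circle, but it is continuous on the open section of the disc and 0 elsewhere, hence
    measurable. *)
Lemma measurable_disc_ext (h : CC -> CC) (q : RR) : analytic_disc h -> 0 < q <= 1 ->
  @measurable_fun _ _ (measurableTypeR RR * measurableTypeR RR)%type (measurableTypeR RR) setT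
    (disc_ext (fun z => cabs (h z) `^ q)).
Proof.
move=> ah hq.
have cF (g : RR -> CC) (t : RR) : ccont g t -> cabs (g t) < 1 ->
    {for t, continuous (fun s => cabs (h (g s)) `^ q)}.
  by move=> cg g1; apply: cont_cabs_powR => //; apply: ccont_comp cg; exact: analyticP.
have mD : measurable (disc2 : set (measurableTypeR RR * measurableTypeR RR)%type).
  rewrite (_ : disc2 = @rad RR @^-1` [set` `[0%R, 1%R[%R]); last first.
    by apply/seteqP; split => z; rewrite /disc2 /= in_itv /= rad_ge0 rad_lt// expr1n.
  exact: (@measurable_gauge_ball RR _ (@measurable_rad RR)).
suff : @measurable_fun _ _ (measurableTypeR RR * measurableTypeR RR)%type (measurableTypeR RR) disc2 (disc_ext (fun z => cabs (h z) `^ q)).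
  move=> m; rewrite (_ : disc_ext _ = fun z => if z \in disc2 then disc_ext (fun z => cabs (h z) `^ q) z else 0).
    exact: (measurable_fun_extend0 mD m).
  apply/funext => z; rewrite /disc_ext; case: ifPn => [hz|/negbTE hz].
    by rewrite mem_set.
  by case: ifPn.
apply: measurable_sep_cont => //.
  move=> x y; rewrite /disc2 /= => xy.
  have [d d0 Hd] := quad_lt1_near xy.
  apply: (continuous_eq_near d0) (cF _ _ (ccont_hor x y) _); last by rewrite cabs_lt1.
  by move=> k kd; rewrite /disc_ext /= Hd.
move=> x.
pose O : set RR := [set y | x ^+ 2 + y ^+ 2 < 1].
have oO : open O.
  rewrite openE => y Oy; have := Oy; rewrite /O /= addrC => /quad_lt1_near[d d0 Hd].
  exists d => //= z zd; have := Hd (z - y).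
  by rewrite distrC => /(_ zd); rewrite addrC [(y + _)%R]addrC subrK.
rewrite (_ : (fun y => _) = (fun y => if y \in O then cabs (h (x +i* y)%C) `^ q else 0)).
  apply: (@open_measurable_extend0 RR _ _ oO) => y Oy.
  by apply: (cF _ _ (ccont_ver x y)); rewrite cabs_lt1.
apply/funext => y; rewrite /disc_ext /=; case: ifPn => [hz|/negbTE hz].
  by rewrite mem_set.
by rewrite memNset// /O /= hz.
Qed.

Lemma continuous_pmean h (q x : RR) : analytic_disc h -> 0 < q <= 1 -> `|x| < 1 ->
  {for x, continuous (pmean h q)}.
Proof.
move=> ah hq x1; have q0 : 0 < q by case/andP: hq.
pose r := (1 + `|x|) / 2.
have nx := normr_ge0 x.
have hr : 0 <= r < 1 by rewrite /r; lra.
have [K [K0 HK]] := powmod_avg_shift ah (lexx 0) hq hr.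
have pmE y : pmean h q y = mean (fun t => powmod h 0 q (y%:C * ecirc t)).
  by rewrite /pmean /circ_avg; congr mean; apply/funext => t; rewrite /powmod addr0.
apply: continuous_eps => e e0.
have [d d0 Hd] := powR_small q0 e0.
pose d1 := Num.min ((1 - `|x|) / 2) (d / (K + 1)).
have K1 : 0 < K + 1 by lra.
exists d1; first by rewrite /d1 lt_min !divr_gt0// subr_gt0.
move=> k; rewrite /d1 lt_min => /andP[k1 k2].
have xk : `|x + k| <= r by apply: le_trans (ler_normD _ _) _; rewrite /r; lra.
rewrite !pmE; apply: le_lt_trans (HK _ _ _ _) _.
- by rewrite cabsR.
- by rewrite cabsR /r; lra.
have -> : (x + k)%:C - x%:C = k%:C by rewrite rmorphD /= addrC addKr.
rewrite cabsR; apply: Hd; first by rewrite mulr_ge0.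
rewrite ltr_pdivlMr// in k2; apply: le_lt_trans k2.
by rewrite mulrC ler_wpM2l//; lra.
Qed.

Lemma measurable_pmean h (q : RR) : analytic_disc h -> 0 < q <= 1 ->
  @measurable_fun _ _ (measurableTypeR RR) (measurableTypeR RR) `]-1, 1[ (pmean h q).
Proof.
move=> ah hq; apply: (@open_continuous_measurable_fun RR); first exact: interval_open.
move=> x /set_mem; rewrite /= in_itv /= -ltr_norml => x1; exact: continuous_pmean.
Qed.

Definition ecos (t : RR) : RR := cRe (ecirc t).
Definition esin (t : RR) : RR := cIm (ecirc t).

Lemma ecirc_rotation (t x y : RR) : (x +i* y)%C * ecirc t =
  ((ecos t * x - esin t * y) +i* (esin t * x + ecos t * y))%C.
Proof.
rewrite [LHS]cReImE cReM cImM /= -/(ecos t) -/(esin t).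
by congr Complex; [rewrite mulrC [y * _]mulrC|rewrite mulrC [y * _]mulrC].
Qed.

(** Averaging the plane integral over all rotations turns |h|^q into its circular mean, a radial
    function. kappa is chosen before h, q and w, so that it cancels when two such integrals are
    compared. *)
Lemma polar_integral : exists2 kappa : RR, 0 < kappa & forall (h : CC -> CC) (q : RR) (w : RR -> RR),
  analytic_disc h -> 0 < q <= 1 ->
  @measurable_fun _ _ (measurableTypeR RR) (measurableTypeR RR) `[0, 1[ w ->
  (forall r, 0 <= r < 1 -> 0 <= w r) ->
  (\int[@plane_measure RR]_(z in disc2) (cabs (h (z.1 +i* z.2)%C) `^ q * w (rad z))%:E =
  kappa%:E * \int[leb]_(x in [set` `[(0:RR)%R, 1%R[%R]) (pmean h q x * w x * x)%:E)%E.
Proof.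
have [kappa k0 Hk] := radial_plane_integral RR; exists kappa => // h q w ah hq mw w0.
have mI : @measurable _ (measurableTypeR RR) `[0, 1[ by exact: measurable_itv.
pose u (x : RR) : RR := if x \in `[0, 1[%classic then w x else 0.
have mu : @measurable_fun _ _ (measurableTypeR RR) (measurableTypeR RR) setT u.
  exact: (measurable_fun_extend0 mI mw).
have uE x : 0 <= x < 1 -> u x = w x by move=> hx; rewrite /u mem_set//= in_itv.
have u0 x : 0 <= u x.
  by rewrite /u; case: ifPn => // /set_mem /=; rewrite in_itv /=; exact: w0.
have un x : ~~ (0 <= x < 1) -> u x = 0.
  by move=> hx; rewrite /u memNset//= in_itv /=; exact/negP.
pose f (z : RR * RR) : \bar RR := (disc_ext (fun z => cabs (h z) `^ q) z * u (rad z))%:E.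
have f0 z : (0 <= f z)%E.
  by rewrite lee_fin mulr_ge0// /disc_ext; case: ifP => // _; exact: powR_ge0.
have mf : @measurable_fun _ _ (measurableTypeR RR * measurableTypeR RR)%type _ setT f.
  apply/measurable_EFinP; apply: (@measurable_funM _ _ RR); first exact: measurable_disc_ext.
  exact: (measurableT_comp mu (@measurable_rad RR)).
have mcos : @measurable_fun _ _ (measurableTypeR RR) (measurableTypeR RR) setT ecos.
  by apply: (@continuous_measurable_fun RR) => t; apply: ccont_Re; exact: ccont_ecirc.
have msin : @measurable_fun _ _ (measurableTypeR RR) (measurableTypeR RR) setT esin.
  by apply: (@continuous_measurable_fun RR) => t; apply: ccont_Im; exact: ccont_ecirc.
have cs t : ecos t ^+ 2 + esin t ^+ 2 = 1 by rewrite -sqr_cabs cabs_ecirc expr1n.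
pose m (x : RR) : RR := if x \in `[0, 1[%classic then pmean h q x else 0.
have mm : @measurable_fun _ _ (measurableTypeR RR) (measurableTypeR RR) setT m.
  apply: (measurable_fun_extend0 mI); apply: measurable_funS (measurable_pmean ah hq).
    exact: measurable_itv.
  by move=> x /=; rewrite !in_itv /=; lra.
have m0 x : 0 <= m x.
  by rewrite /m; case: ifP => // _; apply: mean_ge0 => t; exact: powR_ge0.
pose psi (x : RR) : \bar RR := (m x * u x)%:E.
have lhsE : (\int[@plane_measure RR]_(z in disc2) (cabs (h (z.1 +i* z.2)%C) `^ q * w (rad z))%:E =
    \int[@plane_measure RR]_z f z)%E.
  rewrite integral_mkcond; apply: eq_integral => z _; rewrite patchE /f /disc_ext.
  case: ifPn => [/set_mem|/negP hz].
    by rewrite /disc2 /= => hz; rewrite hz uE// rad_ge0 rad_lt// expr1n.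
  by rewrite ifN ?mul0r//; apply/negP => hz'; apply: hz; rewrite mem_set.
rewrite lhsE (@plane_integral_rotation_avg RR ecos esin)//.
have -> : (\int[@plane_measure RR]_z \int[@lebesgue_measure RR]_(t in [set` `[0%R, 1%R]%R])
    f ((ecos t * z.1 - esin t * z.2)%R, (esin t * z.1 + ecos t * z.2)%R) =
    \int[@plane_measure RR]_z psi (rad z))%E.
  apply: eq_integral => -[x y] _ /=.
  have rE t : rad (ecos t * x - esin t * y, esin t * x + ecos t * y) = rad (x, y).
    by rewrite -!cabs_rad -ecirc_rotation cabs_mulcirc.
  have [z1|z1] := boolP (0 <= rad (x, y) < 1); last first.
    rewrite /psi (un _ z1) mulr0; apply: integral0_eq => t _.
    by rewrite /f rE (un _ z1) mulr0.
  have z1' : cabs (x +i* y)%C < 1 by case/andP: z1.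
  have cm : continuous (fun t => cabs (h ((x +i* y)%C * ecirc t)) `^ q) by exact: cont_pmean.
  have -> : (fun t : RR => f (ecos t * x - esin t * y, esin t * x + ecos t * y)) =
      (fun t => (u (rad (x, y)) * cabs (h ((x +i* y)%C * ecirc t)) `^ q)%:E).
    apply/funext => t; rewrite /f rE /disc_ext /= -cabs_lt1 -ecirc_rotation cabs_mulcirc z1'.
    by rewrite mulrC.
  rewrite (@mean_EFin RR); last exact: (@continuous_Ml RR).
  rewrite (@meanZ RR)// (circ_avgE (v := fun z => cabs (h z) `^ q)).
    rewrite /psi mulrC /m mem_set//=.
  by apply: cont_pmean => //; rewrite cabsR_ge0// cabs_ge0.
rewrite Hk.
- congr (_ * _)%E; rewrite [RHS]integral_mkcond; apply: eq_integral => x _; rewrite patchE.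
  rewrite /psi /m /u; case: ifPn => // _.
  by rewrite mul0r mul0e.
- apply/measurable_EFinP; exact: (@measurable_funM _ _ RR).
- by move=> x; rewrite lee_fin mulr_ge0.
- move=> x; apply: contraNT => /un; rewrite /psi => ->; by rewrite mulr0.
Qed.

(** * Area estimates *)

Lemma integral_ge_const d (T : measurableType d) (R : realType) (mu : {measure set T -> \bar R})
    (A D : set T) (f : T -> \bar R) (c : R) : measurable A -> measurable D -> A `<=` D ->
  measurable_fun D f -> (forall x, D x -> 0 <= f x)%E -> 0 <= c -> (forall x, A x -> c%:E <= f x)%E ->
  (c%:E * mu A <= \int[mu]_(x in D) f x)%E.
Proof.
move=> mA mD AD mf f0 c0 fc.
apply: (@le_trans _ _ (\int[mu]_(x in A) f x)%E); last exact: ge0_subset_integral.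
rewrite -integral_cst//; apply: ge0_le_integral => //; exact: measurable_funS mf.
Qed.

Lemma integral_le_const d (T : measurableType d) (R : realType) (mu : {measure set T -> \bar R})
    (A D : set T) (f : T -> \bar R) (c : R) : measurable A -> measurable D ->
  measurable_fun D f -> (forall x, D x -> 0 <= f x)%E -> 0 <= c ->
  (forall x, D x -> A x -> f x <= c%:E)%E -> (forall x, D x -> ~ A x -> f x = 0)%E ->
  (\int[mu]_(x in D) f x <= c%:E * mu A)%E.
Proof.
move=> mA mD mf f0 c0 fc f00.
have -> : (\int[mu]_(x in D) f x = \int[mu]_(x in D `&` A) f x)%E.
  rewrite [LHS]integral_mkcond [RHS]integral_mkcond; apply: eq_integral => x _; rewrite !patchE in_setI.
  case: ifPn => //= /set_mem Dx; case: ifPn => // /negP Ax; apply: f00 => //.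
  by move=> /mem_set.
have mDA : measurable (D `&` A) by exact: measurableI.
apply: (@le_trans _ _ (\int[mu]_(x in D `&` A) (cst c%:E) x)%E).
  apply: ge0_le_integral => //.
  - by move=> x [Dx _]; exact: f0.
  - by apply: measurable_funS mf => // x [].
  - by move=> x [] Dx Ax; exact: fc.
rewrite integral_cst// lee_wpmul2l ?lee_fin//.
by apply: le_measure; rewrite ?inE.
Qed.

Lemma has_cderiv_affine (c w z : CC) : has_cderiv (fun y => c + w * y) z w.
Proof.
have := has_cderivD (has_cderiv_cst c z) (has_cderivZ w (has_cderiv_id z)).
by rewrite add0r mulr1.
Qed.

Lemma analytic_affine h (c w : CC) : analytic_disc h -> cabs c + cabs w <= 1 -> w != 0 ->
  analytic_disc (fun y => h (c + w * y)).
Proof.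
move=> ah cw w0; apply: analytic_disc_hol => z z1.
exists (cderiv h (c + w * z) * w); apply: has_cderiv_comp (has_cderiv_affine c w z) _.
apply: analyticP => //; apply: le_lt_trans (cabsD _ _) _; rewrite cabsM.
apply: lt_le_trans cw; rewrite ltrD2l -[X in _ < X]mulr1 ltr_pM2l// cabs_gt0.
by [].
Qed.

Lemma pmean0 h q : pmean h q 0 = cabs (h 0) `^ q.
Proof.
rewrite /pmean /circ_avg -[RHS](@mean_cst RR); congr mean; apply/funext => t.
by rewrite rmorph0 mul0r.
Qed.

Lemma pmean_ge0 h q x : 0 <= pmean h q x.
Proof. by apply: mean_ge0 => t; exact: powR_ge0. Qed.

Lemma measurable_weighted_pmean h (q : RR) (w : RR -> RR) : analytic_disc h -> 0 < q <= 1 ->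
  @measurable_fun _ _ (measurableTypeR RR) (measurableTypeR RR) `[0, 1[ w ->
  @measurable_fun _ _ (measurableTypeR RR) _ `[0, 1[ (fun x => (pmean h q x * w x * x)%:E).
Proof.
move=> ah hq mw; apply/measurable_EFinP.
apply: (@measurable_funM _ _ RR); last exact: measurable_id.
apply: (@measurable_funM _ _ RR); last exact: mw.
apply: measurable_funS (measurable_pmean ah hq); first exact: measurable_itv.
by move=> x /=; rewrite !in_itv /=; lra.
Qed.

Lemma disc2_integralE (F w : _ -> RR) :
  (\int[@plane_measure RR]_(z in disc2) (F (z.1 +i* z.2)%C * w (rad z))%:E =
   \int[@plane_measure RR]_z (disc_ext F z * w (rad z))%:E)%E.
Proof.
rewrite integral_mkcond; apply: eq_integral => z _; rewrite patchE /disc_ext.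
case: ifPn => [/set_mem|/negP hz]; first by rewrite /disc2 /= => ->.
by rewrite ifN ?mul0r//; apply/negP => hz'; apply: hz; rewrite mem_set.
Qed.

Lemma disc_ext_ge0 (F : CC -> RR) z : (forall y, 0 <= F y) -> 0 <= disc_ext F z.
Proof. by move=> F0; rewrite /disc_ext; case: ifP. Qed.

Lemma measurable_plane_scale (R : realType) (a c c' : R) (f : R * R -> \bar R) :
  measurable_fun setT f -> measurable_fun setT (fun z : R * R => f ((a * z.1 + c)%R, (a * z.2 + c')%R)).
Proof.
move=> mf; apply: (measurableT_comp mf); apply: measurable_fun_pair; apply: measurable_funD => //;
  by apply: measurable_funM.
Qed.

Lemma cscaleE (d u v : RR) (z : CC) :
  z + d%:C * (u +i* v)%C = ((d * u + cRe z) +i* (d * v + cIm z))%C.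
Proof. by case: z => a b; rewrite [LHS]cReImE cReD cImD cReM cImM /=; congr Complex; ring. Qed.

Definition step_itv (R : realType) (a b x : R) : R := if a <= x < b then 1 else 0.

Lemma measurable_step_itv (R : realType) (a b : R) :
  @measurable_fun _ _ (measurableTypeR R) (measurableTypeR R) setT (step_itv a b).
Proof.
rewrite (_ : step_itv a b = \1_[set` `[a, b[%R]); last first.
  apply/funext => x; rewrite indicE /step_itv; case: ifPn => h.
    by rewrite mem_set//= in_itv.
  by rewrite memNset//= in_itv /=; exact/negP.
by apply: measurable_indic; exact: measurable_itv.
Qed.

Lemma step_itv_ge0 (R : realType) (a b x : R) : 0 <= step_itv a b x.
Proof. by rewrite /step_itv; case: ifP. Qed.

Lemma lebesgue_measure_itvco (R : realType) (a b : R) : a <= b ->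
  @lebesgue_measure R [set` `[a, b[%R] = (b - a)%:E.
Proof.
move=> ab; rewrite lebesgue_measure_itv /= lte_fin; case: ltP => h; first by rewrite -EFinB.
by have -> : b - a = 0 by lra.
Qed.

(* Compare the mean of |h|^q over the disc of centre z and radius d with its integral over the annulus
   |z| - d <= |y| < |z| + d, which has width 2d and where the circular means are at most the last one. *)
Lemma pointwise_pmean h (q d : RR) (z : CC) : analytic_disc h -> 1 / 2 <= q <= 1 -> 0 < d ->
  cabs z + d < 1 -> cabs (h z) `^ q <= 8 * pmean h q (cabs z + d) / d.
Proof.
move=> ah q2 d0 zd; have [kap k0 H] := polar_integral.
have q01 : 0 < q <= 1 by lra.
set r := cabs z; set M := pmean h q (r + d); set A := cabs (h z) `^ q.
have r0 : 0 <= r := cabs_ge0 z.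
have M0 : 0 <= M by exact: pmean_ge0.
have A0 : 0 <= A by exact: powR_ge0.
have dC0 : (d%:C : CC) != 0 by rewrite -cabs_gt0 cabsR gtr0_norm.
pose k (y : CC) := h (z + d%:C * y).
have ak : analytic_disc k.
  by apply: analytic_affine => //; rewrite cabsR_ge0 ?ltW.
pose I1 : RR -> RR := fun=> 1.
pose I2 : RR -> RR := step_itv (r - d) (r + d).
have mI1 : @measurable_fun _ _ (measurableTypeR RR) (measurableTypeR RR) `[0, 1[ I1.
  exact: measurable_cst.
have mI2T : @measurable_fun _ _ (measurableTypeR RR) (measurableTypeR RR) setT I2.
  exact: (@measurable_step_itv RR).
have mI2 : @measurable_fun _ _ (measurableTypeR RR) (measurableTypeR RR) `[0, 1[ I2.
  exact: (measurable_funS measurableT (@subsetT _ _) mI2T).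
have I20 x : 0 <= I2 x by exact: (@step_itv_ge0 RR).
have lo := H k q I1 ak q01 mI1 (fun _ _ => ler01).
have hi := H h q I2 ah q01 mI2 (fun x _ => I20 x).
rewrite (disc2_integralE (fun y => cabs (k y) `^ q)) in lo.
rewrite (disc2_integralE (fun y => cabs (h y) `^ q)) in hi.
have mI : @measurable _ (measurableTypeR RR) `[0, 1[ by exact: measurable_itv.
(* Only radii in [1/2, 1) are kept: there the Jacobian is at least 1/2 and the mean of |k|^q at
   least its value A at 0, on an interval of length 1/2. *)
have lo2 : ((kap * (A / 4))%:E <= \int[@plane_measure RR]_y (disc_ext (fun y => cabs (k y) `^ q) y * I1 (rad y))%:E)%E.
  rewrite lo EFinM lee_wpmul2l ?lee_fin//; first exact: ltW.
  have -> : ((A / 4)%:E = (A / 2)%:E * leb [set` `[(1/2 : RR)%R, 1%R[%R])%E.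
    have -> : leb [set` `[(1/2 : RR)%R, 1%R[%R] = (1 - 1/2)%:E by apply: lebesgue_measure_itvco; clear; lra.
    rewrite -EFinM; congr EFin; clear; lra.
  apply: integral_ge_const => //.
  - by move=> x /=; rewrite !in_itv /=; clear; lra.
  - exact: measurable_weighted_pmean.
  - move=> x /=; rewrite in_itv /= => /andP[x0 _].
    rewrite lee_fin; exact: (mulr_ge0 (mulr_ge0 (pmean_ge0 _ _ _) ler01) x0).
  - by clear -A0; lra.
  - move=> x /=; rewrite in_itv /= lee_fin /I1 mulr1 => x1.
    have : A <= pmean k q x.
      have -> : A = pmean k q 0 by rewrite pmean0 /k mulr0 addr0.
      by apply: pmean_mono => //; clear -x1; lra.
    move=> AP; apply: ler_pM => //; clear -x1; lra.
have hi2 : (\int[@plane_measure RR]_y (disc_ext (fun y => cabs (h y) `^ q) y * I2 (rad y))%:E <= (kap * (M * (2 * d)))%:E)%E.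
  rewrite hi EFinM lee_wpmul2l ?lee_fin//; first exact: ltW.
  have -> : ((M * (2 * d))%:E = M%:E * leb [set` `[(r - d)%R, (r + d)%R[%R])%E.
    have -> : leb [set` `[(r - d)%R, (r + d)%R[%R] = (r + d - (r - d))%:E by apply: lebesgue_measure_itvco; clear -d0; lra.
    by rewrite -EFinM; congr EFin; ring.
  apply: integral_le_const => //.
  - exact: measurable_weighted_pmean.
  - move=> x /=; rewrite in_itv /= => /andP[x0 _].
    rewrite lee_fin; exact: (mulr_ge0 (mulr_ge0 (pmean_ge0 _ _ _) (I20 x)) x0).
  - move=> x /=; rewrite !in_itv /= => x01 xr; rewrite lee_fin /I2 /step_itv xr mulr1.
    have PM : pmean h q x <= M by apply: pmean_mono => //; clear -x01 xr zd; lra.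
    by apply: le_trans PM; rewrite ler_piMr ?pmean_ge0//; clear -x01; lra.
  - by move=> x /= _; rewrite in_itv /= => /negP/negbTE xA; rewrite /I2 /step_itv xA mulr0 mul0r.
pose f2 (y : RR * RR) : \bar RR := (disc_ext (fun y => cabs (h y) `^ q) y * I2 (rad y))%:E.
have f20 y : (0 <= f2 y)%E.
  rewrite lee_fin; apply: mulr_ge0 (I20 _); apply: disc_ext_ge0 => t; exact: powR_ge0.
have mf2 : @measurable_fun _ _ (measurableTypeR RR * measurableTypeR RR)%type _ setT f2.
  apply/measurable_EFinP; apply: (@measurable_funM _ _ RR); first exact: measurable_disc_ext.
  exact: (measurableT_comp mI2T (@measurable_rad RR)).
have sc := @plane_integral_scale RR d (cRe z) (cIm z) f2 d0 mf2 f20.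
(* A point y of the unit disc is sent to z + d y, which lies in the annulus where [I2] equals 1.
   Rescaling then costs d^-2, and A/4 <= d^-2 M (2d) produces the constant 8. *)
have cmp : (\int[@plane_measure RR]_y (disc_ext (fun y => cabs (k y) `^ q) y * I1 (rad y))%:E <=
    \int[@plane_measure RR]_y f2 ((d * y.1 + cRe z)%R, (d * y.2 + cIm z)%R))%E.
  apply: ge0_le_integral => //.
  - move=> y _; rewrite lee_fin mulr1; apply: disc_ext_ge0 => t; exact: powR_ge0.
  - apply/measurable_EFinP; apply: (@measurable_funM _ _ RR); first exact: measurable_disc_ext.
    exact: measurable_cst.
  - exact: (@measurable_plane_scale RR d (cRe z) (cIm z) f2 mf2).
  move=> y _; rewrite /disc_ext; case: ifP => [hy|_]; last by rewrite mul0r; exact: f20.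
  have yE : z + d%:C * (y.1 +i* y.2)%C = ((d * y.1 + cRe z) +i* (d * y.2 + cIm z))%C.
    exact: cscaleE.
  have y1 : cabs (y.1 +i* y.2)%C < 1 by rewrite cabs_lt1.
  have dy : cabs (d%:C * (y.1 +i* y.2)%C) < d.
    by rewrite cabsM cabsR_ge0 ?ltW// -[X in _ < X]mulr1 ltr_pM2l.
  have up := cabsD z (d%:C * (y.1 +i* y.2)%C).
  have dn := cabs_leB z (- (d%:C * (y.1 +i* y.2)%C)).
  rewrite opprK cabsN in dn.
  rewrite /f2 /disc_ext -cabs_rad /= -yE -cabs_lt1 -yE -/r in up dn *.
  have zd' : r + d < 1 by [].
  have c2 : cabs (z + d%:C * (y.1 +i* y.2)%C) < r + d by apply: le_lt_trans up _; rewrite ltrD2l.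
  have c1 : r - d <= cabs (z + d%:C * (y.1 +i* y.2)%C).
    by apply: le_trans dn; rewrite lerD2l lerN2 ltW.
  by rewrite (lt_trans c2 zd') lee_fin /I1 /I2 /step_itv c1 c2.
rewrite sc in cmp.
have dd : (0 < (d ^- 2)%:E)%E by rewrite lte_fin invr_gt0 exprn_gt0.
have := le_trans lo2 (le_trans cmp (lee_wpmul2l (ltW dd) hi2)).
rewrite -EFinM lee_fin => fin.
have : A / 4 <= d ^- 2 * (M * (2 * d)).
  by rewrite -(ler_pM2l k0); apply: le_trans fin _; rewrite mulrCA.
have -> : d ^- 2 * (M * (2 * d)) = 2 * M / d by field; rewrite gt_eqF.
rewrite -!mulrA; move: (M / d) (A); clear => X Y; lra.
Qed.

(** * Radial weights and dyadic sums *)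

Lemma itvco_sub (R : realType) (a b c d : R) : c <= a -> b <= d ->
  [set` `[a, b[%R] `<=` [set` `[c, d[%R].
Proof. by move=> ca bd x /=; rewrite !in_itv /= => /andP[/(le_trans ca) -> /lt_le_trans ->]. Qed.

Lemma ge0_integral_itvco_split (R : realType) (a b c : R) (f : R -> \bar R) : a <= b -> b <= c ->
  measurable_fun [set` `[a, c[%R] f -> (forall x, (a <= x < c)%R -> (0 <= f x)%E) ->
  (\int[@lebesgue_measure R]_(x in [set` `[a, c[%R]) f x =
   \int[@lebesgue_measure R]_(x in [set` `[a, b[%R]) f x + \int[@lebesgue_measure R]_(x in [set` `[b, c[%R]) f x)%E.
Proof.
move=> ab bc mf f0.
have E : [set` `[a, c[%R] = [set` `[a, b[%R] `|` [set` `[b, c[%R] :> set R.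
  apply/seteqP; split => x /=; rewrite !in_itv /=.
    by move=> /andP[ax xc]; have [xb|bx] := ltP x b; [left; rewrite ax|right].
  by case=> /andP[h1 h2]; rewrite ?(le_trans ab h1) ?h2 ?h1 ?(lt_le_trans h2 bc).
rewrite E ge0_integral_setU//; try exact: measurable_itv.
- by rewrite -E.
- by move=> x; rewrite -E /= in_itv /= => h; exact: f0.
- by apply/disj_setPS => x [] /=; rewrite !in_itv /= => /andP[_ h1] /andP[h2 _]; lra.
Qed.

Lemma weight_measurable w : radial_weight w ->
  @measurable_fun _ _ (measurableTypeR RR) (measurableTypeR RR) `[0, 1[ w.
Proof. by case=> _ /measurable_int/measurable_EFinP. Qed.

Lemma omega_hatE w r : radial_weight w -> 0 <= r < 1 ->
  (omega_hat w r)%:E = (\int[leb]_(x in [set` `[r, 1[%R]) (w x)%:E)%E.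
Proof.
move=> [w0 iw _] hr; rewrite /omega_hat /Rintegral fineK//.
apply: integrable_fin_num => //; apply: integrableS iw; try exact: measurable_itv.
by apply: (@itvco_sub RR); lra.
Qed.

Lemma weight_integral_split (w : RR -> RR) r s :
  @measurable_fun _ _ (measurableTypeR RR) (measurableTypeR RR) `[0, 1[ w -> (forall r, 0 <= r < 1 -> 0 <= w r) ->
  0 <= r <= s -> s < 1 ->
  (\int[leb]_(x in [set` `[r, 1[%R]) (w x)%:E =
   \int[leb]_(x in [set` `[r, s[%R]) (w x)%:E + \int[leb]_(x in [set` `[s, 1[%R]) (w x)%:E)%E.
Proof.
move=> mw w0 rs s1; apply: (@ge0_integral_itvco_split RR); [lra|lra| |].
  apply/measurable_EFinP; apply: measurable_funS mw; first exact: measurable_itv.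
  by apply: (@itvco_sub RR); lra.
by move=> x hx; rewrite lee_fin w0//; lra.
Qed.

Lemma omega_hatB w r s : radial_weight w -> 0 <= r <= s -> s < 1 ->
  (omega_hat w r - omega_hat w s)%:E = (\int[leb]_(x in [set` `[r, s[%R]) (w x)%:E)%E.
Proof.
move=> hw rs s1; have [w0 _ _] := hw.
rewrite EFinB !omega_hatE//; [|lra|lra].
rewrite (weight_integral_split (weight_measurable hw) w0 rs s1) addeK//.
by rewrite -omega_hatE//; lra.
Qed.

Lemma omega_hat_mono w r s : radial_weight w -> 0 <= r <= s -> s < 1 -> omega_hat w s <= omega_hat w r.
Proof.
move=> hw rs s1; have [w0 _ _] := hw; rewrite -subr_ge0 -lee_fin omega_hatB//.
apply: integral_ge0 => x /=; rewrite in_itv /= => hx; rewrite lee_fin w0//; lra.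
Qed.

Lemma ge_const_weight_integral (w m : RR -> RR) (D : set RR) (c : RR) :
  @measurable _ (measurableTypeR RR) D -> D `<=` `[0, 1[%classic ->
  @measurable_fun _ _ (measurableTypeR RR) (measurableTypeR RR) `[0, 1[ w -> (forall r, 0 <= r < 1 -> 0 <= w r) ->
  @measurable_fun _ _ (measurableTypeR RR) (measurableTypeR RR) `[0, 1[ m ->
  0 <= c -> (forall x, D x -> c <= m x) ->
  (c%:E * \int[leb]_(x in D) (w x)%:E <= \int[leb]_(x in D) (m x * w x)%:E)%E.
Proof.
move=> mD D01 mw w0 mm c0 cm.
have w0D x : D x -> 0 <= w x by move=> /D01 /=; rewrite in_itv /=; exact: w0.
have mwD : @measurable_fun _ _ (measurableTypeR RR) (measurableTypeR RR) D w.
  by apply: measurable_funS mw => //; exact: measurable_itv.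
have mmD : @measurable_fun _ _ (measurableTypeR RR) (measurableTypeR RR) D m.
  by apply: measurable_funS mm => //; exact: measurable_itv.
rewrite -ge0_integralZl_EFin//.
- apply: ge0_le_integral => //.
  + by move=> x Dx; rewrite mule_ge0 ?lee_fin//; exact: w0D.
  + by apply: emeasurable_funM => //; apply/measurable_EFinP.
  + by apply/measurable_EFinP; exact: (@measurable_funM _ _ RR).
  + by move=> x Dx; rewrite -EFinM lee_fin ler_wpM2r ?w0D// cm.
- exact/measurable_EFinP.
Qed.

(** On [r_k, r_(k+1)) the increasing function m is at least m(r_k) and the weight has mass W(r_k) -
    W(r_(k+1)); the last term accounts for [r_K, 1). *)
Lemma weighted_step_integral (w m : RR -> RR) : radial_weight w ->
  @measurable_fun _ _ (measurableTypeR RR) (measurableTypeR RR) `[0, 1[ m ->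
  (forall x, 0 <= x < 1 -> 0 <= m x) -> (forall x y, 0 <= x <= y -> y < 1 -> m x <= m y) ->
  forall K (r : nat -> RR), (forall k, 0 <= r k < 1) -> (forall k, r k <= r k.+1) ->
  ((\sum_(k < K) m (r k) * (omega_hat w (r k) - omega_hat w (r k.+1)) + m (r K) * omega_hat w (r K))%:E <=
   \int[leb]_(x in [set` `[r 0%N, 1[%R]) (m x * w x)%:E)%E.
Proof.
move=> hw mm m0 mmono; have [w0 _ _] := hw; have mw := weight_measurable hw.
have mmw : @measurable_fun _ _ (measurableTypeR RR) (measurableTypeR RR) `[0, 1[ (fun x => m x * w x).
  exact: (@measurable_funM _ _ RR).
have mw0 x : 0 <= x < 1 -> 0 <= m x * w x by move=> hx; rewrite mulr_ge0 ?m0 ?w0.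
elim=> [|K IH] r r01 rmono.
  rewrite big_ord0 add0r EFinM omega_hatE//.
  apply: ge_const_weight_integral => //.
  - by move=> x /=; rewrite !in_itv /=; have := r01 0%N; lra.
  - exact: m0.
  - by move=> x /=; rewrite in_itv /= => hx; apply: mmono; have := r01 0%N; lra.
rewrite big_ord_recl /= -addrA EFinD.
have r0 := r01 0%N; have r1 := r01 1%N; have r010 := rmono 0%N.
rewrite (weight_integral_split mmw mw0 (r := r 0%N) (s := r 1%N)); [|lra|lra].
apply: leeD.
  rewrite EFinM omega_hatB//; [|lra|lra].
  apply: ge_const_weight_integral => //.
  - by move=> x /=; rewrite !in_itv /=; lra.
  - exact: m0.
  - by move=> x /=; rewrite in_itv /= => hx; apply: mmono; lra.
exact: (IH (fun k => r k.+1)).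
Qed.

(** By parts, the right-hand side is m_0 W_0 plus the sum of (m_(k+1) - m_k) W_(k+1). The
    coefficients are nonnegative, so W_k may be replaced by c x^k, and x^k - x^(k+1) = (1 - x)
    x^k. *)
Lemma abel_geometric (R : realType) (m W : nat -> R) (x c : R) : 0 < x < 1 -> 0 < c ->
  (forall k, 0 <= m k) -> (forall k, m k <= m k.+1) -> (forall k, c * x ^+ k <= W k) -> forall K,
  (1 - x) * c * \sum_(k < K) m k * x ^+ k <=
  \sum_(k < K) m k * (W k - W k.+1) + m K * W K.
Proof.
move=> x01 c0 m0 mm Wx K.
have main : c * (\sum_(k < K) m k * (x ^+ k - x ^+ k.+1) + m K * x ^+ K) <=
    \sum_(k < K) m k * (W k - W k.+1) + m K * W K.
  elim: K => [|K IH]; first by rewrite !big_ord0 !add0r mulrCA ler_wpM2l//; have := Wx 0%N.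
  rewrite !big_ord_recr /=.
  have := ler_wpM2l (_ : 0 <= m K.+1 - m K) (Wx K.+1); rewrite subr_ge0 => /(_ (mm K)).
  move: IH; move: (\sum_(i < K) _) (\sum_(i < K) _) => S1 S2 IH h.
  move: IH h; rewrite exprS; move: (x ^+ K) => y; lra.
apply: le_trans main; rewrite [(1 - x) * c]mulrC -mulrA; apply: ler_wpM2l; first exact: ltW.
rewrite mulr_sumr -[X in X <= _]addr0; apply: lerD; last by rewrite mulr_ge0// exprn_ge0; lra.
by apply: ler_sum => k _; rewrite exprS; lra.
Qed.

(** Monotone convergence along [0, 1 - 1/(n+1)); it reduces estimates to [0, s), which finitely many
    dyadic rings cover. *)
Lemma integral_itvco_le (R : realType) (f : R -> \bar R) (B : \bar R) :
  measurable_fun [set` `[(0:R), 1[%R] f -> (forall x, 0 <= x < 1 -> (0 <= f x)%E) ->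
  (forall s : R, 0 <= s < 1 -> (\int[@lebesgue_measure R]_(x in [set` `[0%R, s[%R]) f x <= B)%E) ->
  (\int[@lebesgue_measure R]_(x in [set` `[0%R, 1%R[%R]) f x <= B)%E.
Proof.
move=> mf f0 fB; pose F (n : nat) : set R := [set` `[0, 1 - n.+1%:R^-1[%R].
have mF n : measurable (F n) by exact: measurable_itv.
have UF : \bigcup_n F n = [set` `[(0:R), 1[%R].
  apply/seteqP; split => x /=.
    move=> [n _]; rewrite /F /= !in_itv /= => /andP[-> h]; apply: lt_le_trans h _.
    by rewrite gerBl invr_ge0.
  rewrite in_itv /= => /andP[x0 x1]; exists (Num.truncn (1 - x)^-1) => //.
  rewrite /F /= in_itv /= x0 /= ltrBrDr -ltrBrDl.
  have x1' : 0 < 1 - x by lra.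
  rewrite -[X in _ < X]invrK ltf_pV2 ?posrE ?invr_gt0//; exact: truncnS_gt.
have F1 n : 0 <= (1 - n.+1%:R^-1 : R) < 1.
  have h : n.+1%:R^-1 <= 1 :> R by rewrite invf_le1 ?ler1n// ltr0n.
  have h' : 0 < n.+1%:R^-1 :> R by rewrite invr_gt0 ltr0n.
  by rewrite subr_ge0 h gtrBl.
have cv := @ge0_nondecreasing_set_cvg_integral _ (measurableTypeR R) R F f (@lebesgue_measure R).
rewrite -UF; apply: (cvge_le _ (cv _ _ _ _)).
- by apply: nearW => n; exact: fB.
- apply/nondecreasing_seqP => n; apply/subsetPset => x; rewrite /F /= !in_itv /= => /andP[-> h].
  by apply: lt_le_trans h _; rewrite lerD2l lerN2 lef_pV2 ?posrE// ler_nat.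
- exact: mF.
- by move=> n; apply: measurable_funS mf; [exact: measurable_itv|rewrite -UF; exact: bigcup_sup].
- move=> n x Fx; apply: f0; have : [set` `[(0:R), 1[%R] x by rewrite -UF; exists n.
  by rewrite /= in_itv.
Qed.

(** If W stayed above e, all integrals of w over [0, s) would be at most W(0) - e, and so would W(0)
    in the limit. *)
Lemma omega_hat_small (w : RR -> RR) (e : RR) : radial_weight w -> 0 < e -> exists2 s : RR, 0 <= s < 1 & omega_hat w s < e.
Proof.
move=> hw e0; apply: contrapT => H.
have We s : 0 <= s < 1 -> e <= omega_hat w s.
  by move=> hs; rewrite leNgt; apply/negP => h; apply: H; exists s.
have [w0 _ _] := hw.
have : ((omega_hat w 0)%:E <= (omega_hat w 0 - e)%:E)%E.
  have h0 : 0 <= (0 : RR) < 1 by rewrite lexx ltr01.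
  rewrite (omega_hatE hw h0); apply: (@integral_itvco_le RR).
  - by apply/measurable_EFinP; exact: weight_measurable hw.
  - by move=> x hx; rewrite lee_fin w0.
  - move=> s hs; have hs0 : 0 <= (0 : RR) <= s by lra.
    rewrite -[X in (X <= _)%E](omega_hatB hw hs0); last by case/andP: hs.
    by rewrite lee_fin; have := We s hs; lra.
by rewrite lee_fin; lra.
Qed.

(** * Dyadic radii and growth along them *)

Definition dyad (R : realType) (k : nat) : R := 1 - 2 ^- k.

Lemma half_powS (R : realType) k : 2 ^- k.+1 = 2 ^- k / 2 :> R.
Proof. by rewrite exprS invfM mulrC. Qed.

Lemma half_pow_gt0 (R : realType) k : 0 < 2 ^- k :> R.
Proof. by rewrite invr_gt0 exprn_gt0. Qed.

Lemma dyadS (R : realType) k : dyad R k.+1 = dyad R k + 2 ^- k.+1.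
Proof. by rewrite /dyad half_powS; lra. Qed.

Lemma dyad0 (R : realType) : dyad R 0 = 0.
Proof. by rewrite /dyad expr0 invr1 subrr. Qed.

Lemma dyad_leS (R : realType) k : dyad R k <= dyad R k.+1.
Proof. by rewrite dyadS lerDl ltW// half_pow_gt0. Qed.

Lemma dyad01 (R : realType) k : 0 <= dyad R k < 1.
Proof.
apply/andP; split; last by rewrite /dyad; have := half_pow_gt0 R k; lra.
by elim: k => [|k IH]; [rewrite dyad0|exact: le_trans IH (dyad_leS _ _)].
Qed.

Lemma dyad_ge (R : realType) (s : R) : s < 1 -> exists K, s <= dyad R K.
Proof.
move=> s1; exists (Num.truncn (1 - s)^-1); rewrite /dyad.
have s1' : 0 < 1 - s by lra.
set K := Num.truncn _; have h : (1 - s)^-1 < K.+1%:R :> R by exact: truncnS_gt.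
have h2 : (K.+1%:R <= 2 ^+ K :> R) by rewrite -natrX ler_nat ltn_expl.
suff : 2 ^- K <= 1 - s by lra.
rewrite -[X in _ <= X]invrK lef_pV2 ?posrE ?invr_gt0 ?exprn_gt0//.
exact: le_trans (ltW h) h2.
Qed.

(** Subadditivity of the power 1/s, applied to a^s and b^s. *)
Lemma powRD_ge (R : realType) (a b s : R) : 0 <= a -> 0 <= b -> 1 <= s ->
  a `^ s + b `^ s <= (a + b) `^ s.
Proof.
move=> a0 b0 s1; have s0 : 0 < s by lra.
have sV : 0 < s^-1 <= 1 by rewrite invr_gt0 s0 invf_le1.
have /andP[sV0 _] := sV.
have := powRD_le (powR_ge0 a s) (powR_ge0 b s) sV.
rewrite -!powRrM mulfV ?gt_eqF// !powRr1// => h.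
have := powR_le s0 (powR_ge0 _ _) h.
by rewrite -powRrM mulVf ?gt_eqF// powRr1// addr_ge0// powR_ge0.
Qed.

Lemma sum_powR_le (R : realType) (y : nat -> R) (s : R) K : (forall k, 0 <= y k) -> 1 <= s ->
  \sum_(k < K) y k `^ s <= (\sum_(k < K) y k) `^ s.
Proof.
move=> y0 s1; elim: K => [|K IH]; first by rewrite !big_ord0 powR_ge0.
rewrite !big_ord_recr /=; apply: le_trans (powRD_ge _ (y0 K) s1); last by apply: sumr_ge0.
by rewrite lerD2r.
Qed.

(** Moving radially, f changes by at most 2^-(k+1) B_k on the ring between two consecutive dyadic
    radii; z' is the radial projection of z onto the inner circle. *)
Lemma analytic_growth f (B : nat -> RR) : analytic_disc f ->
  (forall k z, cabs z <= dyad RR k.+1 -> cabs (cderiv f z) <= B k) ->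
  forall k z, cabs z <= dyad RR k -> cabs (f z) <= cabs (f 0) + \sum_(j < k) 2 ^- j.+1 * B j.
Proof.
move=> af hB; have B0 k : 0 <= B k.
  by apply: le_trans (cabs_ge0 _) (hB k 0 _); rewrite cabs0; case/andP: (dyad01 RR k.+1).
elim=> [|k IH] z hz.
  have -> : z = 0 by apply/eqP; rewrite -cabs_eq0 eq_le cabs_ge0 -(dyad0 RR) hz.
  by rewrite big_ord0 addr0.
rewrite big_ord_recr /= addrA.
have p0 := half_pow_gt0 RR k.+1.
have [hz'|hz'] := leP (cabs z) (dyad RR k).
  by apply: le_trans (IH z hz') _; rewrite lerDl mulr_ge0// ltW.
have /andP[dk0 dk1] := dyad01 RR k.
have z0 : 0 < cabs z by exact: le_lt_trans hz'.
pose t := dyad RR k / cabs z.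
have t0 : 0 <= t by rewrite divr_ge0// ltW.
pose z' := t%:C * z.
have cz' : cabs z' = dyad RR k by rewrite cabsM cabsR_ge0// /t divfK// gt_eqF.
have dz : cabs (z - z') = cabs z - dyad RR k.
  have -> : z - z' = (1 - t)%:C * z by rewrite rmorphB /= mulrBl rmorph1 mul1r.
  rewrite cabsM cabsR_ge0; first by rewrite mulrBl mul1r /t divfK// gt_eqF.
  by rewrite subr_ge0 ler_pdivrMr// mul1r ltW.
have mv : cabs (f z - f z') <= B k * cabs (z - z').
  apply: cderiv_mvt => s s01.
  have ss : cabs (z' + s%:C * (z - z')) <= dyad RR k.+1.
    by apply: cabs_segment => //; rewrite cz' dyad_leS.
  exists (cderiv f (z' + s%:C * (z - z'))); last exact: hB.
  apply: analyticP => //; apply: le_lt_trans ss _; by case/andP: (dyad01 RR k.+1).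
have := IH z' (_ : _ <= _); rewrite cz' => /(_ (lexx _)) h1.
have h2 : cabs (f z) <= cabs (f z - f z') + cabs (f z').
  by apply: le_trans (cabsD _ _); rewrite subrK.
have h3 : B k * cabs (z - z') <= 2 ^- k.+1 * B k.
  by rewrite mulrC ler_wpM2r// dz lerBlDl -dyadS.
lra.
Qed.

Lemma powR_expr (R : realType) (a s : R) n : 0 <= a -> (a ^+ n) `^ s = (a `^ s) ^+ n.
Proof. by move=> a0; rewrite -(powR_mulrn n a0) -powRrM mulrC powRrM powR_mulrn// powR_ge0. Qed.

(** The factor by which (1 - r)^(2p-1) decreases from one dyadic radius to the next; it is less than
    1 when p > 1/2. *)
Definition dratio (R : realType) (p : R) : R := 2^-1 `^ (2 * p - 1).

Lemma dratio01 (R : realType) (p : R) : 1 / 2 < p -> 0 < dratio p < 1.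
Proof.
move=> hp; rewrite powR_gt0 ?invr_gt0//=.
have <- : 1 `^ (2 * p - 1) = (1 : R) by rewrite powR1.
by apply: gt0_ltr_powR; rewrite ?nnegrE//; lra.
Qed.

Lemma dratioE (R : realType) (p : R) : dratio p = 2 * (4^-1) `^ p.
Proof.
have -> : (4^-1 : R) = 2^-1 ^+ 2 by rewrite exprVn -natrX.
rewrite -powR_mulrn// -powRrM /dratio powRB//; last by rewrite invr_neq0// implybT.
by rewrite powRr1// invrK mulrC.
Qed.

Lemma powR_half_pow (R : realType) (p : R) k : (2 ^- k) `^ (2 * p - 1) = dratio p ^+ k.
Proof. by rewrite -exprVn powR_expr. Qed.

(** Inside the power, 4^-k becomes 4^(-pk), which combines with 2^k to [dratio p ^+ k]; the constant
    is 32 = 8 times 2^2. *)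
Lemma quarter_powE (R : realType) (p m : R) k : 0 < p -> 0 <= m ->
  4 ^- k * (8 * m * 2 ^+ k.+2) `^ p^-1 = (32 * (m * dratio p ^+ k)) `^ p^-1.
Proof.
move=> p0 m0; have h : (4 ^- k : R) = ((4 ^- k) `^ p) `^ p^-1.
  by rewrite -powRrM mulfV ?gt_eqF// powRr1// invr_ge0 exprn_ge0.
have e0 : 0 <= 8 * m * 2 ^+ k.+2 by apply: mulr_ge0 (exprn_ge0 _ _); [apply: mulr_ge0|].
rewrite [X in X * _]h -powRM ?powR_ge0//.
congr (_ `^ _); rewrite -exprVn powR_expr// dratioE exprMn !exprS.
by move: (2 ^+ k) (_ ^+ k) => u v; ring.
Qed.

(** [pointwise_pmean] with d = 2^-(k+2), the gap between the dyadic radii k+1 and k+2. *)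
Lemma cabs_le_pmean h (p : RR) k (z : CC) : analytic_disc h -> 1 / 2 <= p <= 1 ->
  cabs z <= dyad RR k.+1 -> cabs (h z) <= (8 * pmean h p (dyad RR k.+2) * 2 ^+ k.+2) `^ p^-1.
Proof.
move=> ah hp hz; have p0 : 0 < p by lra.
have /andP[_] := dyad01 RR k.+2; rewrite dyadS => dk.
have z0 := cabs_ge0 z; have q0 := half_pow_gt0 RR k.+2.
have -> : cabs (h z) = (cabs (h z) `^ p) `^ p^-1.
  by rewrite -powRrM mulfV ?gt_eqF// powRr1// cabs_ge0.
apply: powR_le; [by rewrite invr_gt0|exact: powR_ge0|].
have zd : cabs z + 2 ^- k.+2 < 1 by apply: le_lt_trans dk; rewrite lerD2r.
apply: le_trans (pointwise_pmean ah hp q0 zd) _.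
have zz : 0 <= cabs z + 2 ^- k.+2 <= dyad RR k.+1 + 2 ^- k.+2.
  by rewrite lerD2r hz andbT; exact: addr_ge0 (ltW q0).
have e0 : 0 <= 2 ^+ k.+2 :> RR by exact: exprn_ge0.
rewrite invrK; apply: ler_wpM2r e0 _ _ _; apply: ler_wpM2l (ler0n _ _) _ _ _.
exact: pmean_mono ah hp zz dk.
Qed.

(** Raised to the power p, the bound reads (1 - r)^(2p-1) <= B^p W(r). At the dyadic radius k+2 the
    left side is [dratio p] to the power k+2, and the two extra factors go into c. *)
Lemma omega_hat_dyad_ge (w : RR -> RR) (p B : RR) : radial_weight w -> 0 < p ->
  (forall r, 0 <= r < 1 -> (1 - r) `^ (2 - p^-1) / omega_hat w r `^ p^-1 <= B) ->
  exists2 c : RR, 0 < c & forall k, c * dratio p ^+ k <= omega_hat w (dyad RR k.+2).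
Proof.
move=> hw p0 hB; have [_ _ W0] := hw.
have h0 : 0 <= (0 : RR) < 1 by rewrite lexx ltr01.
have B0 : 0 < B.
  apply: lt_le_trans (hB 0 h0); rewrite divr_gt0 ?powR_gt0// ?W0//; lra.
have x0 : 0 < dratio p by rewrite powR_gt0// invr_gt0.
exists (dratio p ^+ 2 / B `^ p); first by rewrite divr_gt0 ?exprn_gt0 ?powR_gt0.
move=> k; have hr := dyad01 RR k.+2; have := hB _ hr; have := W0 _ hr.
move: (omega_hat w _) => W Wp.
have -> : 1 - dyad RR k.+2 = 2 ^- k.+2 by rewrite /dyad; lra.
rewrite ler_pdivrMr ?powR_gt0// => h.
have pe : (2 - p^-1) * p = 2 * p - 1 by rewrite mulrBl mulVf ?gt_eqF.
have e1 : ((2 ^- k.+2) `^ (2 - p^-1)) `^ p = dratio p ^+ k.+2 by rewrite -powRrM pe powR_half_pow.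
have e2 : (B * W `^ p^-1) `^ p = B `^ p * W.
  by rewrite powRM ?powR_ge0 ?(ltW B0)// -powRrM mulVf ?gt_eqF// powRr1// ltW.
have := powR_le p0 (powR_ge0 _ _) h.
rewrite e1 e2 -addn2 exprD => h2.
by rewrite mulrAC ler_pdivrMr ?powR_gt0// mulrC [W * _]mulrC.
Qed.

(** The bound of [cabs_le_pmean] on the disc of radius [dyad RR k.+1]. With h = f', its sum against
    4^-k controls both T_g f for g(z) = z and the norm in D^1_0. *)
Definition dcoef (h : CC -> CC) (p : RR) (k : nat) : RR :=
  (8 * pmean h p (dyad RR k.+2) * 2 ^+ k.+2) `^ p^-1.

Lemma sum_dcoef_le (w : RR -> RR) (p c : RR) (h : CC -> CC) (S : RR) : radial_weight w -> 1 / 2 < p < 1 ->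
  0 < c -> (forall k, c * dratio p ^+ k <= omega_hat w (dyad RR k.+2)) -> analytic_disc h ->
  (\int[leb]_(x in [set` `[(0:RR)%R, 1%R[%R]) (pmean h p x * w x * x)%:E <= S%:E)%E ->
  forall K, \sum_(k < K) 4 ^- k * dcoef h p k <= (64 / ((1 - dratio p) * c)) `^ p^-1 * S `^ p^-1.
Proof.
move=> hw hp c0 hc ah hS K; have [w0 _ _] := hw; have mw := weight_measurable hw.
have hp' : 0 < p <= 1 by lra.
have hp2 : 1 / 2 <= p <= 1 by lra.
have p0 : 0 < p by lra.
have /andP[x0 x1] := dratio01 (proj1 (andP hp)).
have mm : @measurable_fun _ _ (measurableTypeR RR) (measurableTypeR RR) `[0, 1[ (pmean h p).
  apply: measurable_funS (measurable_pmean ah hp'); first exact: measurable_itv.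
  by move=> x /=; rewrite !in_itv /=; lra.
have mono x y : 0 <= x <= y -> y < 1 -> pmean h p x <= pmean h p y by move=> *; exact: pmean_mono.
have step := weighted_step_integral hw mm (fun x _ => pmean_ge0 h p x) mono K
  (fun k => dyad01 RR k.+2) (fun k => dyad_leS RR k.+2).
have d2 : dyad RR 2 = 3 / 4 by rewrite /dyad; lra.
(* The dyadic radii start at 3/4, so dropping the Jacobian factor x costs at most a factor 2. *)
have step2 : (\int[leb]_(x in [set` `[dyad RR 2, 1%R[%R]) (pmean h p x * w x)%:E <= (2 * S)%:E)%E.
  have S2 : ((2 : RR)%:E * \int[leb]_(x in [set` `[(0:RR)%R, 1%R[%R]) (pmean h p x * w x * x)%:E <= (2 * S)%:E)%E.
    by rewrite EFinM lee_wpmul2l// lee_fin.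
  apply: le_trans S2.
  have mf := measurable_weighted_pmean ah hp' mw.
  have f0 (x : RR) : 0 <= x < 1 -> 0 <= pmean h p x * w x * x.
    move=> hx; apply: mulr_ge0; last by case/andP: hx.
    by apply: mulr_ge0 (pmean_ge0 _ _ _) (w0 _ hx).
  rewrite -ge0_integralZl_EFin//.
  have sub : [set` `[dyad RR 2, 1%R[%R] `<=` [set` `[(0:RR), 1[%R].
    by apply: (@itvco_sub RR); clear -d2; lra.
  apply: (@le_trans _ _ (\int[leb]_(x in [set` `[dyad RR 2, 1%R[%R]) (2%:E * (pmean h p x * w x * x)%:E))%E).
    apply: ge0_le_integral => //.
    - by move=> x /sub /=; rewrite in_itv /= => hx; rewrite lee_fin mulr_ge0 ?pmean_ge0 ?w0.
    - apply/measurable_EFinP; apply: (@measurable_funM _ _ RR).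
        by apply: measurable_funS mm => //; exact: measurable_itv.
      by apply: measurable_funS mw => //; exact: measurable_itv.
    - apply: emeasurable_funM => //; apply: measurable_funS mf => //; exact: measurable_itv.
    - move=> x xD; have := sub _ xD; move: xD => /=; rewrite !in_itv /= d2 => hx hx2.
      rewrite -EFinM lee_fin mulrCA -[X in X <= _]mulr1; apply: ler_wpM2l; last by clear -hx; lra.
      exact: mulr_ge0 (pmean_ge0 _ _ _) (w0 _ hx2).
  apply: ge0_subset_integral => //.
  - by apply: emeasurable_funM.
  - by move=> x /=; rewrite in_itv /= => hx; rewrite mule_ge0// lee_fin f0.
have := le_trans step step2; rewrite lee_fin => step3.
have ab := abel_geometric (m := fun k => pmean h p (dyad RR k.+2)) (W := fun k => omega_hat w (dyad RR k.+2))
  (dratio01 (proj1 (andP hp))) c0 (fun k => pmean_ge0 _ _ _)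
  (fun k => mono _ _ (andb_true_intro (conj (proj1 (andP (dyad01 RR k.+2))) (dyad_leS RR k.+2))) (proj2 (andP (dyad01 RR k.+3)))) hc K.
have := le_trans ab step3; set Y := \sum_(k < K) _ => hY.
have xc : 0 < (1 - dratio p) * c by rewrite mulr_gt0 ?subr_gt0.
have S0 : 0 <= S.
  have : 0 <= Y by apply: sumr_ge0 => k _; rewrite mulr_ge0 ?pmean_ge0// exprn_ge0// ltW.
  by move=> Y0; have := le_trans (mulr_ge0 (ltW xc) Y0) hY; clear; lra.
have pV1 : 1 <= p^-1 by rewrite invf_ge1//; clear -hp; lra.
under eq_bigr => k _ do rewrite /dcoef quarter_powE ?pmean_ge0//.
(* The exponent 1/p is at least 1, so the sum moves inside the power, where the bound from Abel
   summation is linear. *)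
apply: le_trans (@sum_powR_le RR (fun k => 32 * (pmean h p (dyad RR k.+2) * dratio p ^+ k)) p^-1 K _ pV1) _.
  by move=> k; rewrite !mulr_ge0 ?pmean_ge0// exprn_ge0// ltW.
rewrite -mulr_sumr -/Y -powRM//; last by rewrite divr_ge0// ltW.
have YS : Y <= 2 * S / ((1 - dratio p) * c) by rewrite ler_pdivlMr// mulrC.
apply: powR_le; first by rewrite invr_gt0.
  by apply: mulr_ge0 => //; apply: sumr_ge0 => k _; rewrite mulr_ge0 ?pmean_ge0// exprn_ge0// ltW.
have -> : 64 / ((1 - dratio p) * c) * S = 32 * (2 * S / ((1 - dratio p) * c)) by ring.
exact: ler_wpM2l.
Qed.

(** * Boundedness when (ii) fails *)

Notation meas01 w := (@measurable_fun _ _ (measurableTypeR RR) (measurableTypeR RR) `[0, 1[%classic w).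

Lemma weighted_pmean_ge0 h (q : RR) (w : RR -> RR) (x : RR) : (forall r, 0 <= r < 1 -> 0 <= w r) ->
  0 <= x < 1 -> 0 <= pmean h q x * w x * x.
Proof.
move=> w0 hx; apply: mulr_ge0; last by case/andP: hx.
by apply: mulr_ge0 (pmean_ge0 _ _ _) (w0 _ hx).
Qed.

Lemma dirichlet_integral_polar : exists2 kap : RR, 0 < kap & forall (f : CC -> CC) (p : RR) (w : RR -> RR),
  analytic_disc f -> 0 < p <= 1 -> meas01 w -> (forall r, 0 <= r < 1 -> 0 <= w r) ->
  (dirichlet_integral p w f =
  kap%:E * \int[leb]_(x in [set` `[(0:RR)%R, 1%R[%R]) (pmean (cderiv f) p x * w x * x)%:E)%E.
Proof.
have [kap k0 H] := polar_integral; exists (kap / pi); first by rewrite divr_gt0// pi_gt0.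
move=> f p w af hp mw w0; have ad := cderiv_analytic af.
have pi0 : 0 <= pi^-1 :> RR by rewrite invr_ge0 pi_ge0.
have mw' : meas01 (fun x => w x / pi).
  by apply: (@measurable_funM _ _ RR) => //; exact: measurable_cst.
have w0' r : 0 <= r < 1 -> 0 <= w r / pi by move=> hr; rewrite mulr_ge0// w0.
have -> : (dirichlet_integral p w f = \int[@plane_measure RR]_(z in disc2)
    (cabs (cderiv f (z.1 +i* z.2)%C) `^ p * (w (rad z) / pi))%:E)%E.
  by rewrite /dirichlet_integral; apply: eq_integral => z _; rewrite mulrA.
rewrite (H _ _ _ ad hp mw' w0') EFinM -muleA; congr (_ * _)%E.
rewrite -ge0_integralZl_EFin//.
- by apply: eq_integral => x _; rewrite -EFinM; congr EFin; ring.
- by move=> x /=; rewrite in_itv /= => hx; rewrite lee_fin weighted_pmean_ge0.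
- exact: measurable_weighted_pmean.
Qed.

Lemma dirichlet_integral_ge0 p w f : (forall r, 0 <= r < 1 -> 0 <= w r) ->
  (0 <= dirichlet_integral p w f)%E.
Proof.
move=> w0; apply: integral_ge0 => z; rewrite /disc2 /= => hz.
rewrite lee_fin; apply: mulr_ge0; last by rewrite invr_ge0 pi_ge0.
apply: mulr_ge0; first exact: powR_ge0.
by apply: w0; rewrite sqrtr_ge0 -/(rad z) rad_lt// expr1n.
Qed.

Lemma norm_Dp_ge_dirichlet p w f : 0 < p -> (forall r, 0 <= r < 1 -> 0 <= w r) ->
  fine (dirichlet_integral p w f) `^ p^-1 <= norm_Dp p w f.
Proof.
move=> p0 w0; apply: powR_le; [by rewrite invr_gt0|by rewrite fine_ge0// dirichlet_integral_ge0|].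
by rewrite lerDl powR_ge0.
Qed.

Lemma norm_Dp_ge_at0 p w f : 0 < p -> (forall r, 0 <= r < 1 -> 0 <= w r) -> cabs (f 0) <= norm_Dp p w f.
Proof.
move=> p0 w0; rewrite -[X in X <= _](powRr1 (cabs_ge0 _)) -(mulfV (lt0r_neq0 p0)) powRrM.
apply: powR_le; [by rewrite invr_gt0|exact: powR_ge0|].
by rewrite lerDr fine_ge0// dirichlet_integral_ge0.
Qed.

Lemma dcoef_ge0 h p k : 0 <= dcoef h p k.
Proof. exact: powR_ge0. Qed.

Definition growth (B : nat -> RR) (a : RR) (k : nat) : RR := a + \sum_(j < k) 2 ^- j.+1 * B j.

(* From K to K+1 the left side grows by exactly [2^-K * (2^-(K+1) * B K)]. *)
Lemma sum_growth_le (B : nat -> RR) (a : RR) K : (forall k, 0 <= B k) ->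
  \sum_(k < K) growth B a k.+1 * 2 ^- k.+1 + growth B a K * 2 ^- K <= a + \sum_(k < K) 4 ^- k * B k.
Proof.
move=> B0; elim: K => [|K IH].
  by rewrite /growth !big_ord0 add0r expr0 invr1 mulr1.
rewrite !big_ord_recr /=; apply: le_trans (_ : (a + \sum_(k < K) 4 ^- k * B k) + 2 ^- K * (2 ^- K.+1 * B K) <= _).
  have -> : growth B a K.+1 = growth B a K + 2 ^- K.+1 * B K by rewrite /growth big_ord_recr /= addrA.
  move: IH; rewrite half_powS.
  move: (\sum_(k < K) _) (\sum_(k < K) _) (growth B a K) (2 ^- K) (B K) => s1 s2 b h y IH; lra.
rewrite -addrA lerD2l lerD2l mulrA; apply: ler_wpM2r => //.
have -> : 4 ^- K = 2 ^- K * 2 ^- K :> RR by rewrite -invfM -exprMn -natrM.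
by apply: ler_wpM2l; rewrite ?(ltW (half_pow_gt0 _ _))// half_powS; have := half_pow_gt0 RR K; lra.
Qed.

Lemma ccont_line (z : CC) t : ccont (fun s => s%:C * z) t.
Proof.
apply: ccontM; last exact: ccont_cst.
by apply: ccontP => /=; [exact: cvg_id|exact: cst_continuous].
Qed.

Lemma cderiv_id z : cderiv id z = 1.
Proof. exact: has_cderivE (has_cderiv_id z). Qed.

Lemma cabs_scale_le (t : RR) (z : CC) : 0 <= t -> cabs z <= 1 -> cabs (t%:C * z) <= t.
Proof. by move=> t0 z1; rewrite cabsM cabsR_ge0// -[X in _ <= X]mulr1 ler_wpM2l. Qed.

(** For g(z) = z the operator integrates f along [0, z]. On the pieces between dyadic parameters, of
    length 2^-(k+1), [growth] bounds |f|, and the total is the quantity estimated by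
    [sum_growth_le]. *)
Lemma Tg_id_le f (B : nat -> RR) (M : RR) (z : CC) : analytic_disc f ->
  (forall k z, cabs z <= dyad RR k.+1 -> cabs (cderiv f z) <= B k) ->
  (forall K, \sum_(k < K) 4 ^- k * B k <= M) -> cabs z < 1 ->
  cabs (Tg id f z) <= cabs (f 0) + M.
Proof.
move=> af hB hM z1; have B0 k : 0 <= B k.
  by apply: le_trans (cabs_ge0 _) (hB k 0 _); rewrite cabs0; case/andP: (dyad01 RR k.+1).
pose beta := growth B (cabs (f 0)).
have grow := analytic_growth af hB.
pose F (t : RR) : CC := f (t%:C * z) * z.
have TE : Tg id f z = cint 0 1 F.
  rewrite /Tg /cint /F; congr Complex; congr Rintegral; apply/funext => t; by rewrite cderiv_id mulr1.
have tz t : 0 <= t <= 1 -> cabs (t%:C * z) < 1.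
  move=> /andP[t0 t1]; rewrite cabsM cabsR_ge0//; apply: le_lt_trans z1.
  by rewrite -[X in _ <= X]mul1r ler_wpM2r// cabs_ge0.
have cF : ccont_on 0 1 F.
  move=> t ht; apply: ccontM; last exact: ccont_cst.
  by apply: ccont_comp (ccont_line z t); exact: analyticP af (tz _ ht).
have Fle k t : 0 <= t <= 1 -> cabs (t%:C * z) <= dyad RR k -> cabs (F t) <= beta k.
  move=> ht hk; rewrite /F cabsM; apply: le_trans (grow k _ hk).
  by rewrite -[X in _ <= X]mulr1 ler_wpM2l ?cabs_ge0// ltW.
have part k : cabs (cint 0 (dyad RR k) F) <= \sum_(j < k) beta j.+1 * 2 ^- j.+1.
  elim: k => [|k IH]; first by rewrite dyad0 cint_pt cabs0 big_ord0.
  have /andP[d0 d1] := dyad01 RR k; have /andP[e0 e1] := dyad01 RR k.+1.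
  have de := dyad_leS RR k.
  rewrite (cint_split d0 de); last by move=> t /andP[h1 h2]; apply: cF; rewrite h1 (le_trans h2 (ltW e1)).
  rewrite big_ord_recr /=; apply: le_trans (cabsD _ _) _; apply: lerD IH _.
  have -> : 2 ^- k.+1 = dyad RR k.+1 - dyad RR k by rewrite dyadS addrC addKr.
  apply: cint_abs_le => // t /andP[h1 h2].
    by apply: cF; rewrite (le_trans d0 h1) (le_trans h2 (ltW e1)).
  apply: Fle; first by rewrite (le_trans d0 h1) (le_trans h2 (ltW e1)).
  by apply: le_trans (cabs_scale_le (le_trans d0 h1) (ltW z1)) h2.
(* Since |z| is at most the dyadic radius K, the bound at level K holds on the whole remaining piece
   up to t = 1. *)
have [K hK] := dyad_ge z1.
have /andP[d0 d1] := dyad01 RR K.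
rewrite TE (cint_split d0 (ltW d1)) //.
apply: le_trans (cabsD _ _) _.
apply: le_trans (_ : \sum_(k < K) beta k.+1 * 2 ^- k.+1 + beta K * 2 ^- K <= _); last first.
  by apply: le_trans (sum_growth_le _ K B0) _; rewrite lerD2l.
apply: lerD (part K) _.
have -> : 2 ^- K = 1 - dyad RR K by rewrite /dyad subKr.
apply: cint_abs_le (ltW d1) _ _ => t /andP[h1 h2].
  by apply: cF; rewrite (le_trans d0 h1).
apply: Fle; first by rewrite (le_trans d0 h1).
apply: le_trans hK; rewrite cabsM cabsR_ge0 ?(le_trans d0 h1)//.
by rewrite -[X in _ <= X]mul1r ler_wpM2r// cabs_ge0.
Qed.

(** With B = [dcoef h p k] one has |h| <= B^(1-p) |h|^p on the circle, so the mean is at most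
    B^(1-p) m; since B^p = 32 m 2^k, this equals B / (32 2^k). *)
Lemma pmean1_le h (p : RR) k (x : RR) : analytic_disc h -> 1 / 2 <= p < 1 -> 0 <= x <= dyad RR k.+1 ->
  pmean h 1 x <= 2 ^- k * dcoef h p k.
Proof.
move=> ah hp hx; have hp' : 1 / 2 <= p <= 1 by lra.
have p01 : 0 < p <= 1 by lra.
have p0 : 0 < p by lra.
have p1 : 0 < 1 - p by lra.
set B := dcoef h p k; have B0 : 0 <= B by exact: dcoef_ge0.
have /andP[x0 xd] := hx; have /andP[e0 e1] := dyad01 RR k.+1; have /andP[f0 f1] := dyad01 RR k.+2.
have x1 : x < 1 := le_lt_trans xd e1.
set m := pmean h p (dyad RR k.+2); have m0 : 0 <= m by exact: pmean_ge0.
have cx : cabs x%:C < 1 by rewrite cabsR_ge0.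
have le1 : pmean h 1 x <= B `^ (1 - p) * m.
  apply: (@le_trans _ _ (B `^ (1 - p) * pmean h p x)); last first.
    apply: ler_wpM2l; first exact: powR_ge0.
    by apply: pmean_mono => //; rewrite x0 (le_trans xd (dyad_leS _ _)).
  rewrite /pmean /circ_avg -(@meanZ RR); last exact: cont_pmean.
  apply: (@le_mean RR); [by apply: cont_pmean; rewrite ?ltr01 ?lexx|by apply: (@continuous_Ml RR); exact: cont_pmean|].
  move=> t; have hB : cabs (h (x%:C * ecirc t)) <= B.
    by apply: cabs_le_pmean => //; rewrite cabs_mulcirc cabsR_ge0.
  move: hB; move: (cabs_ge0 (h (x%:C * ecirc t))); move: (cabs _) => y y0 yB.
  have -> : y `^ 1 = y `^ (1 - p) * y `^ p.
    by rewrite -powRD subrK// oner_eq0.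
  by apply: ler_wpM2r; [exact: powR_ge0|exact: powR_le p1 y0 yB].
apply: le_trans le1 _.
have BE : B `^ p = 8 * m * 2 ^+ k.+2.
  rewrite /B /dcoef -powRrM mulVf ?gt_eqF// powRr1// mulr_ge0 ?exprn_ge0// mulr_ge0//.
have BB : B `^ (1 - p) * (8 * m * 2 ^+ k.+2) = B.
  by rewrite -BE -powRD subrK ?powRr1// oner_eq0.
have t0 : 0 < 2 ^+ k :> RR by rewrite exprn_gt0.
rewrite [X in _ <= X]mulrC ler_pdivlMr//.
have h0 := mulr_ge0 (mulr_ge0 (powR_ge0 B (1 - p)) m0) (ltW t0).
clearbody B m; move: BB h0; rewrite !exprS; move: (B `^ _) (2 ^+ k) => u v BB h0.
clear -BB h0; lra.
Qed.

(** A dyadic ring has width 2^-(k+1) and the mean there is at most 2^-k [dcoef h p k]; the product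
    is below 4^-k [dcoef h p k]. *)
Lemma pmean1_integral_le h (p M : RR) : analytic_disc h -> 1 / 2 <= p < 1 ->
  (forall K, \sum_(k < K) 4 ^- k * dcoef h p k <= M) ->
  (\int[leb]_(x in [set` `[(0:RR)%R, 1%R[%R]) (pmean h 1 x * omega_one x * x)%:E <= M%:E)%E.
Proof.
move=> ah hp hM.
have m1 : meas01 omega_one by exact: measurable_cst.
have h1 : 0 < (1 : RR) <= 1 by rewrite ltr01 lexx.
have o0 r : 0 <= r < 1 -> 0 <= omega_one r by move=> _; exact: ler01.
have mf := measurable_weighted_pmean ah h1 m1.
have f0 (x : RR) : 0 <= x < 1 -> (0 <= (pmean h 1 x * omega_one x * x)%:E)%E.
  by move=> hx; rewrite lee_fin weighted_pmean_ge0.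
apply: (@integral_itvco_le RR) => // s /andP[s0 s1].
have [K hK] := dyad_ge s1.
have part k : (\int[leb]_(x in [set` `[0%R, dyad RR k[%R]) (pmean h 1 x * omega_one x * x)%:E <=
    (\sum_(j < k) 4 ^- j * dcoef h p j)%:E)%E.
  elim: k => [|k IH].
    by rewrite dyad0 big_ord0 set_itvco0 integral_set0.
  have /andP[d0 d1] := dyad01 RR k; have /andP[e0 e1] := dyad01 RR k.+1.
  rewrite (@ge0_integral_itvco_split RR 0 (dyad RR k)) ?dyad_leS//; last 2 first.
  - apply: measurable_funS mf; first exact: measurable_itv.
    by apply: (@itvco_sub RR) => //; exact: ltW.
  - by move=> x /andP[h0 h2]; apply: f0; rewrite h0 (lt_trans h2).
  rewrite big_ord_recr /= EFinD; apply: leeD => //.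
  have q0 := half_pow_gt0 RR k.+1.
  have lenE : leb [set` `[dyad RR k, dyad RR k.+1[%R] = (2 ^- k.+1)%:E.
    apply: etrans (@lebesgue_measure_itvco RR _ _ (dyad_leS _ _)) _.
    by rewrite dyadS addrC addKr.
  apply: (@le_trans _ _ ((2 ^- k * dcoef h p k)%:E * leb [set` `[dyad RR k, dyad RR k.+1[%R])%E); last first.
    rewrite lenE -EFinM lee_fin mulrAC; apply: ler_wpM2r; first exact: dcoef_ge0.
    have -> : 4 ^- k = 2 ^- k * 2 ^- k :> RR by rewrite -invfM -exprMn -natrM.
    by apply: ler_wpM2l; rewrite ?(ltW (half_pow_gt0 _ _))// half_powS; have := half_pow_gt0 RR k; clear; lra.
  have sub : [set` `[dyad RR k, dyad RR k.+1[%R] `<=` [set` `[(0:RR), 1[%R].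
    by apply: (@itvco_sub RR) => //; exact: ltW.
  apply: integral_le_const => //.
  - by apply: measurable_funS mf => //; exact: measurable_itv.
  - by move=> x /sub /=; rewrite in_itv /=; exact: f0.
  - by rewrite mulr_ge0 ?dcoef_ge0// ltW// half_pow_gt0.
  - move=> x /= hx _; have := sub _ hx; move: hx; rewrite /= !in_itv /= => hx /andP[x0 x1].
    rewrite lee_fin mulr1; apply: le_trans (pmean1_le ah hp (_ : 0 <= x <= dyad RR k.+1)).
      by rewrite -[X in _ <= X]mulr1; apply: ler_wpM2l (ltW x1); exact: pmean_ge0.
    by case/andP: hx => _ /ltW ->; rewrite x0.
apply: (@le_trans _ _ (\int[leb]_(x in [set` `[0%R, dyad RR K[%R]) (pmean h 1 x * omega_one x * x)%:E)%E).
  have /andP[d0 d1] := dyad01 RR K.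
  apply: ge0_subset_integral => //; try exact: measurable_itv.
  - apply: measurable_funS mf; first exact: measurable_itv.
    by apply: (@itvco_sub RR) => //; exact: ltW.
  - by move=> x /=; rewrite in_itv /= => /andP[h0 h2]; apply: f0; rewrite h0 (lt_trans h2).
  - by apply: (@itvco_sub RR).
by apply: le_trans (part K) _; rewrite lee_fin.
Qed.

Definition phi (p : RR) (w : RR -> RR) (r : RR) : RR :=
  (1 - r) `^ (2 - p^-1) / omega_hat w r `^ p^-1.

Definition phi_bounded (p : RR) (w : RR -> RR) : Prop :=
  exists B : RR, forall r, 0 <= r < 1 -> phi p w r <= B.

(** For p <= 1/2 the exponent 2 - 1/p is nonpositive, so phi >= W^(-1/p), which is unbounded because
    W takes arbitrarily small values. *)
Lemma phi_bounded_half p w : 0 < p < 1 -> radial_weight w -> phi_bounded p w -> 1 / 2 < p.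
Proof.
move=> /andP[p0 p1] hw [B hB]; rewrite ltNge; apply/negP => hp.
have [_ _ W0] := hw.
have e0 : 2 - p^-1 <= 0.
  by rewrite subr_le0 -[X in X <= _]invrK lef_pV2 ?posrE ?invr_gt0//; lra.
have B1 : 0 < Num.max B 1 by rewrite lt_max ltr01 orbT.
pose c := ((Num.max B 1)^-1) `^ p.
have c0 : 0 < c by rewrite powR_gt0// invr_gt0.
have [s hs hWs] := omega_hat_small hw c0.
have := hB s hs; rewrite /phi ler_pdivrMr ?powR_gt0 ?W0// => h.
have /andP[s0 s1] := hs.
have one : 1 <= (1 - s) `^ (2 - p^-1).
  have s1' : 0 < 1 - s <= 1 by lra.
  by have := ger_powR s1' e0; rewrite powRr0.
have WB : (Num.max B 1)^-1 <= omega_hat w s `^ p^-1.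
  rewrite -div1r ler_pdivrMr// mulrC; apply: le_trans one _; apply: le_trans h _.
  by apply: ler_wpM2r; [exact: powR_ge0|rewrite le_max lexx].
have := powR_le p0 (_ : 0 <= (Num.max B 1)^-1) WB; rewrite invr_ge0 => /(_ (ltW B1)).
rewrite -powRrM mulVf ?gt_eqF// powRr1 ?(ltW (W0 _ hs))// -/c => cW.
by move: (le_lt_trans cW hWs); rewrite ltxx.
Qed.

Lemma phi_bounded_dcoef p w : 0 < p < 1 -> radial_weight w -> phi_bounded p w ->
  exists2 C : RR, 0 <= C & forall f, in_Dp p w f ->
    forall K, \sum_(k < K) 4 ^- k * dcoef (cderiv f) p k <= C * norm_Dp p w f.
Proof.
move=> hp hw hphi; have hp2 := phi_bounded_half hp hw hphi.
have [p0 p1] := andP hp; have [B hB] := hphi; have [w0 _ _] := hw.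
have [c c0 hc] := omega_hat_dyad_ge hw p0 hB.
have [kap k0 hpol] := dirichlet_integral_polar.
pose C1 := (64 / ((1 - dratio p) * c)) `^ p^-1.
have C10 : 0 <= C1 by exact: powR_ge0.
exists (C1 * (kap^-1) `^ p^-1); first by rewrite mulr_ge0// powR_ge0.
move=> f [af Df] K; have hp3 : 1 / 2 < p < 1 by rewrite hp2 p1.
have hp01 : 0 < p <= 1 by rewrite p0 ltW.
have D0 := dirichlet_integral_ge0 p f w0.
pose S := kap^-1 * fine (dirichlet_integral p w f).
have DE : (dirichlet_integral p w f = (fine (dirichlet_integral p w f))%:E)%E.
  by rewrite fineK// ge0_fin_numE.
have hS : (\int[leb]_(x in [set` `[(0:RR)%R, 1%R[%R]) (pmean (cderiv f) p x * w x * x)%:E <= S%:E)%E.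
  rewrite /S EFinM -DE (hpol f p w af hp01 (weight_measurable hw) w0) muleA -EFinM.
  by rewrite mulVf ?gt_eqF// mul1e.
apply: le_trans (sum_dcoef_le hw hp3 c0 hc (cderiv_analytic af) hS K) _.
rewrite -/C1 -mulrA; apply: ler_wpM2l C10 _ _ _.
rewrite /S powRM ?invr_ge0 ?(ltW k0) ?fine_ge0//.
by apply: ler_wpM2l; [exact: powR_ge0|exact: norm_Dp_ge_dirichlet].
Qed.

Lemma phi_bounded_Tid p w : 0 < p < 1 -> radial_weight w -> phi_bounded p w -> T_Dp_Hinf p w id.
Proof.
move=> hp hw hphi; have [C C0 hC] := phi_bounded_dcoef hp hw hphi; have [w0 _ _] := hw.
have hp2 := phi_bounded_half hp hw hphi; have [p0 p1] := andP hp.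
have hp4 : 1 / 2 <= p <= 1 by lra.
split; first by apply: analytic_disc_hol => z _; exists 1; exact: has_cderiv_id.
exists (1 + C) => f hf z z1; have [af _] := hf.
have hB k y : cabs y <= dyad RR k.+1 -> cabs (cderiv f y) <= dcoef (cderiv f) p k.
  exact: cabs_le_pmean (cderiv_analytic af) hp4.
apply: le_trans (Tg_id_le af hB (hC f hf) z1) _.
by rewrite mulrDl mul1r lerD2r norm_Dp_ge_at0.
Qed.

Lemma phi_bounded_embedding p w : 0 < p < 1 -> radial_weight w -> phi_bounded p w ->
  identity_bounded_Dp_D10 p w.
Proof.
move=> hp hw hphi; have [C C0 hC] := phi_bounded_dcoef hp hw hphi; have [w0 _ _] := hw.
have hp2 := phi_bounded_half hp hw hphi; have [p0 p1] := andP hp.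
have [kap k0 hpol] := dirichlet_integral_polar.
have m1 : meas01 omega_one by exact: measurable_cst.
have h1 : 0 < (1 : RR) <= 1 by rewrite ltr01 lexx.
have o0 r : 0 <= r < 1 -> 0 <= omega_one r by move=> _; exact: ler01.
exists (kap * C + 1) => f hf; have [af _] := hf.
have hp3 : 1 / 2 <= p < 1 by lra.
have le := pmean1_integral_le (cderiv_analytic af) hp3 (hC f hf).
have D1 : (dirichlet_integral 1%R omega_one f <= (kap * (C * norm_Dp p w f))%:E)%E.
  by rewrite (hpol f 1 _ af h1 m1 o0) EFinM lee_wpmul2l// lee_fin ltW.
have D0 := dirichlet_integral_ge0 1 f o0.
have Dfin : (dirichlet_integral 1%R omega_one f < +oo)%E by apply: le_lt_trans D1 (ltry _).
split; first by split.
rewrite /norm_Dp invr1 powRr1; last by rewrite addr_ge0 ?powR_ge0 ?fine_ge0.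
rewrite powRr1 ?cabs_ge0// mulrDl mul1r; apply: lerD; last exact: norm_Dp_ge_at0.
by rewrite -mulrA -lee_fin fineK// ge0_fin_numE.
Qed.

(** * Test functions *)

Definition testfun (a : CC) (n : nat) (z : CC) : CC := ((1 - cconj a * z) ^+ n.+1)^-1.

Lemma cabs_1B_ge (u : CC) : 1 - cabs u <= cabs (1 - u).
Proof. by rewrite -[X in X - _ <= _]cabs1; exact: cabs_leB. Qed.

Lemma test_base_ge (a z : CC) : 1 - cabs a * cabs z <= cabs (1 - cconj a * z).
Proof. by have := cabs_1B_ge (cconj a * z); rewrite cabsM cabs_conj. Qed.

Lemma mul_cabs_lt1 (a z : CC) : cabs a < 1 -> cabs z <= 1 -> cabs a * cabs z < 1.
Proof.
move=> a1 z1; apply: le_lt_trans a1; rewrite -[X in _ <= X]mulr1.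
by apply: ler_wpM2l z1; exact: cabs_ge0.
Qed.

Lemma test_base_neq0 (a z : CC) : cabs a < 1 -> cabs z < 1 -> 1 - cconj a * z != 0.
Proof.
move=> a1 z1; rewrite -cabs_gt0; apply: lt_le_trans (test_base_ge _ _).
by rewrite subr_gt0; exact: mul_cabs_lt1 (ltW z1).
Qed.

Lemma test_deriv_identity (K : fieldType) (u v b N : K) : u != 0 -> v != 0 ->
  N * b / (u * (u * v)) = - (u * v) ^- 2 * (N * v * (0 - b * 1)).
Proof. by move=> u0 v0; field; rewrite u0 v0. Qed.

Lemma has_cderiv_test (a z : CC) n : cabs a < 1 -> cabs z < 1 ->
  has_cderiv (testfun a n) z (n.+1%:R * cconj a / (1 - cconj a * z) ^+ n.+2).
Proof.
move=> a1 z1; have u0 := test_base_neq0 a1 z1.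
have hb : has_cderiv (fun z => 1 - cconj a * z) z (0 - cconj a * 1).
  exact: has_cderivB (has_cderiv_cst 1 z) (has_cderivZ (cconj a) (has_cderiv_id z)).
have hX := has_cderiv_comp hb (has_cderivX (1 - cconj a * z) n.+1).
have hV := has_cderiv_comp hX (has_cderivV (expf_neq0 n.+1 u0)).
have -> : n.+1%:R * cconj a / (1 - cconj a * z) ^+ n.+2 =
  - ((1 - cconj a * z) ^+ n.+1) ^- 2 * (n.+1%:R * (1 - cconj a * z) ^+ n * (0 - cconj a * 1)).
  rewrite [_ ^+ n.+2]exprS [_ ^+ n.+1]exprS.
  exact: (test_deriv_identity _ _ u0 (expf_neq0 n u0)).
exact: hV.
Qed.

Lemma testfun_analytic a n : cabs a < 1 -> analytic_disc (testfun a n).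
Proof. by move=> a1; apply: analytic_disc_hol => z z1; eexists; exact: has_cderiv_test. Qed.

Lemma cabs_cderiv_test (a z : CC) n : cabs a < 1 -> cabs z < 1 ->
  cabs (cderiv (testfun a n) z) = n.+1%:R * cabs a / cabs (1 - cconj a * z) ^+ n.+2.
Proof.
move=> a1 z1; rewrite (has_cderivE (has_cderiv_test n a1 z1)).
rewrite !cabsM cabsV cabsX cabs_conj; congr (_ * _ / _).
have -> : (n.+1%:R : CC) = n.+1%:R%:C by rewrite rmorph_nat.
by rewrite cabsR_ge0.
Qed.

Lemma Re_cayley (z : CC) : z != 1 -> cRe ((1 + z) / (1 - z)) = (1 - cabs z ^+ 2) / cabs (1 - z) ^+ 2.
Proof.
move=> z1; have n0 : 0 < cabs (1 - z) by rewrite cabs_gt0 subr_eq0 eq_sym.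
have -> : (1 + z) / (1 - z) = (1 + z) * cconj (1 - z) * ((cabs (1 - z) ^+ 2)^-1)%:C.
  have c0 : cconj (1 - z) != 0 by rewrite -cabs_eq0 cabs_conj gt_eqF.
  have inv_id (K : fieldType) (x u v : K) : v != 0 -> x / u = x * v * (u * v)^-1.
    by move=> v0; rewrite -mulf_div mulfV ?mulr1.
  by rewrite fmorphV /= -mulc_conj; exact: inv_id.
rewrite cReM /= mulr0 subr0; congr (_ / _).
rewrite sqr_cabs cReM /=; case: z {z1 n0} => x y /=; ring.
Qed.

(** The Poisson kernel (1 - |z|^2) / |1 - z|^2 is the real part of (1 + z)/(1 - z), whose mean over
    a circle about 0 is its value 1 at the centre. *)
Lemma poisson_mean (b : CC) : cabs b < 1 ->
  mean (fun t => (cabs (1 - b * ecirc t) ^+ 2)^-1) = (1 - cabs b ^+ 2)^-1.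
Proof.
move=> b1.
have nz (z : CC) : cabs z < 1 -> z != 1.
  by move=> h; apply/eqP => e; move: h; rewrite e cabs1 ltxx.
have hol (z : CC) : cabs z < 1 -> exists d, has_cderiv (fun z => (1 + z) / (1 - z)) z d.
  move=> z1; have u0 : 1 - z != 0 by rewrite subr_eq0 eq_sym nz.
  eexists; apply: has_cderivM; first exact: has_cderivD (has_cderiv_cst 1 z) (has_cderiv_id z).
  exact: has_cderiv_comp (has_cderivB (has_cderiv_cst 1 z) (has_cderiv_id z)) (has_cderivV u0).
have cm : cmean (fun t => (1 + (0 + b * ecirc t)) / (1 - (0 + b * ecirc t))) = (1 + 0) / (1 - 0).
  apply: (circle_mean (F := fun z => (1 + z) / (1 - z))) => z; rewrite subr0 => hz.
  by apply: hol; exact: le_lt_trans b1.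
have b2 : 0 < 1 - cabs b ^+ 2 by rewrite subr_gt0 expr_lt1 ?cabs_ge0.
have := congr1 cRe cm; rewrite addr0 subr0 divr1 /= => cm1.
have E t : (cabs (1 - b * ecirc t) ^+ 2)^-1 =
    (1 - cabs b ^+ 2)^-1 * cRe ((1 + (0 + b * ecirc t)) / (1 - (0 + b * ecirc t))).
  rewrite add0r Re_cayley; last by apply: nz; rewrite cabs_mulcirc.
  by rewrite cabs_mulcirc mulKf// gt_eqF.
transitivity (mean (fun t => (1 - cabs b ^+ 2)^-1 * cRe ((1 + (0 + b * ecirc t)) / (1 - (0 + b * ecirc t))))).
  by congr mean; apply/funext => t; exact: E.
rewrite (@meanZ RR).
  by rewrite /mean cm1 mulr1.
move=> t; apply: ccont_Re.
have z1 : cabs (0 + b * ecirc t) < 1 by rewrite add0r cabs_mulcirc.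
have [d hd] := hol _ z1.
exact: ccont_comp hd (ccont_circle 0 b t).
Qed.

(** With q = (n+2)p >= 2, the power -q of |1 - conj(a) z| splits off the power -2. The rest is at
    most (1 - |a| x)^(2-q), and the mean of the power -2 is given by [poisson_mean], which is at
    most (1 - |a| x)^-1. *)
Lemma pmean_test_le (a : CC) n (p x : RR) : 0 < p <= 1 -> 2 <= n.+2%:R * p -> cabs a < 1 -> 0 <= x < 1 ->
  pmean (cderiv (testfun a n)) p x <= n.+1%:R `^ p * (1 - cabs a * x) `^ (1 - n.+2%:R * p).
Proof.
move=> hp hq a1 /andP[x0 x1]; have p0 : 0 < p by case/andP: hp.
set q := n.+2%:R * p in hq *.
set dl := 1 - cabs a * x.
have ax : cabs a * x < 1.
  by have := mul_cabs_lt1 (z := x%:C) a1; rewrite cabsR_ge0// => ->//; exact: ltW.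
have ax0 : 0 <= cabs a * x by rewrite mulr_ge0 ?cabs_ge0.
have dl0 : 0 < dl by rewrite subr_gt0.
have xc t : cabs (x%:C * ecirc t) = x by rewrite cabs_mulcirc cabsR_ge0.
have xc1 t : cabs (x%:C * ecirc t) < 1 by rewrite xc.
have uge t : dl <= cabs (1 - cconj a * (x%:C * ecirc t)).
  by have := test_base_ge a (x%:C * ecirc t); rewrite xc.
have pt t : cabs (cderiv (testfun a n) (x%:C * ecirc t)) `^ p <=
    n.+1%:R `^ p * dl `^ (2 - q) * (cabs (1 - (cconj a * x%:C) * ecirc t) ^+ 2)^-1.
  rewrite (cabs_cderiv_test n a1 (xc1 t)) -mulrA; move: (uge t); rewrite mulrA.
  move: (cabs (1 - _)) => u du; have u0 : 0 < u := lt_le_trans dl0 du.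
  have n0 : 0 <= n.+1%:R :> RR by exact: ler0n.
  have u2 : 0 <= u ^- n.+2 by rewrite invr_ge0 exprn_ge0// ltW.
  apply: (@le_trans _ _ ((n.+1%:R / u ^+ n.+2) `^ p)).
    apply: powR_le => //.
      exact: mulr_ge0 n0 (mulr_ge0 (cabs_ge0 _) u2).
    apply: ler_wpM2l n0 _ _ _; rewrite -[X in _ <= X]mul1r; exact: ler_wpM2r u2 _ _ (ltW a1).
  rewrite (powRM _ n0 u2) -mulrA; apply: ler_wpM2l; first exact: powR_ge0.
  have -> : (u ^- n.+2) `^ p = u `^ (2 - q) * u ^- 2.
    rewrite powRV ?exprn_ge0 ?(ltW u0)// -(powR_mulrn _ (ltW u0)) -(powR_mulrn 2 (ltW u0)) -powRrM -/q.
    by rewrite -!powRN -powRD ?(gt_eqF u0) ?implybT//; congr (_ `^ _); lra.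
  apply: ler_wpM2r; first by rewrite invr_ge0 exprn_ge0// ltW.
  have -> : 2 - q = - (q - 2) by rewrite opprB.
  rewrite !powRN lef_pV2 ?posrE ?powR_gt0//.
  have [->|q2] := eqVneq (q - 2) 0; first by rewrite !powRr0.
  by apply: powR_le (ltW dl0) du; rewrite lt_neqAle eq_sym q2 subr_ge0.
have cb : cabs (cconj a * x%:C) = cabs a * x by rewrite cabsM cabs_conj cabsR_ge0.
have cont2 : continuous (fun t => (cabs (1 - (cconj a * x%:C) * ecirc t) ^+ 2)^-1).
  have -> : (fun t => (cabs (1 - (cconj a * x%:C) * ecirc t) ^+ 2)^-1) =
            (fun t => cabs ((1 - (0 + (cconj a * x%:C) * ecirc t))^-1) * cabs ((1 - (0 + (cconj a * x%:C) * ecirc t))^-1)).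
    by apply/funext => t; rewrite add0r cabsV expr2 invfM.
  move=> t; have cc : ccont (fun t => (1 - (0 + (cconj a * x%:C) * ecirc t))^-1) t.
    have nz : 1 - (0 + cconj a * x%:C * ecirc t) != 0.
      by rewrite add0r -mulrA; exact: test_base_neq0 a1 (xc1 t).
    exact: ccont_comp (has_cderivV nz) (ccontB (ccont_cst 1 t) (ccont_circle 0 (cconj a * x%:C) t)).
  exact: (@contM_at RR _ _ t (ccont_cabs cc) (ccont_cabs cc)).
apply: (@le_trans _ _ (mean (fun t => n.+1%:R `^ p * dl `^ (2 - q) * (cabs (1 - (cconj a * x%:C) * ecirc t) ^+ 2)^-1))).
  apply: (@le_mean RR) => //; last exact: (@continuous_Ml RR).
  apply: cont_pmean => //; last by rewrite cabsR_ge0.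
  by apply: cderiv_analytic; exact: testfun_analytic.
rewrite (@meanZ RR)// poisson_mean ?cb// -mulrA; apply: ler_wpM2l; first exact: powR_ge0.
have -> : dl `^ (1 - q) = dl `^ (2 - q) * dl^-1.
  rewrite -powR_inv1 ?(ltW dl0)// -powRD ?(gt_eqF dl0) ?implybT//; congr (_ `^ _); lra.
apply: ler_wpM2l; first exact: powR_ge0.
rewrite lef_pV2 ?posrE//; last by rewrite subr_gt0 expr_lt1.
by rewrite lerD2l lerN2 expr2 -[X in _ <= X]mulr1 ler_wpM2l// ltW.
Qed.

(** The choice of n: the first condition is the one of [pmean_test_le]; the second, with C the
    doubling constant, is the one of [radial_test_integral] for s = (n+2)p - 1. *)
Lemma exists_geometric_small (R : realType) (C p : R) : 0 < p ->
  exists n : nat, 2 <= n.+2%:R * p /\ (2 / 3) `^ (n.+2%:R * p - 1) * C <= 1 / 2.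
Proof.
move=> p0; pose x : R := (2 / 3) `^ p.
have x0 : 0 < x by rewrite powR_gt0//; lra.
have x1 : `|x| < 1.
  rewrite gtr0_norm//; have <- : 1 `^ p = (1 : R) by rewrite powR1.
  by apply: gt0_ltr_powR; rewrite ?nnegrE//; lra.
have e0 : 0 < (3 * (`|C| + 1))^-1 by rewrite invr_gt0 mulr_gt0// ltr_wpDl.
have /cvgrPdist_lt/(_ _ e0)[N _ HN] := @cvg_expr R x x1.
pose n := maxn N (Num.truncn (2 / p)).+1; exists n.
have n1 : 2 <= n.+2%:R * p.
  rewrite -ler_pdivrMr//; apply: le_trans (ltW (truncnS_gt (2 / p))) _.
  by rewrite ler_nat !leqW// leq_max leqnn orbT.
split=> //.
have hN : x ^+ n.+2 < (3 * (`|C| + 1))^-1.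
  have := HN n.+2 (_ : (N <= n.+2)%N); rewrite !leqW ?leq_maxl// => /(_ isT).
  by rewrite sub0r normrN gtr0_norm// exprn_gt0.
have xE : (2 / 3) `^ (n.+2%:R * p - 1) = x ^+ n.+2 * (3 / 2).
  rewrite powRB; last by apply/implyP => _; apply: lt0r_neq0; lra.
  rewrite powRr1; last by lra.
  rewrite mulrC [_ * p]mulrC powRrM powR_mulrn ?powR_ge0// mulrC; congr (_ * _); by rewrite invf_div.
rewrite xE; have C1 : 0 < `|C| + 1 by rewrite ltr_wpDl.
have h : x ^+ n.+2 * (3 * (`|C| + 1)) <= 1 by rewrite -ler_pdivlMr ?mulr_gt0// div1r ltW.
have y0 : 0 < x ^+ n.+2 by rewrite exprn_gt0.
have := ler_wpM2l (ltW y0) (ler_norm C); have := ler_norm C.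
move: h y0 C1; move: (x ^+ _) `|C| => y c h y0 C1; nra.
Qed.

Lemma measurable_affine_powR (R : realType) (a s : R) :
  @measurable_fun _ _ (measurableTypeR R) (measurableTypeR R) setT (fun x => (1 - a * x) `^ s).
Proof.
apply: (measurableT_comp (measurable_powR s)); exact: measurable_funB.
Qed.

Lemma affine_gt0 (R : realType) (a x : R) : 0 <= a < 1 -> 0 <= x < 1 -> 0 < 1 - a * x.
Proof. by move=> ha hx; nra. Qed.

Lemma powRN_anti (R : realType) (u v s : R) : 0 <= s -> 0 < u -> u <= v -> v `^ (- s) <= u `^ (- s).
Proof.
move=> s0 u0 uv; have v0 := lt_le_trans u0 uv; rewrite !powRN lef_pV2 ?posrE ?powR_gt0//.
have [->|sn] := eqVneq s 0; first by rewrite !powRr0.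
by apply: powR_le (ltW u0) uv; rewrite lt_neqAle eq_sym sn.
Qed.

Lemma le_weight_integral (w m : RR -> RR) (D : set RR) (c : RR) :
  @measurable _ (measurableTypeR RR) D -> D `<=` `[0, 1[%classic ->
  meas01 w -> (forall r, 0 <= r < 1 -> 0 <= w r) -> meas01 m -> 0 <= c ->
  (forall x, D x -> 0 <= m x <= c) ->
  (\int[leb]_(x in D) (m x * w x)%:E <= c%:E * \int[leb]_(x in D) (w x)%:E)%E.
Proof.
move=> mD D01 mw w0 mm c0 cm.
have w0D x : D x -> 0 <= w x by move=> /D01 /=; rewrite in_itv /=; exact: w0.
have mwD : @measurable_fun _ _ (measurableTypeR RR) (measurableTypeR RR) D w.
  by apply: measurable_funS mw => //; exact: measurable_itv.
have mmD : @measurable_fun _ _ (measurableTypeR RR) (measurableTypeR RR) D m.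
  by apply: measurable_funS mm => //; exact: measurable_itv.
rewrite -ge0_integralZl_EFin//.
- apply: ge0_le_integral => //.
  + by move=> x Dx; have /andP[h _] := cm x Dx; rewrite lee_fin mulr_ge0 ?w0D.
  + by apply/measurable_EFinP; exact: (@measurable_funM _ _ RR).
  + by apply: emeasurable_funM => //; apply/measurable_EFinP.
  + by move=> x Dx; have /andP[_ h] := cm x Dx; rewrite -EFinM lee_fin ler_wpM2r ?w0D.
- exact/measurable_EFinP.
Qed.

(* On [x <= b = 2a - 1] one has 1 - a x >= (3/4) (1 - b x) although 1 - b = 2 (1 - a); this gain
   lets the next induction absorb the constant of the doubling condition. *)
Lemma affine_powR_halving (R : realType) (a b x s : R) : 0 <= s -> b = 2 * a - 1 -> 0 <= b -> a < 1 ->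
  0 <= x <= b -> (1 - a * x) `^ (- s) <= (4 / 3) `^ s * (1 - b * x) `^ (- s).
Proof.
move=> s0 bE b0 a1 hx.
have bx : 0 < 1 - b * x by nra.
have p1 : (0 : R) < 4 / 3 by lra.
have p2 : (0 : R) < 3 / 4 by lra.
have -> : (4 / 3) `^ s = (3 / 4) `^ (- s) :> R.
  by rewrite powRN -powRV ?(ltW p2)// invf_div.
rewrite -(powRM _ (ltW p2) (ltW bx)).
by apply: powRN_anti => //; [rewrite mulr_gt0|nra].
Qed.

(** Each summand takes half of the right side: in the first, (4/3)^s and 1 - b = 2 (1 - a) combine
    to (2/3)^s, which together with Wb <= C Wa gives (2/3)^s C <= 1/2; in the second, 2^s >= 2. *)
Lemma halving_estimate (R : realType) (C s a b Wa Wb : R) : 1 <= C -> 1 <= s -> (2 / 3) `^ s * C <= 1 / 2 ->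
  b = 2 * a - 1 -> a < 1 -> 0 < Wa -> 0 < Wb -> Wb <= C * Wa ->
  (4 / 3) `^ s * (2 `^ s * C * Wb * (1 - b) `^ (- s)) + (1 - a) `^ (- s) * (C * Wa) <=
  2 `^ s * C * Wa * (1 - a) `^ (- s).
Proof.
move=> C1 s1 hs -> a1 Wa0 Wb0 WbC.
have p23 : (0 : R) <= 2 / 3 by lra.
have a0 : 0 <= 1 - a by lra.
have -> : 1 - (2 * a - 1) = 2 * (1 - a) by ring.
rewrite (powRM _ (ler0n R 2) a0).
have E : (4 / 3) `^ s * (2 `^ (- s)) = (2 / 3) `^ s :> R.
  have -> : (4 / 3 : R) = (2 / 3) * 2 by lra.
  by rewrite (powRM _ p23 (ler0n R 2)) powRN mulfK// gt_eqF// powR_gt0.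
have ts2 : 2 <= 2 `^ s :> R.
  by rewrite -[X in X <= _]powRr1// ler_powR// ler1n.
have t0 : 0 <= (1 - a) `^ (- s) by exact: powR_ge0.
have q0 : 0 <= (2 / 3) `^ s :> R by exact: powR_ge0.
move: E; move: ((4 / 3) `^ s) (2 `^ (- s)) => u v E.
rewrite (_ : u * _ = 2 `^ s * (1 - a) `^ (- s) * ((u * v) * C) * Wb); last by ring.
rewrite E; move: hs q0 ts2 t0; move: ((2 / 3) `^ s) (2 `^ s) ((1 - a) `^ (- s)) => q T z hs q0 T2 z0.
have Tz : 0 <= T * z by rewrite mulr_ge0//; lra.
have CW : 0 <= C * Wa by rewrite mulr_ge0//; lra.
have st1 : T * z * (q * C) * Wb <= T * z * (1 / 2) * (C * Wa).
  apply: ler_pM => //; [|exact: ltW|exact: ler_wpM2l].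
  by apply: mulr_ge0 => //; apply: mulr_ge0 => //; lra.
have st2 : 0 <= z * (C * Wa) * (T / 2 - 1).
  by apply: mulr_ge0; [exact: mulr_ge0|lra].
by apply: le_trans (lerD st1 (lexx _)) _; rewrite -subr_ge0; apply: le_trans st2 _; rewrite le_eqVlt; apply/orP; left; apply/eqP; field.
Qed.

(** Induction on the dyadic size of 1 - a, passing from a to b = 2a - 1. As (1 + b)/2 = a, doubling
    gives W(b) <= C W(a). On [b, 1) the power is at most (1 - a)^(-s); on [0, b) it is compared with
    the power for b, to which the induction hypothesis applies. *)
Lemma radial_test_integral (w : RR -> RR) (C s : RR) : radial_weight w -> 1 <= C ->
  (forall r, 0 <= r < 1 -> omega_hat w r <= C * omega_hat w ((1 + r) / 2)) ->
  1 <= s -> (2 / 3) `^ s * C <= 1 / 2 -> forall a, 0 <= a < 1 ->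
  (\int[leb]_(x in [set` `[(0:RR)%R, 1%R[%R]) ((1 - a * x) `^ (- s) * w x)%:E <=
   (2 `^ s * C * omega_hat w a * (1 - a) `^ (- s))%:E)%E.
Proof.
move=> hw C1 hD s1 hs; have [w0 _ W0] := hw; have mw := weight_measurable hw.
have s0 : 0 <= s by lra.
have h0 : 0 <= (0 : RR) < 1 by rewrite lexx ltr01.
have mI : @measurable _ (measurableTypeR RR) `[0, 1[ by exact: measurable_itv.
have mm a : meas01 (fun x => (1 - a * x) `^ (- s)).
  exact: (measurable_funS measurableT (@subsetT _ _) (@measurable_affine_powR RR a (- s))).
have mmw a : @measurable_fun _ _ (measurableTypeR RR) _ `[0, 1[%classic (fun x => ((1 - a * x) `^ (- s) * w x)%:E).
  by apply/measurable_EFinP; apply: (@measurable_funM _ _ RR); [exact: mm|exact: mw].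
have ts : 0 < 2 `^ s :> RR by rewrite powR_gt0.
have ts2 : 2 <= 2 `^ s :> RR by rewrite -[X in X <= _]powRr1// ler_powR//; lra.
(* For a <= 1/2 the power is at most 2^s, and W(0) <= C W(1/2) <= C W(a). *)
have base a : 0 <= a < 1 -> a <= 1 / 2 ->
    (\int[leb]_(x in [set` `[(0:RR)%R, 1%R[%R]) ((1 - a * x) `^ (- s) * w x)%:E <=
    (2 `^ s * C * omega_hat w a * (1 - a) `^ (- s))%:E)%E.
  move=> ha a2; apply: (@le_trans _ _ ((2 `^ s)%:E * \int[leb]_(x in [set` `[(0:RR)%R, 1%R[%R]) (w x)%:E)%E).
    apply: (le_weight_integral mI (@subset_refl _ _) mw w0 (mm a) (ltW ts)).
    move=> x /=; rewrite in_itv /= => hx; rewrite powR_ge0 /=.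
    have -> : 2 `^ s = (1 / 2) `^ (- s) :> RR by rewrite powRN div1r powRV// invrK.
    by apply: powRN_anti => //; clear -ha a2 hx; nra.
  rewrite -(omega_hatE hw h0) -EFinM lee_fin -!mulrA; apply: ler_wpM2l; first exact: ltW.
  have W2 : omega_hat w 0 <= C * omega_hat w a.
    apply: le_trans (hD 0 h0) _; apply: ler_wpM2l; first by clear -C1; lra.
    by apply: omega_hat_mono hw _ _; clear -ha a2; lra.
  apply: le_trans W2 _; apply: ler_wpM2l; first by clear -C1; lra.
  rewrite -[X in X <= _]mulr1; apply: ler_wpM2l; first exact: ltW (W0 _ ha).
  have e1 : 1 `^ (- s) = (1 : RR) by rewrite powR1.
  rewrite -[X in X <= _]e1.
  by apply: powRN_anti => //; clear -ha; lra.
have main k a : 0 <= a < 1 -> 2 ^- k.+1 <= 1 - a ->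
    (\int[leb]_(x in [set` `[(0:RR)%R, 1%R[%R]) ((1 - a * x) `^ (- s) * w x)%:E <=
    (2 `^ s * C * omega_hat w a * (1 - a) `^ (- s))%:E)%E.
  elim: k a => [|k IH] a ha hk; first by apply: base => //; move: hk; rewrite expr1; clear; lra.
  have [a2|a2] := leP a (1 / 2); first exact: base.
  pose b := 2 * a - 1.
  have hb : 0 <= b < 1 by rewrite /b; clear -ha a2; lra.
  have hbk : 2 ^- k.+1 <= 1 - b by rewrite /b; move: hk; rewrite (half_powS RR k.+1); clear; lra.
  have ba : 0 <= b <= a by rewrite /b; clear -ha a2; lra.
  have a1 : a < 1 by case/andP: ha.
  have b1 : b < 1 by case/andP: hb.
  have f0 (x : RR) : 0 <= x < 1 -> (0 <= ((1 - a * x) `^ (- s) * w x)%:E)%E.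
    by move=> hx; rewrite lee_fin mulr_ge0 ?powR_ge0 ?w0.
  have mf := mmw a.
  have b0 : 0 <= b by case/andP: hb.
  rewrite (@ge0_integral_itvco_split RR 0 b 1 _ b0 (ltW b1) mf f0).
  have Wa := W0 _ ha; have Wb := W0 _ hb.
  have WbC : omega_hat w b <= C * omega_hat w a.
    by have := hD b hb; have -> : (1 + b) / 2 = a by rewrite /b; clear; lra.
  have dpos : 0 < 1 - a by clear -a1; lra.
  have part2 : (\int[leb]_(x in [set` `[b, 1%R[%R]) ((1 - a * x) `^ (- s) * w x)%:E <=
     ((1 - a) `^ (- s) * (C * omega_hat w a))%:E)%E.
    apply: (@le_trans _ _ (((1 - a) `^ (- s))%:E * \int[leb]_(x in [set` `[b, 1%R[%R]) (w x)%:E)%E).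
      apply: (le_weight_integral (D := [set` `[b, 1%R[%R]) _ _ mw w0 (mm a) (powR_ge0 _ _)).
      - exact: measurable_itv.
      - by apply: (@itvco_sub RR).
      - move=> x /=; rewrite in_itv /= => hx; rewrite powR_ge0 /=; apply: powRN_anti => //.
        by clear -hx ha; nra.
    rewrite -(omega_hatE hw hb) -EFinM lee_fin; apply: ler_wpM2l => //; exact: powR_ge0.
  have part1 : (\int[leb]_(x in [set` `[0%R, b[%R]) ((1 - a * x) `^ (- s) * w x)%:E <=
     ((4 / 3) `^ s * (2 `^ s * C * omega_hat w b * (1 - b) `^ (- s)))%:E)%E.
    rewrite EFinM; apply: (@le_trans _ _ (((4 / 3) `^ s)%:E *
       \int[leb]_(x in [set` `[(0:RR)%R, 1%R[%R]) ((1 - b * x) `^ (- s) * w x)%:E)%E); last first.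
      by apply: lee_wpmul2l (IH b hb hbk); rewrite lee_fin powR_ge0.
    have sub : [set` `[(0:RR), b[%R] `<=` [set` `[(0:RR), 1[%R] by apply: (@itvco_sub RR) => //; exact: ltW.
    have mg := mmw b.
    have g0 (x : RR) : 0 <= x < 1 -> (0 <= ((1 - b * x) `^ (- s) * w x)%:E)%E.
      by move=> hx; rewrite lee_fin mulr_ge0 ?powR_ge0 ?w0.
    rewrite -ge0_integralZl_EFin//.
    apply: (@le_trans _ _ (\int[leb]_(x in [set` `[0%R, b[%R]) (((4 / 3) `^ s)%:E * ((1 - b * x) `^ (- s) * w x)%:E))%E).
      apply: ge0_le_integral => //.
      - by move=> x /sub /=; rewrite in_itv /=; exact: f0.
      - by apply: measurable_funS mf => //; exact: measurable_itv.
      - by apply: emeasurable_funM => //; apply: measurable_funS mg => //; exact: measurable_itv.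
      - move=> x /= hx; have := sub _ hx; move: hx; rewrite /= !in_itv /= => hx hx1.
        rewrite -EFinM lee_fin mulrA; apply: ler_wpM2r; first exact: w0.
        by apply: (@affine_powR_halving RR) => //; case/andP: hx => -> /ltW ->.
    apply: ge0_subset_integral => //.
    - by apply: emeasurable_funM.
    - move=> x /=; rewrite in_itv /= => hx; rewrite mule_ge0 ?g0// lee_fin powR_ge0//.
  apply: le_trans (leeD part1 part2) _; rewrite -EFinD lee_fin.
  exact: (@halving_estimate RR).
move=> a ha; have /andP[_ a1] := ha; have [K hK] := dyad_ge a1.
apply: (main K a ha); rewrite half_powS; move: hK; rewrite /dyad; have := half_pow_gt0 RR K; clear; lra.
Qed.

Definition test_size (p : RR) (w : RR -> RR) (n : nat) (a : RR) : RR :=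
  omega_hat w a `^ p^-1 * (1 - a) `^ (p^-1 - n.+2%:R).

Lemma powRN_ge1 (R : realType) (u s : R) : 0 <= s -> 0 < u <= 1 -> 1 <= u `^ (- s).
Proof.
move=> s0 hu; rewrite -[X in X <= _](powRr0 u).
by apply: ger_powR => //; rewrite oppr_le0.
Qed.

Lemma powR_shift (R : realType) (u v : R) n : 0 < u ->
  u `^ (2 - v) = u ^- n * u `^ (n.+2%:R - v).
Proof.
move=> u0; have -> : u ^- n = u `^ (- n%:R) by rewrite powRN powR_mulrn// ltW.
rewrite -powRD; first by congr (_ `^ _); rewrite -addn2 natrD; ring.
by rewrite (gt_eqF u0) implybT.
Qed.

Lemma testfun0 a n : testfun a n 0 = 1.
Proof. by rewrite /testfun mulr0 subr0 expr1n invr1. Qed.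

Lemma testfun_norm p w : 0 < p < 1 -> radial_weight w -> Dhat w ->
  exists n, exists2 K : RR, 0 <= K & forall a : CC, cabs a < 1 ->
    in_Dp p w (testfun a n) /\ norm_Dp p w (testfun a n) <= K * test_size p w n (cabs a).
Proof.
move=> hp hw [C [C1 hD]]; have [p0 p1] := andP hp; have [w0 _ W0] := hw.
have hp01 : 0 < p <= 1 by rewrite p0 ltW.
have [n [hn hs]] := @exists_geometric_small RR C p p0.
have [kap k0 hpol] := dirichlet_integral_polar.
pose s := n.+2%:R * p - 1; have s1 : 1 <= s by rewrite /s; lra.
have sE : 1 - n.+2%:R * p = - s by rewrite /s opprB.
have h0 : 0 <= (0 : RR) < 1 by rewrite lexx ltr01.
have W00 := W0 0 h0.
pose E := 2 `^ s * C; have E0 : 0 <= E by rewrite mulr_ge0 ?powR_ge0//; lra.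
(* The second summand pays for the value 1 of the test function at 0, through W(0) <= E A. *)
pose K0 := kap * n.+1%:R `^ p * E + E / omega_hat w 0.
have np0 : 0 <= n.+1%:R `^ p :> RR by exact: powR_ge0.
have K00 : 0 <= K0.
  by apply: addr_ge0; [exact: mulr_ge0 (mulr_ge0 (ltW k0) np0) E0|exact: divr_ge0 E0 (ltW W00)].
exists n; exists (K0 `^ p^-1); first exact: powR_ge0.
move=> a a1; have a0 := cabs_ge0 a; have ha : 0 <= cabs a < 1 by rewrite a0.
have Wa := W0 _ ha; set A := omega_hat w (cabs a) * (1 - cabs a) `^ (- s).
have A0 : 0 <= A by rewrite mulr_ge0 ?powR_ge0// ltW.
have ana : analytic_disc (testfun a n) by exact: testfun_analytic.
have anad := cderiv_analytic ana.
have mw := weight_measurable hw.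
have m1 : meas01 (fun x => (1 - cabs a * x) `^ (- s)).
  exact: (measurable_funS measurableT (@subsetT _ _) (@measurable_affine_powR RR (cabs a) (- s))).
have m2 : @measurable_fun _ _ (measurableTypeR RR) _ `[0, 1[%classic
    (fun x => ((1 - cabs a * x) `^ (- s) * w x)%:E).
  by apply/measurable_EFinP; apply: (@measurable_funM _ _ RR); [exact: m1|exact: mw].
have mI : @measurable _ (measurableTypeR RR) `[0, 1[ by exact: measurable_itv.
have G := radial_test_integral hw C1 hD s1 hs ha.
have GE : 2 `^ s * C * omega_hat w (cabs a) * (1 - cabs a) `^ (- s) = E * A by rewrite mulrA.
rewrite GE in G; clearbody E.
have f0 (x : RR) : 0 <= x < 1 -> 0 <= (1 - cabs a * x) `^ (- s) * w x.
  by move=> hx; exact: mulr_ge0 (powR_ge0 _ _) (w0 _ hx).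
have DD : (dirichlet_integral p w (testfun a n) <= (kap * n.+1%:R `^ p * E * A)%:E)%E.
  rewrite (hpol _ p w ana hp01 mw w0) -!mulrA EFinM; apply: lee_wpmul2l; first by rewrite lee_fin ltW.
  rewrite EFinM; apply: (@le_trans _ _ ((n.+1%:R `^ p)%:E *
     \int[leb]_(x in [set` `[(0:RR)%R, 1%R[%R]) ((1 - cabs a * x) `^ (- s) * w x)%:E)%E); last first.
    by apply: lee_wpmul2l G; rewrite lee_fin.
  rewrite -ge0_integralZl_EFin//.
  apply: ge0_le_integral => //.
  - by move=> x /=; rewrite in_itv /= => hx; rewrite lee_fin weighted_pmean_ge0.
  - exact: measurable_weighted_pmean.
  - by apply: emeasurable_funM.
  - move=> x /=; rewrite in_itv /= => hx; have /andP[x0 x1] := hx.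
    rewrite -EFinM lee_fin mulrA; have := pmean_test_le hp01 hn a1 hx; rewrite sE => hpm.
    apply: (@le_trans _ _ (pmean (cderiv (testfun a n)) p x * w x)).
      rewrite -[X in _ <= X]mulr1; apply: ler_wpM2l (ltW x1).
      exact: mulr_ge0 (pmean_ge0 _ _ _) (w0 _ hx).
    exact: ler_wpM2r (w0 _ hx) _ _ hpm.
have D0 := dirichlet_integral_ge0 p (testfun a n) w0.
have Dfin : (dirichlet_integral p w (testfun a n) < +oo)%E by apply: le_lt_trans DD (ltry _).
split; first by split.
have WA : omega_hat w 0 <= E * A.
  rewrite -lee_fin (omega_hatE hw h0); apply: le_trans G; rewrite -[X in (X <= _)%E]mul1e.
  apply: (ge_const_weight_integral mI (@subset_refl _ _) mw w0 m1 ler01).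
  move=> x /=; rewrite in_itv /= => hx.
  apply: (@powRN_ge1 RR); first exact: le_trans ler01 s1.
  by rewrite (@affine_gt0 RR)//= lerBlDr lerDl; apply: mulr_ge0 => //; case/andP: hx.
have fD : fine (dirichlet_integral p w (testfun a n)) <= kap * n.+1%:R `^ p * E * A.
  by rewrite -lee_fin fineK// ge0_fin_numE.
have nrm : fine (dirichlet_integral p w (testfun a n)) + cabs (testfun a n 0) `^ p <= K0 * A.
  rewrite /K0 mulrDl; apply: lerD fD _.
  by rewrite testfun0 cabs1 powR1 mulrAC ler_pdivlMr// mul1r.
apply: le_trans (powR_le _ _ nrm) _; first by rewrite invr_gt0.
  by apply: addr_ge0; [rewrite fine_ge0|exact: powR_ge0].
rewrite (powRM _ K00 A0); apply: ler_wpM2l; first exact: powR_ge0.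
rewrite /A /test_size (powRM _ (ltW Wa) (powR_ge0 _ _)) -powRrM.
have -> : - s * p^-1 = p^-1 - n.+2%:R by rewrite -sE mulrBl mul1r mulfK// gt_eqF.
by [].
Qed.

(** For a >= 1/2 the hypothesis rearranges to phi(a) <= C / c. For r < 1/2 both 1 - r and W(r) are
    bounded below, and -|e| copes with either sign of the exponent e = 2 - 1/p. *)
Lemma phi_bounded_of_test p w n (C c : RR) : 0 < p < 1 -> radial_weight w -> 0 < c -> 0 <= C ->
  (forall a : RR, 1 / 2 <= a < 1 -> c * (1 - a) ^- n <= C * test_size p w n a) -> phi_bounded p w.
Proof.
move=> /andP[p0 p1] hw c0 C0 H; have [_ _ W0] := hw.
have pV : 0 < p^-1 by rewrite invr_gt0.
pose e := 2 - p^-1.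
have h2 : 0 <= (1 / 2 : RR) < 1 by lra.
pose B1 := 2^-1 `^ (- `|e|) / omega_hat w (1 / 2) `^ p^-1.
exists (Num.max B1 (C / c)) => r /andP[r0 r1]; rewrite le_max.
have hr : 0 <= r < 1 by rewrite r0.
have Wr := W0 _ hr.
have [r2|r2] := leP (1 / 2) r.
  apply/orP; right; rewrite /phi ler_pdivrMr ?powR_gt0//.
  have d0 : 0 < 1 - r by rewrite subr_gt0.
  have := H r (introT andP (conj r2 r1)); rewrite /test_size.
  have -> : (1 - r) `^ (2 - p^-1) = (1 - r) ^- n * (1 - r) `^ (n.+2%:R - p^-1).
    exact: (@powR_shift RR).
  have -> : p^-1 - n.+2%:R = - (n.+2%:R - p^-1) by rewrite opprB.
  rewrite powRN mulrA ler_pdivlMr ?powR_gt0// -mulrA => h.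
  by rewrite mulrAC ler_pdivlMr// mulrC.
apply/orP; left; rewrite /phi /B1.
have W2 := W0 _ h2.
apply: ler_pM; [exact: powR_ge0|by rewrite invr_ge0 powR_ge0| |].
  have d1 : 0 < 1 - r <= 1 by lra.
  apply: (@le_trans _ _ ((1 - r) `^ (- `|e|))).
    by apply: ger_powR => //; rewrite lerNl -normrN; exact: ler_norm.
  by apply: powRN_anti => //; lra.
rewrite lef_pV2 ?posrE; [|exact: powR_gt0|exact: powR_gt0].
apply: powR_le pV (ltW W2) _.
by apply: omega_hat_mono hw _ _; lra.
Qed.

(** * Consequences of boundedness *)

(** A point z of this box is within (1 - a)/4 of a, so |1 - a z| <= (1 - a^2) + a |z - a| <= 3 (1 -
    a). *)
Lemma cderiv_test_box_ge (a x y : RR) n : 1 / 2 <= a < 1 ->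
  a - (1 - a) / 8 <= x <= a + (1 - a) / 8 -> - ((1 - a) / 8) <= y <= (1 - a) / 8 ->
  cabs (x +i* y)%C < 1 /\
  1 / 2 / (3 * (1 - a)) ^+ n.+2 <= cabs (cderiv (testfun a%:C n) (x +i* y)%C).
Proof.
move=> ha hx hy; have a0 : 0 <= a by lra.
have ca : cabs a%:C = a by rewrite cabsR_ge0.
have ca1 : cabs a%:C < 1 by rewrite ca; lra.
have zE : (x +i* y)%C = a%:C + ((x - a) +i* y)%C :> CC.
  by congr Complex; [rewrite addrC subrK|rewrite add0r].
have wle : cabs ((x - a) +i* y)%C <= (1 - a) / 4.
  apply: le_trans (cabs_le_ReIm _) _ => /=.
  have h1 : `|x - a| <= (1 - a) / 8 by rewrite ler_norml; lra.
  have h2 : `|y| <= (1 - a) / 8 by rewrite ler_norml.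
  lra.
have z1 : cabs (x +i* y)%C < 1.
  rewrite zE; apply: le_lt_trans (cabsD _ _) _; rewrite ca; lra.
split=> //; rewrite (cabs_cderiv_test n ca1 z1) ca.
have ble : cabs (1 - cconj a%:C * (x +i* y)%C) <= 3 * (1 - a).
  have -> : 1 - cconj a%:C * (x +i* y)%C = (1 - a ^+ 2)%:C + - (a%:C * ((x - a) +i* y)%C).
    by rewrite zE; congr Complex => /=; ring.
  apply: le_trans (cabsD _ _) _; rewrite cabsN cabsM ca cabsR_ge0; last by nra.
  have := cabs_ge0 ((x - a) +i* y)%C; move: wle; move: (cabs _) => u; nra.
have u0 : 0 < cabs (1 - cconj a%:C * (x +i* y)%C) by rewrite cabs_gt0 test_base_neq0.
move: ble u0; move: (cabs (1 - _)) => u ble u0.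
have d0 : 0 < 3 * (1 - a) by lra.
apply: ler_pM; [by lra|by rewrite invr_ge0 exprn_ge0// ltW| |].
  have n1 : 1 <= n.+1%:R :> RR by rewrite ler1n.
  nra.
by rewrite lef_pV2 ?posrE ?exprn_gt0// lerXn2r// nnegrE ltW.
Qed.

(** The box has area (1 - a)^2 / 16 and the derivative is at least (1/2) (3 (1 - a))^-(n+2) on it;
    this accounts for the constant 1/32 / 3^(n+2). *)
Lemma dirichlet_test_ge (a : RR) n : 1 / 2 <= a < 1 ->
  ((1 / 32 / 3 ^+ n.+2 / pi * (1 - a) ^- n)%:E <= dirichlet_integral 1%R omega_one (testfun (a%:C)%R n))%E.
Proof.
move=> ha; have a0 : 0 <= a by lra.
have ca1 : cabs a%:C < 1 by rewrite cabsR_ge0//; lra.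
pose d := (1 - a) / 8; have d0 : 0 < d by rewrite /d; lra.
pose A : set (RR * RR) := [set` `[a - d, a + d]%R] `*` [set` `[- d, d]%R].
have pi0 : 0 < pi :> RR by exact: pi_gt0.
pose c := 1 / 2 / (3 * (1 - a)) ^+ n.+2 / pi.
have x0 : 0 < 1 - a by lra.
have c0 : 0 <= c.
  by apply: divr_ge0 (ltW pi0); apply: divr_ge0; [lra|apply: exprn_ge0; lra].
have areaE : (@plane_measure RR A = (2 * d * (2 * d))%:E)%E.
  by apply: etrans (@plane_measure_box RR _ _ _ _ _ _) _; [lra|lra|congr EFin; ring].
have cE : (1 / 32 / 3 ^+ n.+2 / pi * (1 - a) ^- n)%:E = (c%:E * @plane_measure RR A)%E.
  rewrite areaE -EFinM /c /d exprMn [(1 - a) ^+ n.+2]exprS [(1 - a) ^+ n.+1]exprS; congr EFin.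
  have v0 : (1 - a) ^+ n != 0 by rewrite expf_neq0// gt_eqF.
  have t0 : 3 ^+ n.+2 != 0 :> RR by rewrite expf_neq0.
  move: v0 t0 x0 pi0; move: (1 - a) (3 ^+ n.+2) => b t; move: (b ^+ n) (pi : RR) => v q v0 t0 b0 q0.
  by field; rewrite v0 t0 !gt_eqF.
rewrite cE.
have AD : A `<=` disc2.
  move=> [x y] [] /=; rewrite !in_itv /= => hx hy.
  have [z1 _] := cderiv_test_box_ge n ha hx hy.
  by rewrite /disc2 /= -cabs_lt1.
have mD : @measurable _ (measurableTypeR RR * measurableTypeR RR)%type disc2.
  rewrite (_ : disc2 = @rad RR @^-1` [set` `[0%R, 1%R[%R]); last first.
    by apply/seteqP; split => z; rewrite /disc2 /= in_itv /= rad_ge0 rad_lt// expr1n.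
  exact: (@measurable_gauge_ball RR _ (@measurable_rad RR)).
rewrite /dirichlet_integral.
apply: (@integral_ge_const _ _ RR (@plane_measure RR) A disc2) => //.
- exact: (@measurable_box RR).
- have h1 : 0 < (1 : RR) <= 1 by rewrite ltr01 lexx.
  have mx := measurable_disc_ext (cderiv_analytic (testfun_analytic (n := n) ca1)) h1.
  have my : @measurable_fun _ _ (measurableTypeR RR * measurableTypeR RR)%type (measurableTypeR RR) disc2
      (fun z => disc_ext (fun z => cabs (cderiv (testfun a%:C n) z) `^ 1) z * pi^-1).
    apply: (@measurable_funM _ _ RR); last exact: measurable_cst.
    exact: (measurable_funS measurableT (@subsetT _ _) mx).
  apply/measurable_EFinP; apply: eq_measurable_fun my => z /set_mem; rewrite /disc2 /= => hz.
  by rewrite /disc_ext hz mulr1.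
- move=> z _; rewrite lee_fin; apply: divr_ge0 (ltW pi0); rewrite mulr1; exact: powR_ge0.
- move=> [x y] [] /=; rewrite !in_itv /= => hx hy.
  have [_ h] := cderiv_test_box_ge n ha hx hy.
  rewrite lee_fin mulr1 powRr1 ?cabs_ge0//; apply: ler_wpM2r h.
  by rewrite invr_ge0 ltW.
Qed.

Lemma embedding_phi_bounded p w : 0 < p < 1 -> radial_weight w -> Dhat w ->
  identity_bounded_Dp_D10 p w -> phi_bounded p w.
Proof.
move=> hp hw hD [K hK]; have [n [C C0 hC]] := testfun_norm hp hw hD.
have pi0 : 0 < pi :> RR by exact: pi_gt0.
pose c : RR := 1 / 32 / 3 ^+ n.+2 / pi.
have c0 : 0 < c by rewrite !divr_gt0// exprn_gt0.
apply: (@phi_bounded_of_test p w n (Num.max K 0 * C) c) => //.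
  by rewrite mulr_ge0// le_max lexx orbT.
move=> a ha; have a0 : 0 <= a by lra.
have ca : cabs a%:C = a by rewrite cabsR_ge0.
have ca1 : cabs a%:C < 1 by rewrite ca; lra.
have [inD nD] := hC _ ca1; rewrite ca in nD.
have [[_ fin1] n1] := hK _ inD.
have o0 r : 0 <= r < 1 -> 0 <= omega_one r by move=> _; exact: ler01.
have lo := dirichlet_test_ge n ha.
have D0 := dirichlet_integral_ge0 1 (testfun a%:C n) o0.
have lo2 : c * (1 - a) ^- n <= fine (dirichlet_integral 1 omega_one (testfun a%:C n)).
  by rewrite -lee_fin fineK// ge0_fin_numE.
have := norm_Dp_ge_dirichlet (testfun a%:C n) ltr01 o0; rewrite invr1 powRr1 ?fine_ge0// => n2.
apply: le_trans lo2 _; apply: le_trans n2 _; apply: le_trans n1 _.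
have N0 : 0 <= norm_Dp p w (testfun a%:C n) by exact: powR_ge0.
rewrite -mulrA; apply: (@le_trans _ _ (Num.max K 0 * norm_Dp p w (testfun a%:C n))).
  by apply: ler_wpM2r N0 _ _ _; rewrite le_max lexx.
by apply: ler_wpM2l nD; rewrite le_max lexx orbT.
Qed.

(** * Vanishing order at the origin, and averages along rays *)

Lemma le_geometric_eq0 (R : realType) (y c x : R) : 0 <= y -> 0 <= x < 1 ->
  (forall N, y <= c * x ^+ N) -> y = 0.
Proof.
move=> y0 /andP[x0 x1] H; apply/eqP; rewrite eq_le y0 andbT; apply/ler_addgt0Pr => e e0; rewrite add0r.
have c1 : 0 < `|c| + 1 by rewrite ltr_wpDl.
have x1' : `|x| < 1 by rewrite ger0_norm.
have e1 : 0 < e / (`|c| + 1) by rewrite divr_gt0.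
have /cvgrPdist_lt/(_ _ e1)[N _ HN] := @cvg_expr R x x1'.
have := HN N (leqnn N); rewrite sub0r normrN ger0_norm ?exprn_ge0// ltr_pdivlMr// => h.
apply: le_trans (H N) _; apply: le_trans (ltW h); rewrite mulrC; apply: ler_wpM2l; first exact: exprn_ge0.
by apply: le_trans (ler_norm c) _; rewrite lerDl.
Qed.

Lemma pmean1_le_bound h (r M : RR) : analytic_disc h -> 0 <= r < 1 ->
  (forall t, cabs (h (r%:C * ecirc t)) <= M) -> pmean h 1 r <= M.
Proof.
move=> ah /andP[r0 r1] hM; apply: (@mean_le RR).
  by apply: cont_pmean => //; rewrite ?ltr01 ?lexx// cabsR_ge0.
by move=> t; rewrite powRr1 ?cabs_ge0.
Qed.

(** On a circle of radius r > |z| the quotient k is at most B / r^N, and [pointwise_pmean] with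
    exponent 1 carries this to z up to the factor 8/d. Hence |h z| <= (8B/d) (|z|/r)^N for every
    N. *)
Lemma analytic_eq0_of_divisible h : analytic_disc h ->
  (forall N, exists2 k, analytic_disc k & forall z, h z = z ^+ N * k z) ->
  forall z, cabs z < 1 -> h z = 0.
Proof.
move=> ah H z z1; apply/eqP; rewrite -cabs_eq0; apply/eqP.
have z0 := cabs_ge0 z.
pose d := (1 - cabs z) / 2; have d0 : 0 < d by rewrite /d; lra.
pose r := cabs z + d.
have r0 : 0 < r by rewrite /r; lra.
have r1 : r < 1 by rewrite /r /d; lra.
have [B [B0 hB]] := analytic_bounded ah (introT andP (conj (ltW r0) r1)).
have zr : cabs z < r by rewrite /r; lra.
apply: (@le_geometric_eq0 RR _ (8 * B / d) (cabs z / r)); first exact: cabs_ge0.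
  by rewrite divr_ge0 ?(ltW r0)//= ltr_pdivrMr// mul1r.
move=> N; have [k ak hk] := H N.
have kB t : cabs (k (r%:C * ecirc t)) <= B / r ^+ N.
  rewrite ler_pdivlMr ?exprn_gt0// mulrC.
  have cr : cabs (r%:C * ecirc t) = r by rewrite cabs_mulcirc cabsR_ge0// ltW.
  by rewrite -[X in X ^+ N * _]cr -cabsX -cabsM -hk; apply: hB; rewrite cr.
have pk := pmean1_le_bound ak (introT andP (conj (ltW r0) r1)) kB.
have q1 : 1 / 2 <= (1 : RR) <= 1 by lra.
have := pointwise_pmean ak q1 d0 (r1 : cabs z + d < 1); rewrite powRr1 ?cabs_ge0// -/r => kz.
rewrite hk cabsM cabsX expr_div_n mulrCA -[X in X <= _]mulr1 -!mulrA; apply: ler_wpM2l.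
  exact: exprn_ge0.
rewrite mulr1; apply: le_trans kz _; rewrite -!mulrA; apply: ler_wpM2l => //.
by rewrite [X in _ <= X]mulrCA mulrC; apply: ler_wpM2l => //; rewrite invr_ge0 ltW.
Qed.

(** If every quotient vanished at 0, another factor z could be split off each time, and h would be
    divisible by all powers of z. *)
Lemma analytic_factor h : analytic_disc h -> ~ (forall z, cabs z < 1 -> h z = 0) ->
  exists N k, [/\ analytic_disc k, forall z, h z = z ^+ N * k z & k 0 != 0].
Proof.
move=> ah hn; apply: contrapT => H; apply: hn; apply: analytic_eq0_of_divisible => //.
elim=> [|N [k ak hk]]; first by exists h => // z; rewrite expr0 mul1r.
have k0 : k 0 = 0.
  by apply/eqP/negPn/negP => k0; apply: H; exists N, k.
have [k' [ak' hk']] := analytic_div_id ak k0.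
by exists k' => // z; rewrite hk hk' exprSr mulrA.
Qed.

Lemma constant_of_cderiv0 g : analytic_disc g -> (forall z, cabs z < 1 -> cderiv g z = 0) ->
  forall z, cabs z < 1 -> g z = g 0.
Proof.
move=> ag g0 z z1.
suff : cabs (g z - g 0) <= 0 * cabs (z - 0).
  by rewrite mul0r => h; apply/eqP; rewrite -subr_eq0 -cabs_eq0 eq_le h cabs_ge0.
apply: cderiv_mvt => t t01.
have hz : cabs (0 + t%:C * (z - 0)) < 1.
  by apply: le_lt_trans z1; apply: cabs_segment => //; rewrite cabs0 cabs_ge0.
exists (cderiv g (0 + t%:C * (z - 0))); first exact: analyticP ag hz.
by rewrite (g0 _ hz) cabs0.
Qed.

Lemma mean_abs_le (R : realType) (u : R -> R) (Q : R) : continuous u -> (forall t, `|u t| <= Q) -> `|mean u| <= Q.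
Proof.
move=> cu uQ; apply: le_trans (_ : Q * (1 - 0) <= _); last by rewrite subr0 mulr1.
by apply: rint_abs_le => // t _; exact: cu.
Qed.

Definition clamp (R : realType) (t : R) : R := Num.max 0 (Num.min t 1).

Lemma clamp01 (R : realType) (t : R) : 0 <= clamp t <= 1.
Proof. by rewrite /clamp le_max lexx /= ge_max ler01 ge_min lexx orbT. Qed.

Lemma clamp_id (R : realType) (t : R) : 0 <= t <= 1 -> clamp t = t.
Proof. by move=> /andP[t0 t1]; rewrite /clamp min_l// max_r. Qed.

Lemma clampE (R : realType) (t : R) : clamp t = if t <= 0 then 0 else if t <= 1 then t else 1.
Proof.
rewrite /clamp; case: ifP => [t0|/negbT]; first by rewrite min_l ?max_l//; lra.
rewrite -ltNge => t0; case: ifP => [t1|/negbT]; first by rewrite min_l ?max_r//; lra.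
by rewrite -ltNge => t1; rewrite min_r ?max_r//; lra.
Qed.

Lemma clamp_lip (R : realType) (t h : R) : `|clamp (t + h) - clamp t| <= `|h|.
Proof.
have nh := ler_norm h; have nh' := ler_norm (- h); rewrite normrN in nh'.
rewrite !clampE ler_norml.
case: ifP => [?|/negbT]; last rewrite -ltNge => ?; last case: ifP => [?|/negbT]; last rewrite -ltNge => ?;
  (case: ifP => [?|/negbT]; last rewrite -ltNge => ?; last case: ifP => [?|/negbT]; last rewrite -ltNge => ?);
  lra.
Qed.

Lemma continuous_clamp (R : realType) : continuous (@clamp R).
Proof.
move=> t; apply: continuous_eps => e e0; exists e => // h he; apply: le_lt_trans he.
exact: clamp_lip.
Qed.

(* Averaging over s replaces k by k(0). The clamp extends the integrand continuously to all t, as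
   [mean_swap] demands. *)
Lemma mean_ray_average (k : CC -> CC) (A : RR -> CC) (a M Q : RR) : analytic_disc k -> 0 <= a < 1 ->
  (forall t, ccont A t) -> (forall t, cabs (A t) <= M) ->
  (forall s, `|mean (fun t => cRe (A t * k ((clamp t * a)%:C * ecirc s)))| <= Q) ->
  `|mean (fun t => cRe (A t * k 0))| <= Q.
Proof.
move=> ak /andP[a0 a1] cA AM hQ.
have M0 : 0 <= M := le_trans (cabs_ge0 _) (AM 0).
have ta t : 0 <= clamp t * a <= a.
  have /andP[c0 c1] := clamp01 t; rewrite mulr_ge0//= -[X in _ <= X]mul1r.
  exact: ler_wpM2r.
have tz t s : cabs ((clamp t * a)%:C * ecirc s) <= a.
  by rewrite cabs_mulcirc cabsR_ge0; case/andP: (ta t).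
have tz1 t s : cabs ((clamp t * a)%:C * ecirc s) < 1 := le_lt_trans (tz t s) a1.
have a01 : 0 <= a < 1 by rewrite a0.
have [B [B0 hB]] := analytic_bounded ak a01.
have [L [L0 hL]] := analytic_lipschitz ak a01.
pose f (s t : RR) : RR := cRe (A t * k ((clamp t * a)%:C * ecirc s)).
have cont_s t : continuous (f ^~ t).
  move=> s; apply: ccont_Re; apply: ccontM; first exact: ccont_cst.
  apply: ccont_comp (analyticP ak (tz1 t s)) _.
  by apply: ccontM; [exact: ccont_cst|exact: ccont_ecirc].
have cont_t s : continuous (f s).
  move=> t; apply: ccont_Re; apply: ccontM; first exact: cA.
  apply: ccont_comp (analyticP ak (tz1 t s)) _.
  apply: ccontM; last exact: ccont_cst.
  apply: ccontP => /=; last exact: cst_continuous.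
  apply: (@contM_at RR); [exact: (@continuous_clamp RR)|exact: cst_continuous].
have fM s t : `|f s t| <= M * B.
  apply: le_trans (Re_le_cabs _) _; rewrite cabsM.
  by apply: ler_pM => //; rewrite ?cabs_ge0//; exact: hB.
have lip s s' t : `|f s t - f s' t| <= (M * (L * (2 * pi)) * `|s - s'|) `^ 1.
  have pi0 : 0 <= pi :> RR by exact: pi_ge0.
  rewrite powRr1; last by rewrite !mulr_ge0.
  rewrite /f -cReB -mulrBr; apply: le_trans (Re_le_cabs _) _; rewrite cabsM -!mulrA.
  apply: ler_pM => //; rewrite ?cabs_ge0//; apply: le_trans (hL _ _ (tz t s) (tz t s')) _.
  apply: ler_wpM2l => //; rewrite -mulrBr cabsM cabsR_ge0; last by case/andP: (ta t).
  rewrite mulrA; apply: le_trans (ecirc_lip s s'); rewrite -[X in _ <= X]mul1r.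
  by apply: ler_wpM2r; [exact: cabs_ge0|apply: le_trans (ltW a1); case/andP: (ta t)].
have cm1 : continuous (fun s => mean (f s)).
  apply: (continuous_mean_param (K := M * (L * (2 * pi))) ltr01 _ cont_t lip).
  by rewrite !mulr_ge0// pi_ge0.
(* For fixed t the argument of k runs over a circle about 0, so this is the mean value property. *)
have avgE t : mean (f ^~ t) = cRe (A t * k 0).
  have hol z : cabs (z - 0) <= cabs (clamp t * a)%:C -> exists d, has_cderiv k z d.
    rewrite subr0 => hz; exists (cderiv k z); apply: analyticP => //.
    apply: le_lt_trans hz (le_lt_trans _ a1); rewrite cabsR_ge0; by case/andP: (ta t).
  have := circle_mean hol => cm.
  have cc : ccont_on 0 1 (fun s => k (0 + (clamp t * a)%:C * ecirc s)).
    move=> s _; rewrite (_ : (fun s => _) = (fun s => k ((clamp t * a)%:C * ecirc s))).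
      apply: ccont_comp (analyticP ak (tz1 t s)) _.
      by apply: ccontM; [exact: ccont_cst|exact: ccont_ecirc].
    by apply/funext => s'; rewrite add0r.
  rewrite -cm /cmean -(cintZ _ cc) /mean /=; congr rint; apply/funext => s.
  by rewrite add0r.
have cm2 : continuous (fun t => mean (f ^~ t)).
  rewrite (_ : (fun t => _) = (fun t => cRe (A t * k 0))); last by apply/funext => t; exact: avgE.
  by move=> t; apply: ccont_Re; apply: ccontM; [exact: cA|exact: ccont_cst].
have sw := @mean_swap RR f (M * B) fM cont_s cont_t cm1 cm2.
have -> : (fun t => cRe (A t * k 0)) = (fun t => mean (f ^~ t)) by apply/funext => t; rewrite avgE.
rewrite -sw; exact: (@mean_abs_le RR _ _ cm1 hQ).
Qed.

(* For b = a e^(is) and t in [0, 1] the value F_b(t b) does not depend on s; [ray_weight] collects it with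
   the moduli of (t b)^N and b. *)
Definition ray (a t : RR) : RR := clamp t * a.

Definition ray_weight (a : RR) (n N : nat) (t : RR) : RR := ray a t ^+ N * a / (1 - a * ray a t) ^+ n.+1.

Lemma ray_bounds (a t : RR) : 0 <= a -> 0 <= ray a t <= a.
Proof.
move=> a0; have /andP[c0 c1] := clamp01 t; rewrite mulr_ge0//= -[X in _ <= X]mul1r.
exact: ler_wpM2r.
Qed.

Lemma ccont_ray (a t : RR) : ccont (fun t => (ray a t)%:C) t.
Proof.
apply: ccontP => /=; last exact: cst_continuous.
by apply: (@contM_at RR); [exact: (@continuous_clamp RR)|exact: cst_continuous].
Qed.

Lemma cconjR (a : RR) : cconj a%:C = a%:C.
Proof. by rewrite /cconj /= oppr0. Qed.

Lemma ray_weightE (a t : RR) n N :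
  (ray_weight a n N t)%:C = testfun a%:C n (ray a t)%:C * (ray a t)%:C ^+ N * a%:C.
Proof.
rewrite /ray_weight /testfun cconjR; move: (ray a t) => r.
have -> : 1 - a%:C * r%:C = (1 - a * r)%:C :> CC.
  by rewrite [LHS]cReImE cReB cImB cReM cImM /=; congr Complex; ring.
rewrite rmorphM /= fmorphV /= rmorphM /= !rmorphXn /=.
by rewrite mulrC mulrA.
Qed.

Lemma ccont_ray_weight (a t : RR) n N : 0 <= a < 1 -> ccont (fun t => (ray_weight a n N t)%:C) t.
Proof.
move=> /andP[a0 a1].
have -> : (fun t => (ray_weight a n N t)%:C) =
    (fun t => testfun a%:C n (ray a t)%:C * (ray a t)%:C ^+ N * a%:C).
  by apply/funext => u; exact: ray_weightE.
have ca1 : cabs a%:C < 1 by rewrite cabsR_ge0.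
have /andP[r0 ra] := ray_bounds t a0.
have r1 : cabs (ray a t)%:C < 1 by rewrite cabsR_ge0//; exact: le_lt_trans a1.
apply: ccontM; last exact: ccont_cst.
apply: ccontM.
  exact: (ccont_comp (f := testfun a%:C n) (g := fun s => (ray a s)%:C) (has_cderiv_test n ca1 r1) (ccont_ray a t)).
exact: (ccont_comp (f := fun z => z ^+ N) (g := fun s => (ray a s)%:C) (has_cderivX (ray a t)%:C N) (ccont_ray a t)).
Qed.

Lemma ray_weight_bounds (a t : RR) n N : 0 <= a < 1 -> 0 <= ray_weight a n N t <= ((1 - a) ^+ n.+1)^-1.
Proof.
move=> /andP[a0 a1]; have /andP[r0 ra] := ray_bounds t a0.
have r1 : ray a t <= 1 := le_trans ra (ltW a1).
have d0 : 0 < 1 - a by rewrite subr_gt0.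
have ar : a * ray a t <= a by rewrite -[X in _ <= X]mulr1 ler_wpM2l.
have d1 : 1 - a <= 1 - a * ray a t by rewrite lerD2l lerN2.
have d2 : 0 < 1 - a * ray a t := lt_le_trans d0 d1.
apply/andP; split.
  by apply: divr_ge0; [exact: mulr_ge0 (exprn_ge0 _ r0) a0|rewrite exprn_ge0// ltW].
rewrite /ray_weight -[X in _ <= X]mul1r; apply: ler_pM.
- exact: mulr_ge0 (exprn_ge0 _ r0) a0.
- by rewrite invr_ge0 exprn_ge0// ltW.
- rewrite -[X in _ <= X]mulr1; apply: ler_pM; rewrite ?exprn_ge0// ?(ltW a1)//.
  by rewrite exprn_ile1.
- by rewrite lef_pV2 ?posrE ?exprn_gt0// lerXn2r// nnegrE ltW.
Qed.

Lemma ray_factor_identity (K : comNzRingType) (F h e b c : K) (N : nat) :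
  F * ((b * e) ^+ N * h) * (c * e) = e ^+ N.+1 * (F * b ^+ N * c * h).
Proof. by rewrite exprMn exprS; ring. Qed.

Lemma ray_conj_identity (K : fieldType) (a e t : K) : e != 0 -> a * e^-1 * (t * (a * e)) = a * (t * a).
Proof. by move=> e0; field. Qed.

(** Rotating b by e^(is) leaves F_b(t b) alone and multiplies (t b)^N b by the unimodular constant
    e^(i(N+1)s); afterwards only the argument of k depends on s. *)
Lemma Tg_test_ray (g k : CC -> CC) (N n : nat) (a s : RR) : analytic_disc k ->
  (forall z, cderiv g z = z ^+ N * k z) -> 0 <= a < 1 ->
  Tg g (testfun (a%:C * ecirc s) n) (a%:C * ecirc s) = ecirc s ^+ N.+1 *
  cint 0 1 (fun t => (ray_weight a n N t)%:C * k ((ray a t)%:C * ecirc s)).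
Proof.
move=> ak gk ha; have /andP[a0 a1] := ha.
rewrite -cintZ; last first.
  move=> t _; apply: ccontM; first exact: ccont_ray_weight.
  have /andP[r0 ra] := ray_bounds t a0.
  have z1 : cabs ((ray a t)%:C * ecirc s) < 1.
    by rewrite cabs_mulcirc cabsR_ge0//; exact: le_lt_trans a1.
  apply: ccont_comp (analyticP ak z1) _.
  by apply: ccontM; [exact: ccont_ray|exact: ccont_cst].
have -> : Tg g (testfun (a%:C * ecirc s) n) (a%:C * ecirc s) =
   cint 0 1 (fun t => testfun (a%:C * ecirc s) n (t%:C * (a%:C * ecirc s)) *
     cderiv g (t%:C * (a%:C * ecirc s)) * (a%:C * ecirc s)) by [].
apply: eq_cint => t ht.
have rE : ray a t = t * a by rewrite /ray clamp_id.
have tE : testfun (a%:C * ecirc s) n (t%:C * (a%:C * ecirc s)) = testfun a%:C n (ray a t)%:C.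
  rewrite /testfun; congr ((1 - _) ^+ _)^-1; rewrite cconjR rE.
  have -> : cconj (a%:C * ecirc s) = a%:C * cconj (ecirc s).
    by rewrite /cconj cReM cImM /=; congr Complex; ring.
  rewrite ecirc_conj rmorphM /=; exact: ray_conj_identity (ecirc_neq0 s).
rewrite tE gk ray_weightE.
have zE : t%:C * (a%:C * ecirc s) = (ray a t)%:C * ecirc s by rewrite mulrA -rmorphM -rE.
rewrite zE.
exact: ray_factor_identity.
Qed.

(** Only t in [a, 1] is kept, an interval of length 1 - a: there t a >= 1/4, and 1 - a (t a) <= 1 -
    a^3 <= 3 (1 - a). *)
Lemma ray_weight_mean_ge (a : RR) n N : 1 / 2 <= a < 1 ->
  (1 / 4) ^+ N * (1 / 2) / 3 ^+ n.+1 * (1 - a) ^- n <= mean (ray_weight a n N).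
Proof.
move=> ha; have a0 : 0 <= a by lra.
have a1 : a < 1 by lra.
have ha' : 0 <= a < 1 by rewrite a0.
have d0 : 0 < 1 - a by lra.
have cw : continuous (ray_weight a n N).
  by move=> t; have := ccont_Re (ccont_ray_weight t n N ha').
pose c := (1 / 4) ^+ N * (1 / 2) / (3 * (1 - a)) ^+ n.+1.
have cE : (1 / 4) ^+ N * (1 / 2) / 3 ^+ n.+1 * (1 - a) ^- n = c * (1 - a).
  rewrite /c [(3 * _) ^+ _]exprMn [(1 - a) ^+ n.+1]exprS.
  have v0 : (1 - a) ^+ n != 0 by rewrite expf_neq0// gt_eqF.
  have t0 : 3 ^+ n.+1 != 0 :> RR by rewrite expf_neq0.
  have b0 : 1 - a != 0 by rewrite gt_eqF.
  move: ((1 / 4) ^+ N * (1 / 2)) (3 ^+ n.+1) (1 - a) ((1 - a) ^+ n) v0 t0 b0 => u t b v v0 t0 b0.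
  by field; rewrite v0 t0 b0.
rewrite cE /mean (@rint_split RR 0 a 1 _ a0 (ltW a1)); last by move=> t _; exact: cw.
rewrite -[X in X <= _]add0r; apply: lerD.
  by apply: (@rint_ge0 RR) => t _; case/andP: (ray_weight_bounds t n N ha').
rewrite -(@rint_cst RR a 1 c (ltW a1)); apply: (@le_rint RR).
- exact: (@cont_cst RR).
- by move=> t _; exact: cw.
move=> t /andP[ta t1]; have t01 : 0 <= t <= 1 by rewrite (le_trans a0 ta).
rewrite /ray_weight /ray (clamp_id t01).
have r4 : 1 / 4 <= t * a by nra.
have q0 : 0 <= (1 / 4) ^+ N * (1 / 2) :> RR by apply: mulr_ge0; [apply: exprn_ge0|]; lra.
have b0 : 0 < 1 - a * (t * a) by nra.
have h1 : a * (a * a) <= a * (t * a) by apply: (ler_wpM2l a0); apply: (ler_wpM2r a0).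
have h3 : 0 <= (1 - a) * (1 - a) * (a + 2) by apply: mulr_ge0; [apply: mulr_ge0; exact: ltW|lra].
have b3 : 1 - a * (t * a) <= 3 * (1 - a).
  by move: h1 h3; clear => h1 h3; nra.
apply: ler_pM => //.
- by rewrite invr_ge0 exprn_ge0// mulr_ge0// ltW.
- apply: ler_pM; [by apply: exprn_ge0; clear; lra|by clear; lra| |by clear -ha; lra].
  by apply: lerXn2r; rewrite ?nnegrE; clear -r4; lra.
- have b3' : 0 < 3 * (1 - a) by rewrite mulr_gt0.
  rewrite lef_pV2 ?posrE; [|exact: exprn_gt0|exact: exprn_gt0].
  by apply: lerXn2r b3; rewrite nnegrE; exact: ltW.
Qed.

Lemma T_phi_bounded p w g : 0 < p < 1 -> radial_weight w -> Dhat w ->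
  T_Dp_Hinf p w g -> ~ (forall z, cabs z < 1 -> g z = g 0) -> phi_bounded p w.
Proof.
move=> hp hw hD [ag [K hK]] gn; have [n [C C0 hC]] := testfun_norm hp hw hD.
have adg := cderiv_analytic ag.
have [N [k [ak gk k0]]] : exists N k, [/\ analytic_disc k, forall z, cderiv g z = z ^+ N * k z & k 0 != 0].
  by apply: analytic_factor adg _ => h; apply: gn; exact: constant_of_cderiv0.
pose m := cabs (k 0); have m0 : 0 < m by rewrite cabs_gt0.
(* Multiplying by the conjugate makes k1(0) = |k(0)|^2 real and positive, so that taking real parts
   loses nothing. *)
pose k1 (z : CC) := cconj (k 0) * k z.
have ak1 : analytic_disc k1.
  apply: analytic_disc_hol => z z1; exists (cconj (k 0) * cderiv k z).
  exact: has_cderivZ (analyticP ak z1).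
pose c := (1 / 4) ^+ N * (1 / 2) / 3 ^+ n.+1 : RR.
have c0 : 0 < c by rewrite /c !divr_gt0 ?mulr_gt0 ?exprn_gt0 ?divr_gt0.
pose K1 := Num.max K 0; have K10 : 0 <= K1 by rewrite le_max lexx orbT.
apply: (@phi_bounded_of_test p w n (K1 * C) (m * c)) => //; [exact: mulr_gt0|exact: mulr_ge0|].
move=> a ha; have a0 : 0 <= a by lra.
have ha' : 0 <= a < 1 by lra.
have a1 : a < 1 by lra.
pose Q := m * (K1 * (C * test_size p w n a)).
have key : `|mean (fun t => cRe ((ray_weight a n N t)%:C * k1 0))| <= Q.
  apply: (mean_ray_average (M := ((1 - a) ^+ n.+1)^-1) ak1 ha').
  - by move=> t; exact: ccont_ray_weight.
  - by move=> t; have /andP[h1 h2] := ray_weight_bounds t n N ha'; rewrite cabsR_ge0.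
  move=> s; pose b := a%:C * ecirc s.
  have cb : cabs b = a by rewrite cabs_mulcirc cabsR_ge0.
  have cb1 : cabs b < 1 by rewrite cb.
  have [inD nD] := hC _ cb1; rewrite cb in nD.
  have := hK _ inD _ cb1; rewrite (@Tg_test_ray g k N n a s ak gk ha') cabsM cabsX cabs_ecirc expr1n mul1r.
  set I := cint _ _ _ => hI.
  have cI : ccont_on 0 1 (fun t => (ray_weight a n N t)%:C * k ((ray a t)%:C * ecirc s)).
    move=> t _; apply: ccontM; first exact: ccont_ray_weight.
    have /andP[r0 ra] := ray_bounds t a0.
    have z1 : cabs ((ray a t)%:C * ecirc s) < 1.
      by rewrite cabs_mulcirc cabsR_ge0//; exact: le_lt_trans a1.
    apply: ccont_comp (analyticP ak z1) _.
    by apply: ccontM; [exact: ccont_ray|exact: ccont_cst].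
  have -> : mean (fun t => cRe ((ray_weight a n N t)%:C * k1 ((clamp t * a)%:C * ecirc s))) =
      cRe (cconj (k 0) * I).
    rewrite /I -(cintZ _ cI) /mean /=; congr rint; apply/funext => t.
    by rewrite /k1 mulrCA.
  apply: le_trans (Re_le_cabs _) _; rewrite cabsM cabs_conj /Q -/m.
  apply: ler_wpM2l (ltW m0) _ _ _; apply: le_trans hI _.
  have N0 : 0 <= norm_Dp p w (testfun b n) by exact: powR_ge0.
  apply: (@le_trans _ _ (K1 * norm_Dp p w (testfun b n))).
    by apply: ler_wpM2r N0 _ _ _; rewrite le_max lexx.
  exact: ler_wpM2l K10 _ _ nD.
have k1E : k1 0 = (m ^+ 2)%:C by rewrite /k1 mulrC mulc_conj.
have cw : continuous (ray_weight a n N).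
  by move=> t; have := ccont_Re (ccont_ray_weight t n N ha').
have mE : mean (fun t => cRe ((ray_weight a n N t)%:C * k1 0)) = m ^+ 2 * mean (ray_weight a n N).
  rewrite -(@meanZ RR _ _ cw); congr mean; apply/funext => t.
  by rewrite k1E cReM /= mulr0 subr0 mulrC.
have lo := ray_weight_mean_ge n N ha; rewrite -/c in lo.
have : m ^+ 2 * mean (ray_weight a n N) <= Q by rewrite -mE; apply: le_trans (ler_norm _) key.
rewrite /Q expr2 -mulrA ler_pM2l// => up.
rewrite -mulrA; apply: le_trans (_ : m * mean (ray_weight a n N) <= _); first by rewrite ler_pM2l.
by rewrite -mulrA.
Qed.

(** * The series condition *)

Lemma phi_ge0 p w r : 0 <= phi p w r.
Proof. by apply: divr_ge0; exact: powR_ge0. Qed.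

Lemma phi_sup_infty p w :
  ereal_sup [set (phi p w r)%:E | r in `[0, 1[] = +oo%E <-> ~ phi_bounded p w.
Proof.
set S := [set _ | _ in _]; split.
  move=> Soo [B hB]; have : (ereal_sup S <= B%:E)%E.
    by apply: ge_ereal_sup => _ [r /= + <-]; rewrite in_itv /= lee_fin => hr; exact: hB.
  by rewrite Soo leye_eq.
move=> nb; apply/eqP/negPn/negP => Sfin; apply: nb.
have Sle r : 0 <= r < 1 -> ((phi p w r)%:E <= ereal_sup S)%E.
  by move=> hr; apply: ereal_sup_ubound; exists r => //=; rewrite in_itv.
exists (fine (ereal_sup S)) => r hr; have := Sle r hr.
rewrite -lee_fin fineK// ge0_fin_numE ?ltey//.
by apply: le_trans (Sle r hr); rewrite lee_fin phi_ge0.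
Qed.

Definition series_term (p : RR) (w : RR -> RR) (r : RR) (k : nat) : RR :=
  r ^+ (2 * k.-1) / (omega_hat w (1 - k%:R^-1) `^ p^-1 * k%:R `^ (2 - p^-1)).

Definition weighted_series (p : RR) (w : RR -> RR) (r : RR) : \bar RR :=
  ((1 - r)%:E * \sum_(1 <= k <oo) (series_term p w r k)%:E)%E.

Lemma series_termE p w r k : series_term p w r k = r ^+ (2 * k.-1) * phi p w (1 - k%:R^-1).
Proof.
rewrite /series_term /phi; congr (_ * _).
by rewrite subKr powRV ?ler0n// invfM mulrC.
Qed.

Lemma series_term_ge0 p w r k : 0 <= r -> 0 <= series_term p w r k.
Proof. by move=> r0; rewrite series_termE mulr_ge0 ?phi_ge0// exprn_ge0. Qed.

Lemma inv_nat01 (R : realType) k : (0 < k)%N -> 0 <= (1 - k%:R^-1 : R) < 1.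
Proof.
move=> k0; have k0' : 0 < k%:R :> R by rewrite ltr0n.
by rewrite subr_ge0 invf_le1// ler1n k0 gtrBl invr_gt0.
Qed.

(** Since r^(2k) <= r^k, the sum is at most B times a geometric series, that is B / (1 - r). *)
Lemma weighted_series_le p w B r : (forall r, 0 <= r < 1 -> phi p w r <= B) -> 0 <= r < 1 ->
  (weighted_series p w r <= B%:E)%E.
Proof.
move=> hB hr; have /andP[r0 r1] := hr.
have B0 : 0 <= B by apply: le_trans (hB r hr); exact: phi_ge0.
have d0 : 0 < 1 - r by rewrite subr_gt0.
have part n : \sum_(1 <= k < n) series_term p w r k <= B / (1 - r).
  rewrite big_add1 big_mkord; apply: (@le_trans _ _ (\sum_(k < n.-1) B * r ^+ k)).
    apply: ler_sum => k _; rewrite series_termE /= mulrC; apply: ler_pM; rewrite ?phi_ge0 ?exprn_ge0//.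
      exact/hB/inv_nat01.
    by rewrite mul2n -addnn exprD -[X in _ <= X]mulr1 ler_wpM2l ?exprn_ge0// exprn_ile1// ltW.
  rewrite -mulr_sumr; apply: ler_wpM2l => //; rewrite -div1r ler_pdivlMr// mulrC.
  have := subrX1 r n.-1; have := exprn_ge0 n.-1 r0.
  move: (r ^+ _) (\sum_(i < _) _) => y z y0 yz.
  by have -> : (1 - r) * z = 1 - y; lra.
have -> : B%:E = ((1 - r)%:E * (B / (1 - r))%:E)%E.
  by rewrite -EFinM mulrCA mulfV ?mulr1// gt_eqF.
apply: lee_wpmul2l; first by rewrite lee_fin ltW.
apply: lime_le.
  by apply: is_cvg_nneseries => k _ _; rewrite lee_fin series_term_ge0.
by apply: nearW => n; rewrite sumEFin lee_fin.
Qed.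

Lemma bernoulli_ge (R : realType) (y : R) m : 0 <= y <= 1 -> 1 - m%:R * y <= (1 - y) ^+ m.
Proof.
move=> hy; elim: m => [|m IH]; first by rewrite mul0r subr0 expr0.
rewrite exprS; have d0 : 0 <= 1 - y by lra.
apply: le_trans (ler_wpM2l d0 IH); rewrite -natr1.
have : 0 <= m%:R * (y * y) :> R by rewrite mulr_ge0// mulr_ge0//; lra.
by lra.
Qed.

(** The ratio u / v lies in [1/2, 1], so its power e is at least its power |e|, whatever the sign of
    e. *)
Lemma powR_ratio_ge (R : realType) (u v e : R) : 0 < v -> u <= v -> v / 2 <= u ->
  2^-1 `^ `|e| * v `^ e <= u `^ e.
Proof.
move=> v0 uv vu; have u0 : 0 < u by lra.
have -> : u = u / v * v by rewrite divfK// gt_eqF.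
have r0 : 0 < u / v by rewrite divr_gt0.
rewrite [X in _ <= X](powRM _ (ltW r0) (ltW v0)); apply: ler_wpM2r; first exact: powR_ge0.
apply: (@le_trans _ _ ((u / v) `^ `|e|)).
  by apply: ge0_ler_powR; rewrite ?nnegrE ?(ltW r0)// ler_pdivlMr//; lra.
by apply: ger_powR; [rewrite r0 ler_pdivrMr// mul1r|exact: ler_norm].
Qed.

(** Take K the integer part of 1/(1 - s) and r = 1 - y with y = 1/(8K). For K < k <= 2K, 1/k lies
    between (1 - s)/2 and 1 - s, so phi(1 - 1/k) is comparable with phi(s), and r^(2(k-1)) >= (1 -
    y)^(4K) >= 1 - 4Ky = 1/2. The K terms carry the mass yK/2 = 1/16. *)
Lemma phi_le_weighted_series p w s : 0 < p -> radial_weight w -> 0 <= s < 1 ->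
  exists2 r : RR, 0 <= r < 1 &
    ((2^-1 `^ `|2 - p^-1| / 16 * phi p w s)%:E <= weighted_series p w r)%E.
Proof.
move=> p0 hw hs; have /andP[s0 s1] := hs; have [_ _ W0] := hw.
have d0 : 0 < 1 - s by rewrite subr_gt0.
pose K := Num.truncn (1 - s)^-1.
have K2 : (1 - s)^-1 < K.+1%:R by exact: truncnS_gt.
have Kle : K%:R <= (1 - s)^-1 by rewrite truncn_le// invr_ge0 ltW.
have K0 : (0 < K)%N by rewrite truncn_gt0 invf_ge1// gerBl.
have K0' : 0 < K%:R :> RR by rewrite ltr0n.
pose y : RR := (8 * K%:R)^-1.
have y0 : 0 < y by rewrite invr_gt0 mulr_gt0.
have yK : y * K%:R = 1 / 8.
  by rewrite /y invfM -mulrA mulVf ?gt_eqF// mulr1 div1r.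
have K1 : 1 <= K%:R :> RR by rewrite ler1n.
have y1 : y <= 1 / 8 by rewrite -yK -[X in X <= _]mulr1 ler_wpM2l// ltW.
have hr : 0 <= 1 - y < 1 by lra.
have r0 : 0 <= 1 - y by lra.
exists (1 - y) => //.
set c := 2^-1 `^ _.
have c0 : 0 <= c by exact: powR_ge0.
have term k : (K < k <= K + K)%N -> 1 / 2 * (c * phi p w s) <= series_term p w (1 - y) k.
  move=> /andP[Kk kK]; have k0 : (0 < k)%N by exact: leq_ltn_trans Kk.
  have k0' : 0 < k%:R :> RR by rewrite ltr0n.
  rewrite series_termE; apply: ler_pM; [by clear; lra|by rewrite mulr_ge0 ?phi_ge0| |].
    apply: (@le_trans _ _ ((1 - y) ^+ (4 * K))).
      apply: le_trans (bernoulli_ge (4 * K) _); last by clear -y0 y1; lra.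
      by rewrite natrM -mulrA [K%:R * y]mulrC yK; clear; lra.
    apply: ler_wiXn2l => //; first by clear -y0 y1; lra.
    rewrite (leq_trans (_ : _ <= 2 * k)%N)//; first by rewrite leq_mul2l leq_pred orbT.
    by rewrite -(mulnA 2 2 K) leq_mul2l mul2n -addnn kK orbT.
  have hk := inv_nat01 RR k0.
  rewrite /phi subKr mulrA; apply: ler_pM.
  - by rewrite mulr_ge0// powR_ge0.
  - by rewrite invr_ge0 powR_ge0.
  - apply: powR_ratio_ge => //.
      rewrite -[X in _ <= X]invrK lef_pV2 ?posrE ?invr_gt0//.
      by apply: le_trans (ltW K2) _; rewrite ler_nat.
    have h1 : (1 - s) * K%:R <= 1 by rewrite mulrC -ler_pdivlMr// div1r.
    rewrite -[X in _ <= X]div1r ler_pdivlMr//; have : k%:R <= K%:R + K%:R :> RR by rewrite -natrD ler_nat.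
    by move: d0 h1; move: (1 - s) => d d0 h1 hk2; nra.
  - have sk : s <= 1 - k%:R^-1.
      rewrite lerBrDr -lerBrDl -[X in _ <= X]invrK lef_pV2 ?posrE ?invr_gt0//.
      by apply: le_trans (ltW K2) _; rewrite ler_nat.
    have Wk := W0 _ hk; have Ws := W0 _ hs.
    rewrite lef_pV2 ?posrE; [|exact: powR_gt0|exact: powR_gt0].
    apply: powR_le (ltW Wk) _; first by rewrite invr_gt0.
    by apply: omega_hat_mono hw _ _; [rewrite s0|case/andP: hk].
have tge0 k : (1 <= k)%N -> true -> (0 <= (series_term p w (1 - y) k)%:E)%E.
  by move=> _ _; rewrite lee_fin series_term_ge0.
have le1 := nneseries_lim_ge (K + K).+1 tge0.
rewrite sumEFin in le1.
rewrite /weighted_series subKr.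
apply: (@le_trans _ _ (y%:E * (\sum_(1 <= k < (K + K).+1) series_term p w (1 - y) k)%:E)%E); last first.
  by apply: lee_wpmul2l le1; rewrite lee_fin ltW.
rewrite -EFinM lee_fin (@big_cat_nat _ _ _ K.+1)//=; last by rewrite ltnS leq_addr.
apply: (@le_trans _ _ (y * (0 + 1 / 2 * (c * phi p w s) *+ K))).
  rewrite add0r -[_ *+ K]mulr_natl [y * _]mulrA yK.
  by rewrite le_eqVlt; apply/orP; left; apply/eqP; field.
apply: ler_wpM2l; first exact: ltW.
apply: lerD; first by apply: sumr_ge0 => k _; exact: series_term_ge0.
have -> : 1 / 2 * (c * phi p w s) *+ K = \sum_(K.+1 <= k < (K + K).+1) (1 / 2 * (c * phi p w s)).
  by rewrite sumr_const_nat subSS addnK.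
by apply: ler_sum_nat => k; rewrite ltnS; exact: term.
Qed.

Lemma weighted_series_sup_infty p w : 0 < p -> radial_weight w ->
  ereal_sup [set weighted_series p w r | r in `[0, 1[] = +oo%E <-> ~ phi_bounded p w.
Proof.
move=> p0 hw; set S := [set _ | _ in _]; split.
  move=> Soo [B hB]; have : (ereal_sup S <= B%:E)%E.
    by apply: ge_ereal_sup => _ [r /= + <-]; rewrite in_itv /= => hr; exact: weighted_series_le.
  by rewrite Soo leye_eq.
move=> nb; apply/eqP/negPn/negP => Sfin; apply: nb.
pose c : RR := 2^-1 `^ `|2 - p^-1| / 16.
have c0 : 0 < c by rewrite divr_gt0// powR_gt0// invr_gt0.
have Sle s : 0 <= s < 1 -> ((c * phi p w s)%:E <= ereal_sup S)%E.
  move=> hs; have [r hr le] := phi_le_weighted_series p0 hw hs.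
  apply: le_trans le _; apply: ereal_sup_ubound; exists r => //=; by rewrite in_itv.
exists (fine (ereal_sup S) / c) => s hs; rewrite ler_pdivlMr// mulrC.
rewrite -lee_fin fineK ?Sle// ge0_fin_numE ?ltey//.
by apply: le_trans (Sle s hs); rewrite lee_fin mulr_ge0 ?phi_ge0// ltW.
Qed.

Theorem mainTheorem1 (p : RR) (omega : RR -> RR) :
  0 < p < 1 -> radial_weight omega -> Dhat omega ->
  [<->
    (* (i) T(D^p_omega, H^oo) consists of constant functions only *)
    (forall g : CC -> CC, T_Dp_Hinf p omega g ->
       forall z : CC, cabs z < 1 -> g z = g 0);
    (* (ii) *)
    ereal_sup [set ((1 - r) `^ (2 - p^-1) / omega_hat omega r `^ (p^-1))%:E
               | r in `[0, 1[] = +oo%E;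
    (* (iii) *)
    ereal_sup [set ((1 - r)%:E *
                    \sum_(1 <= k <oo)
                      ((r ^+ (2 * k.-1)) /
                       (omega_hat omega (1 - k%:R^-1) `^ (p^-1)
                        * k%:R `^ (2 - p^-1)))%:E)%E
               | r in `[0, 1[] = +oo%E;
    (* (iv) the identity D^p_omega -> D^1_0 is not bounded *)
    ~ identity_bounded_Dp_D10 p omega].
Proof.
move=> hp hw hD; have [p0 p1] := andP hp.
tfae.
(* A bounded phi would put the identity function into T(D^p_omega, H^oo); comparing its values at
   1/2 and 0 shows that it is not constant. *)
- move=> T_const; apply/phi_sup_infty => /(phi_bounded_Tid hp hw)/T_const id_const.
  have h : cabs (2^-1)%:C < 1 by rewrite cabsR_ge0; lra.
  have := congr1 cRe (id_const _ h) => /= /eqP; rewrite invr_eq0; apply/negP; lra.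
- by move=> /phi_sup_infty nb; apply/weighted_series_sup_infty.
- move=> /(weighted_series_sup_infty p0 hw) nb emb; apply: nb.
  exact: embedding_phi_bounded emb.
- move=> nemb g Tg; apply: contrapT => gn; apply: nemb.
  apply: phi_bounded_embedding => //; exact: T_phi_bounded Tg gn.
Qed.
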